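(* Let $F_1(\tau)=\theta_2(\tau)\theta_3(\tau)^8\theta_4(\tau)$ for $\tau$ in the upper half-plane, and let $$R_1(X):=\int_0^{i\infty}F_1(\tau)(\tau-X)^3\,d\tau$$ be its period polynomial (a polynomial in $X$ with complex coefficients). Then $$R_1(X)=R_1(0)(1-X^2)(1+iX).$$
   Context: For $\tau$ in the upper half-plane $\mathbb{H}$ put $\mathfrak q=e^{\pi i\tau}$. The theta constants are $$\theta_2(\tau)=\sum_{n\in\mathbb Z}\mathfrak q^{(n+1/2)^2},\qquad \theta_3(\tau)=\sum_{n\in\mathbb Z}\mathfrak q^{n^2},\qquad \theta_4(\tau)=\sum_{n\in\mathbb Z}(-1)^n\mathfrak q^{n^2},$$ where $\mathfrak q^{(n+1/2)^2}$ means $e^{\pi i\tau(n+1/2)^2}$. The integral from $0$ to $i\infty$ is taken along the positive imaginary axis. *)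

(* Defs.v *)
From Stdlib Require Import Reals ZArith.
From Coquelicot Require Import Coquelicot.

Local Open Scope C_scope.

Definition Cexp (z : C) : C := RtoC (exp (Re z)) * (cos (Im z), sin (Im z)).

Definition CSeries (a : nat -> C) : C :=
  (Series (fun n => Re (a n)), Series (fun n => Im (a n))).

(** Sum over all integers: the indices [0, 1, 2, ...] and then
    [-1, -2, -3, ...].  The theta series converge absolutely when
    [0 < Im tau], so the order of summation does not matter there; outside the
    upper half-plane the values below carry no meaning. *)
Definition ZSeries (a : Z -> C) : C :=
  CSeries (fun n => a (Z.of_nat n)) + CSeries (fun n => a (- Z.of_nat (S n))%Z).

(** [nome_pow tau s] is [q ^ s] for [q = exp (i pi tau)], with the branch
    [exp (i pi tau s)]. *)
Definition nome_pow (tau : C) (s : R) : C := Cexp (RtoC PI * Ci * tau * RtoC s).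

Definition theta2 (tau : C) : C :=
  ZSeries (fun n => nome_pow tau ((IZR n + / 2) ^ 2)%R).

Definition theta3 (tau : C) : C :=
  ZSeries (fun n => nome_pow tau (IZR n ^ 2)%R).

Definition theta4 (tau : C) : C :=
  ZSeries (fun n => RtoC (powerRZ (-1) n) * nome_pow tau (IZR n ^ 2)%R).

(** Integrals from [0] to [i oo] along [tau = i t], [d tau = i d t], improper
    at both ends. *)
Definition imag_axis_pullback (f : C -> C) (t : R) : C := f (Ci * RtoC t) * Ci.

Definition ex_imag_axis_int (f : C -> C) : Prop :=
  @ex_RInt_gen C_R_CompleteNormedModule
    (imag_axis_pullback f) (at_right 0%R) (Rbar_locally p_infty).

Definition imag_axis_int (f : C -> C) : C :=
  @RInt_gen C_R_CompleteNormedModule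
    (imag_axis_pullback f) (at_right 0%R) (Rbar_locally p_infty).

Definition F_1 (tau : C) : C := theta2 tau * theta3 tau ^ 8 * theta4 tau.

Definition R_1 (X : C) : C := imag_axis_int (fun tau => F_1 tau * (tau - X) ^ 3).

(* Main.v *)
Require Import Defs.
From Stdlib Require Import Reals ZArith Lra Lia.
From Coquelicot Require Import Coquelicot.

(** Write [M k] for the integral of [F_1 (i t) t^k] over [t > 0].  Expanding the
    cube gives [R_1 X = M 3 + 3 i X M 2 - 3 X^2 M 1 - i X^3 M 0], so the formula
    amounts to the three relations [M 3 = M 0], [M 2 = M 1] and [M 0 = 3 M 1].

    The first two are the behaviour of [F_1] under [tau -> -1/tau]: by
    [F_1_inversion], [F_1 (i / t) = t^5 F_1 (i t)], and substituting [1/t] for [t]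
    exchanges [M k] and [M (3 - k)] ([moment_symmetry]).

    The third one says that [R_1 (-1) = 0] and comes from the cusp [-1].  The
    substitution [u = -1/(tau + 1)] sends this cusp to infinity and turns
    [F_1 tau (tau + 1)^3 dtau] into a constant times [G u du], where
    [G = theta2^8 theta3 theta4] is [F_cusp] ([F_1_arc]); the cube is exactly what
    makes the automorphy factor disappear.  The imaginary axis becomes the half circle from
    [-1] to [0], whose two ends differ by the period [1] of [G].  Since [G] is a
    power series in [exp (2 pi i u)] without constant term, it has a primitive of
    period [1], so the integral over the half circle should vanish.  The ends of
    the half circle are cusps, so the integral is first truncated to
    [1/T <= t <= T].  Modulo the translation by [1], the two ends of the truncated
    half circle are then joined by a horizontal chord of length [2 / (1 + T^2)],
    and half circle and chord together have integral [0] ([closes_F_cusp]; for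
    the partial sums of the theta series this is a statement about finitely many
    exponentials).  In a sector at the cusp [0] the form [G] is bounded
    ([F_cusp_bound]), so the chord contributes nothing in the limit
    ([moment_relation]).

    All this rests on one fact about theta constants, Jacobi's inversion formula,
    on the imaginary axis for the moments and at complex arguments for the half
    circle ([theta_inversion]).  It is Poisson summation for
    [exp (- pi b^2 x^2)] with complex [b] ([poisson_gauss]).  The Fourier
    coefficients of the periodized Gaussian are found by moving the line of
    integration ([gauss_contour]), and a continuous function whose Fourier
    coefficients all vanish is zero ([fourier_uniqueness]).  This gives Poisson's
    formula up to the value of the Gaussian integral, and the self-dual case
    [b = 1] shows that this value is [1].

    The truncation to [1/T <= t <= T] is symmetric under [t -> 1/t], so the
    relations between the moments hold at each [T], the third one with an
    explicit error, and the limit is taken only at the end. *)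

Local Open Scope R_scope.

(** * Calculus of complex-valued functions *)

(** Continuity, derivatives and integrals refer to [C] as a real normed space;
    fixing that structure here keeps it from being inferred as the complex
    one. *)
Definition Ccontinuous {U : UniformSpace} (f : U -> C) (x : U) : Prop :=
  @continuous U C_R_NormedModule f x.

Definition Cderive_at (f : R -> C) (x : R) (l : C) : Prop :=
  @is_derive R_AbsRing C_R_NormedModule f x l.

Definition CInt (f : R -> C) (a b : R) : C :=
  @RInt C_R_CompleteNormedModule f a b.

Definition is_CInt (f : R -> C) (a b : R) (l : C) : Prop :=
  @is_RInt C_R_NormedModule f a b l.

Lemma C_norm_Cmod (z : C) : @norm R_AbsRing C_R_NormedModule z = Cmod z.
Proof. symmetry; exact (Cmod_norm z). Qed.

Lemma im_le_Cmod (z : C) : Rabs (Im z) <= Cmod z.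
Proof.
  destruct z as [x y]; apply Rle_trans with (2 := proj1 (sqrt_plus_sqr x y)).
  apply Rmax_r.
Qed.

Lemma Cmod_le_re_im (z : C) : Cmod z <= Rabs (Re z) + Rabs (Im z).
Proof.
  destruct z as [x y]; unfold Cmod, Re, Im; simpl fst; simpl snd.
  rewrite <- (Rabs_pos_eq (Rabs x + Rabs y)).
  2: generalize (Rabs_pos x) (Rabs_pos y); lra.
  rewrite <- sqrt_Rsqr_abs; apply sqrt_le_1_alt; unfold Rsqr.
  generalize (Rabs_pos x) (Rabs_pos y) (pow2_abs x) (pow2_abs y); nra.
Qed.

Lemma C_ext (z w : C) : Re z = Re w -> Im z = Im w -> z = w.
Proof. destruct z, w; simpl; intros -> ->; reflexivity. Qed.

Lemma Ci_square : (Ci * Ci = - (1))%C.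
Proof. apply C_ext; simpl; ring. Qed.

Lemma Ci_neq_0 : Ci <> 0%C.
Proof. intros e; injection e; lra. Qed.

Lemma scal_RtoC (c : R) (z : C) :
  @scal R_AbsRing C_R_NormedModule c z = (RtoC c * z)%C.
Proof.
  destruct z; apply C_ext; simpl; unfold scal; simpl; unfold mult; simpl; ring.
Qed.

Lemma Ccontinuous_pair {U : UniformSpace} (f : U -> C) (x : U) :
  continuous (fun y => Re (f y)) x -> continuous (fun y => Im (f y)) x ->
  Ccontinuous f x.
Proof.
  intros h1 h2. unfold Ccontinuous.
  apply continuous_ext with (f := fun y => (Re (f y), Im (f y))).
  { intros y; destruct (f y); reflexivity. }
  apply (continuous_comp_2 (fun y => Re (f y)) (fun y => Im (f y))
    (fun a b => (a, b)) x h1 h2).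
  apply continuous_ext with (f := fun p => p); [intros [? ?]; reflexivity|].
  apply continuous_id.
Qed.

Lemma Ccontinuous_re {U : UniformSpace} (f : U -> C) (x : U) :
  Ccontinuous f x -> continuous (fun y => Re (f y)) x.
Proof.
  intros h; apply (continuous_comp f (fun z : C => fst z) x h), continuous_fst.
Qed.

Lemma Ccontinuous_im {U : UniformSpace} (f : U -> C) (x : U) :
  Ccontinuous f x -> continuous (fun y => Im (f y)) x.
Proof.
  intros h; apply (continuous_comp f (fun z : C => snd z) x h), continuous_snd.
Qed.

Lemma Ccontinuous_const {U : UniformSpace} (c : C) (x : U) :
  Ccontinuous (fun _ => c) x.
Proof. apply continuous_const. Qed.

Lemma Ccontinuous_plus {U : UniformSpace} (f g : U -> C) (x : U) :
  Ccontinuous f x -> Ccontinuous g x -> Ccontinuous (fun y => f y + g y)%C x.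
Proof.
  intros hf hg; exact (@continuous_plus U R_AbsRing C_R_NormedModule f g x hf hg).
Qed.

Lemma Ccontinuous_opp {U : UniformSpace} (f : U -> C) (x : U) :
  Ccontinuous f x -> Ccontinuous (fun y => - f y)%C x.
Proof.
  intros hf; exact (@continuous_opp U R_AbsRing C_R_NormedModule f x hf).
Qed.

Lemma Ccontinuous_mult {U : UniformSpace} (f g : U -> C) (x : U) :
  Ccontinuous f x -> Ccontinuous g x -> Ccontinuous (fun y => f y * g y)%C x.
Proof.
  intros hf hg; apply Ccontinuous_pair; simpl.
  - apply (continuous_minus (V := R_NormedModule));
      apply (continuous_mult (K := R_AbsRing));
      first [now apply Ccontinuous_re | now apply Ccontinuous_im].
  - apply (continuous_plus (V := R_NormedModule));
      apply (continuous_mult (K := R_AbsRing));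
      first [now apply Ccontinuous_re | now apply Ccontinuous_im].
Qed.

Lemma Ccontinuous_minus {U : UniformSpace} (f g : U -> C) (x : U) :
  Ccontinuous f x -> Ccontinuous g x -> Ccontinuous (fun y => f y - g y)%C x.
Proof.
  intros hf hg; exact (@continuous_minus U R_AbsRing C_R_NormedModule f g x hf hg).
Qed.

Lemma Ccontinuous_pow {U : UniformSpace} (f : U -> C) (n : nat) (x : U) :
  Ccontinuous f x -> Ccontinuous (fun y => f y ^ n)%C x.
Proof.
  intros hf; induction n as [|n IH]; simpl.
  - apply Ccontinuous_const.
  - now apply Ccontinuous_mult.
Qed.

Lemma Ccontinuous_RtoC {U : UniformSpace} (f : U -> R) (x : U) :
  continuous f x -> Ccontinuous (fun y => RtoC (f y)) x.
Proof.
  intros hf; apply Ccontinuous_pair; simpl; [exact hf | apply continuous_const].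
Qed.

Lemma Ccontinuous_Cexp {U : UniformSpace} (f : U -> C) (x : U) :
  Ccontinuous f x -> Ccontinuous (fun y => Cexp (f y)) x.
Proof.
  intros hf; unfold Cexp; apply Ccontinuous_mult.
  - apply Ccontinuous_RtoC.
    apply (continuous_comp (fun y => Re (f y)) exp); [now apply Ccontinuous_re|].
    apply continuous_exp.
  - apply Ccontinuous_pair; simpl.
    + apply (continuous_comp (fun y => Im (f y)) cos); [now apply Ccontinuous_im|].
      apply continuous_cos.
    + apply (continuous_comp (fun y => Im (f y)) sin); [now apply Ccontinuous_im|].
      apply continuous_sin.
Qed.

Lemma Cderive_pair (f : R -> C) (x : R) (l : C) :
  is_derive (fun y => Re (f y)) x (Re l) ->
  is_derive (fun y => Im (f y)) x (Im l) -> Cderive_at f x l.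
Proof.
  intros h1 h2; unfold Cderive_at, is_derive.
  apply filterdiff_ext with (f := fun y => (Re (f y), Im (f y))).
  { intros y; destruct (f y); reflexivity. }
  apply filterdiff_ext_lin
    with (l1 := fun y : R => (scal y (Re l), scal y (Im l)) : C_R_NormedModule).
  - apply (@filterdiff_comp'_2 R_AbsRing R_NormedModule R_NormedModule
      R_NormedModule C_R_NormedModule (fun y => Re (f y)) (fun y => Im (f y))
      (fun a b => (a, b)) x (fun y => scal y (Re l)) (fun y => scal y (Im l))
      (fun a b => (a, b)) h1 h2).
    apply filterdiff_ext with (f := fun p => p).
    { intros [? ?]; reflexivity. }
    apply filterdiff_ext_lin with (l1 := fun p => p).
    { apply filterdiff_id. }
    intros [? ?]; reflexivity.
  - intros y; reflexivity.
Qed.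

Lemma Cderive_re (f : R -> C) (x : R) (l : C) :
  Cderive_at f x l -> is_derive (fun y => Re (f y)) x (Re l).
Proof.
  intros h; unfold is_derive.
  apply (@filterdiff_comp' R_AbsRing R_NormedModule C_R_NormedModule
    R_NormedModule f (fun z : C => fst z) x (fun y => scal y l)
    (fun z : C => fst z) h).
  apply filterdiff_linear, (@is_linear_fst R_AbsRing R_NormedModule R_NormedModule).
Qed.

Lemma Cderive_im (f : R -> C) (x : R) (l : C) :
  Cderive_at f x l -> is_derive (fun y => Im (f y)) x (Im l).
Proof.
  intros h; unfold is_derive.
  apply (@filterdiff_comp' R_AbsRing R_NormedModule C_R_NormedModule
    R_NormedModule f (fun z : C => snd z) x (fun y => scal y l)
    (fun z : C => snd z) h).
  apply filterdiff_linear, (@is_linear_snd R_AbsRing R_NormedModule R_NormedModule).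
Qed.

Lemma Cderive_eq (f : R -> C) (x : R) (l l' : C) :
  Cderive_at f x l -> l = l' -> Cderive_at f x l'.
Proof. intros h <-; exact h. Qed.

Lemma Cderive_const (c : C) (x : R) : Cderive_at (fun _ => c) x 0.
Proof. apply (@is_derive_const R_AbsRing C_R_NormedModule). Qed.

Lemma Cderive_RtoC (f : R -> R) (x l : R) :
  is_derive f x l -> Cderive_at (fun y => RtoC (f y)) x l.
Proof.
  intros h; apply Cderive_pair; simpl; [exact h|].
  apply (@is_derive_const R_AbsRing R_NormedModule).
Qed.

Lemma Cderive_plus (f g : R -> C) (x : R) (l m : C) :
  Cderive_at f x l -> Cderive_at g x m ->
  Cderive_at (fun y => f y + g y)%C x (l + m)%C.
Proof.
  intros hf hg.
  exact (@is_derive_plus R_AbsRing C_R_NormedModule f g x l m hf hg).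
Qed.

Lemma Cderive_mult (f g : R -> C) (x : R) (l m : C) :
  Cderive_at f x l -> Cderive_at g x m ->
  Cderive_at (fun y => f y * g y)%C x (l * g x + f x * m)%C.
Proof.
  intros hf hg.
  assert (h1 := Cderive_re _ _ _ hf). assert (h2 := Cderive_im _ _ _ hf).
  assert (h3 := Cderive_re _ _ _ hg). assert (h4 := Cderive_im _ _ _ hg).
  apply Cderive_pair; simpl.
  - evar_last.
    + apply (is_derive_minus (V := R_NormedModule));
        apply (is_derive_mult (K := R_AbsRing));
        first [eassumption | intros; apply Rmult_comm].
    + unfold minus, plus, opp, mult; simpl; unfold Re, Im; ring.
  - evar_last.
    + apply (is_derive_plus (V := R_NormedModule));
        apply (is_derive_mult (K := R_AbsRing));
        first [eassumption | intros; apply Rmult_comm].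
    + unfold minus, plus, opp, mult; simpl; unfold Re, Im; ring.
Qed.

Lemma Cderive_Cexp (f : R -> C) (x : R) (l : C) :
  Cderive_at f x l -> Cderive_at (fun y => Cexp (f y)) x (l * Cexp (f x))%C.
Proof.
  intros hf.
  assert (h1 := Cderive_re _ _ _ hf). assert (h2 := Cderive_im _ _ _ hf).
  apply Cderive_eq with
    (RtoC (Re l * exp (Re (f x))) * (cos (Im (f x)), sin (Im (f x)))
     + RtoC (exp (Re (f x))) * (- sin (Im (f x)) * Im l, cos (Im (f x)) * Im l)%R)%C.
  - apply (Cderive_mult (fun y => RtoC (exp (Re (f y))))
      (fun y => (cos (Im (f y)), sin (Im (f y))))).
    + apply Cderive_RtoC.
      exact (is_derive_comp exp (fun y => Re (f y)) x _ _ (is_derive_exp _) h1).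
    + apply Cderive_pair; simpl; rewrite Rmult_comm.
      * exact (is_derive_comp cos (fun y => Im (f y)) x _ _ (is_derive_cos _) h2).
      * exact (is_derive_comp sin (fun y => Im (f y)) x _ _ (is_derive_sin _) h2).
  - apply C_ext; unfold Cexp; simpl; unfold Re, Im; ring.
Qed.

Lemma Cderive_continuous (f : R -> C) (x : R) (l : C) :
  Cderive_at f x l -> Ccontinuous f x.
Proof.
  intros h; apply (@ex_derive_continuous R_AbsRing C_R_NormedModule).
  now exists l.
Qed.

(** ** Integrals *)

Lemma CInt_correct (f : R -> C) (a b : R) : a <= b ->
  (forall x, a <= x <= b -> Ccontinuous f x) -> is_CInt f a b (CInt f a b).
Proof.
  intros hab hf.
  apply (@RInt_correct C_R_CompleteNormedModule), ex_RInt_continuous.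
  rewrite Rmin_left, Rmax_right by exact hab; exact hf.
Qed.

Lemma CInt_unique (f : R -> C) (a b : R) (l : C) :
  is_CInt f a b l -> CInt f a b = l.
Proof. apply (@is_RInt_unique C_R_CompleteNormedModule). Qed.

Lemma CInt_ext (f g : R -> C) (a b : R) : a <= b ->
  (forall x, a <= x <= b -> f x = g x) -> CInt f a b = CInt g a b.
Proof.
  intros hab h; apply (@RInt_ext C_R_CompleteNormedModule); rewrite Rmin_left, Rmax_right by exact hab.
  intros x hx; apply h; lra.
Qed.

Lemma is_CInt_pair (f : R -> C) (a b : R) (l : C) :
  is_RInt (fun x => Re (f x)) a b (Re l) ->
  is_RInt (fun x => Im (f x)) a b (Im l) -> is_CInt f a b l.
Proof.
  destruct l as [l m].
  exact (@is_RInt_fct_extend_pair R_NormedModule R_NormedModule f a b l m).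
Qed.

Lemma is_CInt_re (f : R -> C) (a b : R) (l : C) :
  is_CInt f a b l -> is_RInt (fun x => Re (f x)) a b (Re l).
Proof. exact (@is_RInt_fct_extend_fst R_NormedModule R_NormedModule f a b l). Qed.

Lemma is_CInt_im (f : R -> C) (a b : R) (l : C) :
  is_CInt f a b l -> is_RInt (fun x => Im (f x)) a b (Im l).
Proof. exact (@is_RInt_fct_extend_snd R_NormedModule R_NormedModule f a b l). Qed.

Lemma is_CInt_plus (f g : R -> C) (a b : R) (l m : C) :
  is_CInt f a b l -> is_CInt g a b m ->
  is_CInt (fun x => f x + g x)%C a b (l + m)%C.
Proof. exact (@is_RInt_plus C_R_NormedModule f g a b l m). Qed.

Lemma is_CInt_minus (f g : R -> C) (a b : R) (l m : C) :
  is_CInt f a b l -> is_CInt g a b m ->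
  is_CInt (fun x => f x - g x)%C a b (l - m)%C.
Proof. exact (@is_RInt_minus C_R_NormedModule f g a b l m). Qed.

Lemma is_CInt_scal (c : C) (f : R -> C) (a b : R) (l : C) :
  is_CInt f a b l -> is_CInt (fun x => c * f x)%C a b (c * l)%C.
Proof.
  intros h; assert (h1 := is_CInt_re _ _ _ _ h). assert (h2 := is_CInt_im _ _ _ _ h).
  apply is_CInt_pair; simpl.
  - apply (is_RInt_minus (V := R_NormedModule));
      apply (is_RInt_scal (V := R_NormedModule)); assumption.
  - apply (is_RInt_plus (V := R_NormedModule));
      apply (is_RInt_scal (V := R_NormedModule)); assumption.
Qed.

Lemma is_CInt_ext (f g : R -> C) (a b : R) (l : C) : a <= b ->
  (forall x, a <= x <= b -> f x = g x) -> is_CInt f a b l -> is_CInt g a b l.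
Proof.
  intros hab h; apply (@is_RInt_ext C_R_NormedModule).
  rewrite Rmin_left, Rmax_right by exact hab; intros x hx; apply h; lra.
Qed.

Lemma is_CInt_Cmod_le (f : R -> C) (a b M : R) (l : C) : a <= b ->
  (forall x, a <= x <= b -> Cmod (f x) <= M) -> is_CInt f a b l ->
  Cmod l <= (b - a) * M.
Proof.
  intros hab hf hl; rewrite <- C_norm_Cmod.
  apply (norm_RInt_le_const f a b l M hab); [|exact hl].
  intros x hx; rewrite C_norm_Cmod; now apply hf.
Qed.

(** Uniformly close integrands have close integrals; this is how every passage
    from partial sums to theta series under an integral sign is made. *)
Lemma CInt_close (f g : R -> C) (a b e : R) (l m : C) : a <= b ->
  (forall x, a <= x <= b -> Cmod (f x - g x) <= e) ->
  is_CInt f a b l -> is_CInt g a b m -> Cmod (l - m) <= (b - a) * e.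
Proof.
  intros hab h hf hg.
  apply (is_CInt_Cmod_le (fun x => f x - g x)%C a b e); auto.
  now apply is_CInt_minus.
Qed.

Lemma is_CInt_derive (f df : R -> C) (a b : R) : a <= b ->
  (forall x, a <= x <= b -> Cderive_at f x (df x)) ->
  (forall x, a <= x <= b -> Ccontinuous df x) ->
  is_CInt df a b (f b - f a)%C.
Proof.
  intros hab h1 h2.
  apply (@is_RInt_derive C_R_CompleteNormedModule);
    rewrite Rmin_left, Rmax_right by exact hab; assumption.
Qed.

(** * Series over the integers with geometric domination *)

Fixpoint csum (a : nat -> C) (N : nat) : C :=
  match N with O => 0%C | S n => (csum a n + a n)%C end.

Definition zsum (a : Z -> C) (N : nat) : C :=
  (csum (fun n => a (Z.of_nat n)) N + csum (fun n => a (- Z.of_nat (S n))%Z) N)%C.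

(** All the series below have Gaussian terms.  A geometric majorant is all that
    is used of their decay, since it gives explicit uniform tail estimates. *)
Definition geom_dominated (A r : R) (a : Z -> C) : Prop :=
  forall n, Cmod (a n) <= A * r ^ Z.abs_nat n.

Lemma CSeries_le_geom (a : nat -> C) (A r : R) : 0 <= r < 1 ->
  (forall n, Cmod (a n) <= A * r ^ n) ->
  ex_series (fun n => Re (a n)) /\ ex_series (fun n => Im (a n)) /\
  Cmod (CSeries a) <= 2 * A / (1 - r).
Proof.
  intros hr ha.
  assert (hg : ex_series (fun n => A * r ^ n)).
  { apply (ex_series_scal (V := R_NormedModule)).
    apply ex_series_geom; rewrite Rabs_pos_eq; lra. }
  assert (hs : Series (fun n => A * r ^ n) = A / (1 - r)).
  { rewrite Series_scal_l, Series_geom; [reflexivity|]; rewrite Rabs_pos_eq; lra. }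
  assert (key : forall b : nat -> R, (forall n, Rabs (b n) <= A * r ^ n) ->
    ex_series b /\ Rabs (Series b) <= A / (1 - r)).
  { intros b hb; assert (hb' : ex_series (fun n => Rabs (b n))).
    { apply (ex_series_le (V := R_CompleteNormedModule)) with (2 := hg).
      intros n; unfold norm; simpl; unfold abs; simpl; rewrite Rabs_Rabsolu; auto. }
    split; [now apply ex_series_Rabs|].
    apply Rle_trans with (1 := Series_Rabs _ hb').
    rewrite <- hs; apply Series_le; [|exact hg].
    intros n; split; [apply Rabs_pos | auto]. }
  destruct (key (fun n => Re (a n))) as [h1 h2].
  { intros n; apply Rle_trans with (1 := re_le_Cmod _); auto. }
  destruct (key (fun n => Im (a n))) as [h3 h4].
  { intros n; apply Rle_trans with (1 := im_le_Cmod _); auto. }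
  split; [exact h1|]; split; [exact h3|].
  apply Rle_trans with (1 := Cmod_le_re_im _); simpl.
  unfold Rdiv in *; lra.
Qed.

Lemma CSeries_tail (a : nat -> C) (A r : R) (N : nat) : 0 <= r < 1 ->
  (forall n, Cmod (a n) <= A * r ^ n) ->
  Cmod (CSeries a - csum a N) <= 2 * A / (1 - r) * r ^ N.
Proof.
  intros hr ha.
  assert (hshift : (CSeries a - csum a N)%C = CSeries (fun k => a (N + k)%nat)).
  { induction N as [|N IH].
    - transitivity (CSeries a); [simpl; ring | reflexivity].
    - transitivity (CSeries a - csum a N - a N)%C; [simpl; ring|].
      rewrite IH.
      destruct (CSeries_le_geom (fun k => a (N + k)%nat) (A * r ^ N) r hr)
        as [h1 [h2 _]].
      { intros n; rewrite Rmult_assoc, <- pow_add; auto. }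
      unfold CSeries; rewrite (Series_incr_1 _ h1), (Series_incr_1 _ h2).
      rewrite Nat.add_0_r.
      rewrite (Series_ext (fun n => Re (a (N + S n)%nat)) (fun n => Re (a (S N + n)%nat))),
        (Series_ext (fun n => Im (a (N + S n)%nat)) (fun n => Im (a (S N + n)%nat))).
      2, 3: intros n; now rewrite Nat.add_succ_r.
      apply C_ext; simpl; unfold Re, Im; ring. }
  rewrite hshift.
  destruct (CSeries_le_geom (fun k => a (N + k)%nat) (A * r ^ N) r hr) as [_ [_ h]].
  { intros n; rewrite Rmult_assoc, <- pow_add; auto. }
  apply Rle_trans with (1 := h); right; field; lra.
Qed.

Lemma ZSeries_tail (a : Z -> C) (A r : R) (N : nat) : 0 <= r < 1 -> 0 <= A ->
  geom_dominated A r a ->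
  Cmod (ZSeries a - zsum a N) <= 4 * A / (1 - r) * r ^ N.
Proof.
  intros hr hA ha; unfold ZSeries, zsum.
  assert (h1 := CSeries_tail (fun n => a (Z.of_nat n)) A r N hr).
  assert (h2 := CSeries_tail (fun n => a (- Z.of_nat (S n))%Z) A r N hr).
  replace (_ - _)%C with
    ((CSeries (fun n => a (Z.of_nat n)) - csum (fun n => a (Z.of_nat n)) N)
     + (CSeries (fun n => a (- Z.of_nat (S n))%Z)
        - csum (fun n => a (- Z.of_nat (S n))%Z) N))%C by ring.
  apply Rle_trans with (1 := Cmod_triangle _ _).
  replace (4 * A / (1 - r) * r ^ N)
    with (2 * A / (1 - r) * r ^ N + 2 * A / (1 - r) * r ^ N) by (field; lra).
  apply Rplus_le_compat; [apply h1 | apply h2]; intros n.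
  - rewrite <- (Zabs2Nat.id n) at 2; apply ha.
  - apply Rle_trans with (1 := ha _).
    apply Rmult_le_compat_l; [exact hA|].
    replace (Z.abs_nat (- Z.of_nat (S n))) with (S n) by lia.
    simpl; rewrite <- (Rmult_1_l (r ^ n)) at 2.
    apply Rmult_le_compat_r; [now apply pow_le | lra].
Qed.

Lemma ZSeries_bound (a : Z -> C) (A r : R) : 0 <= r < 1 -> 0 <= A ->
  geom_dominated A r a -> Cmod (ZSeries a) <= 4 * A / (1 - r).
Proof.
  intros hr hA ha; assert (h := ZSeries_tail a A r 0 hr hA ha).
  replace (ZSeries a - zsum a 0)%C with (ZSeries a) in h by (unfold zsum; simpl; ring).
  simpl in h; lra.
Qed.

Lemma is_lim_seq_geom_bound (K r : R) : 0 <= r < 1 ->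
  is_lim_seq (fun N => K * r ^ N) 0.
Proof.
  intros hr; replace (Finite 0) with (Rbar_mult K 0) by (simpl; now rewrite Rmult_0_r).
  apply is_lim_seq_scal_l, is_lim_seq_geom; rewrite Rabs_pos_eq; lra.
Qed.

Lemma zero_of_geom_bound (z : C) (K r : R) : 0 <= r < 1 ->
  (forall N : nat, Cmod z <= K * r ^ N) -> z = 0%C.
Proof.
  intros hr h; apply Cmod_eq_0.
  assert (hlim : is_lim_seq (fun N => K * r ^ N) 0).
  { now apply is_lim_seq_geom_bound. }
  apply Rle_antisym; [|apply Cmod_ge_0].
  exact (is_lim_seq_le _ _ _ _ h (is_lim_seq_const _) hlim).
Qed.

Lemma ZSeries_unique (a : Z -> C) (A r K : R) (z : C) : 0 <= r < 1 -> 0 <= A ->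
  geom_dominated A r a ->
  (forall N : nat, Cmod (z - zsum a N) <= K * r ^ N) -> ZSeries a = z.
Proof.
  intros hr hA ha hz.
  assert (h : (ZSeries a - z)%C = 0%C).
  { apply (zero_of_geom_bound _ (4 * A / (1 - r) + K) r hr); intros N.
    replace (ZSeries a - z)%C with ((ZSeries a - zsum a N) + - (z - zsum a N))%C by ring.
    apply Rle_trans with (1 := Cmod_triangle _ _); rewrite Cmod_opp.
    assert (h1 := ZSeries_tail a A r N hr hA ha); specialize (hz N); lra. }
  replace (ZSeries a) with ((ZSeries a - z) + z)%C by ring; rewrite h; ring.
Qed.

Lemma csum_ext (a b : nat -> C) (N : nat) :
  (forall n, a n = b n) -> csum a N = csum b N.
Proof. intros h; induction N as [|N IH]; simpl; [|rewrite IH, h]; reflexivity. Qed.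

Lemma zsum_ext (a b : Z -> C) (N : nat) :
  (forall n, a n = b n) -> zsum a N = zsum b N.
Proof. intros h; unfold zsum; f_equal; apply csum_ext; intros; apply h. Qed.

Lemma ZSeries_ext (a b : Z -> C) : (forall n, a n = b n) -> ZSeries a = ZSeries b.
Proof.
  intros h; unfold ZSeries, CSeries.
  f_equal; f_equal; apply Series_ext; intros; now rewrite h.
Qed.

Lemma csum_scal (c : C) (a : nat -> C) (N : nat) :
  csum (fun n => c * a n)%C N = (c * csum a N)%C.
Proof. induction N as [|N IH]; simpl; [|rewrite IH]; ring. Qed.

Lemma zsum_scal (c : C) (a : Z -> C) (N : nat) :
  zsum (fun n => c * a n)%C N = (c * zsum a N)%C.
Proof. unfold zsum; rewrite !csum_scal; ring. Qed.

Lemma geom_dominated_scal (c : C) (A r : R) (a : Z -> C) :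
  geom_dominated A r a -> geom_dominated (Cmod c * A) r (fun n => c * a n)%C.
Proof.
  intros h n; rewrite Cmod_mult, Rmult_assoc.
  apply Rmult_le_compat_l; [apply Cmod_ge_0 | apply h].
Qed.

Lemma ZSeries_scal (c : C) (A r : R) (a : Z -> C) : 0 <= r < 1 -> 0 <= A ->
  geom_dominated A r a -> ZSeries (fun n => c * a n)%C = (c * ZSeries a)%C.
Proof.
  intros hr hA ha.
  apply (ZSeries_unique _ (Cmod c * A) r (Cmod c * (4 * A / (1 - r)))); auto.
  - apply Rmult_le_pos; [apply Cmod_ge_0 | exact hA].
  - now apply geom_dominated_scal.
  - intros N; rewrite zsum_scal.
    replace (_ - _)%C with (c * (ZSeries a - zsum a N))%C by ring.
    rewrite Cmod_mult, Rmult_assoc; apply Rmult_le_compat_l; [apply Cmod_ge_0|].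
    now apply ZSeries_tail.
Qed.

Lemma csum_continuous {U : UniformSpace} (a : U -> nat -> C) (x : U) (N : nat) :
  (forall n, Ccontinuous (fun y => a y n) x) -> Ccontinuous (fun y => csum (a y) N) x.
Proof.
  intros h; induction N as [|N IH]; simpl.
  - apply Ccontinuous_const.
  - now apply Ccontinuous_plus.
Qed.

Lemma zsum_continuous {U : UniformSpace} (a : U -> Z -> C) (x : U) (N : nat) :
  (forall n, Ccontinuous (fun y => a y n) x) -> Ccontinuous (fun y => zsum (a y) N) x.
Proof.
  intros h; apply Ccontinuous_plus;
    [apply (csum_continuous (fun y n => a y (Z.of_nat n)))
    | apply (csum_continuous (fun y n => a y (- Z.of_nat (S n))%Z))]; intros n; apply h.
Qed.

Lemma Ccontinuous_Cmod {U : UniformSpace} (f : U -> C) (x : U) :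
  Ccontinuous f x <->
  (forall e : posreal, locally x (fun y => Cmod (f y - f x) < e)).
Proof.
  unfold Ccontinuous, continuous; rewrite (@filterlim_locally_ball_norm R_AbsRing U C_R_NormedModule _
    (@filter_filter _ _ (locally_filter x))).
  unfold ball_norm; split; intros h e; generalize (h e); apply filter_imp;
    intros y; rewrite C_norm_Cmod; auto.
Qed.

Lemma ZSeries_continuous {U : UniformSpace} (a : U -> Z -> C) (x : U) (A r : R) :
  0 <= r < 1 -> 0 <= A -> locally x (fun y => geom_dominated A r (a y)) ->
  (forall n, Ccontinuous (fun y => a y n) x) ->
  Ccontinuous (fun y => ZSeries (a y)) x.
Proof.
  intros hr hA hd hc; apply Ccontinuous_Cmod; intros e.
  assert (hlim : is_lim_seq (fun N => 4 * A / (1 - r) * r ^ N) 0).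
  { now apply is_lim_seq_geom_bound. }
  assert (he3 : 0 < e / 3) by (destruct e; simpl; lra).
  apply is_lim_seq_spec in hlim; destruct (hlim (mkposreal _ he3)) as [N hN].
  specialize (hN N (Nat.le_refl N)); simpl in hN.
  rewrite Rminus_0_r in hN; apply Rabs_def2 in hN; destruct hN as [hN _].
  assert (hz := proj1 (Ccontinuous_Cmod _ _) (zsum_continuous a x N hc) (mkposreal _ he3)).
  assert (hx := locally_singleton x _ hd).
  generalize (filter_and _ _ hd hz); apply filter_imp; intros y [hy hyz]; simpl in hyz.
  replace (_ - _)%C with ((ZSeries (a y) - zsum (a y) N)
    + ((zsum (a y) N - zsum (a x) N) + - (ZSeries (a x) - zsum (a x) N)))%C by ring.
  apply Rle_lt_trans with (1 := Cmod_triangle _ _).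
  apply Rle_lt_trans with (1 := Rplus_le_compat_l _ _ _ (Cmod_triangle _ _)).
  rewrite Cmod_opp.
  assert (h1 := ZSeries_tail (a y) A r N hr hA hy).
  assert (h2 := ZSeries_tail (a x) A r N hr hA hx).
  simpl in *; lra.
Qed.

Lemma is_CInt_csum (f : R -> nat -> C) (I : nat -> C) (a b : R) (N : nat) :
  (forall n, is_CInt (fun x => f x n) a b (I n)) ->
  is_CInt (fun x => csum (f x) N) a b (csum I N).
Proof.
  intros h; induction N as [|N IH]; simpl.
  - unfold is_CInt; evar_last; [apply (@is_RInt_const C_R_NormedModule)|].
    rewrite scal_RtoC; ring.
  - now apply is_CInt_plus.
Qed.

(** Termwise integration.  The explicit rate lets the conclusion be combined with
    other approximations of the same integral along the same partial sums. *)
Lemma CInt_ZSeries (f : R -> Z -> C) (I : Z -> C) (J : C) (a b A r : R) (N : nat) :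
  a <= b -> 0 <= r < 1 -> 0 <= A ->
  (forall x, a <= x <= b -> geom_dominated A r (f x)) ->
  (forall n, is_CInt (fun x => f x n) a b (I n)) ->
  is_CInt (fun x => ZSeries (f x)) a b J ->
  Cmod (J - zsum I N) <= (b - a) * (4 * A / (1 - r)) * r ^ N.
Proof.
  intros hab hr hA hd hI hJ; rewrite Rmult_assoc.
  apply (CInt_close (fun x => ZSeries (f x)) (fun x => zsum (f x) N) a b); auto.
  - intros x hx; apply ZSeries_tail; auto.
  - apply is_CInt_plus; apply (is_CInt_csum _ _ a b N); intros n; apply hI.
Qed.

Lemma Cexp_plus (z w : C) : Cexp (z + w) = (Cexp z * Cexp w)%C.
Proof.
  unfold Cexp; apply C_ext; simpl; unfold Re, Im;
    rewrite exp_plus; [rewrite cos_plus | rewrite sin_plus]; simpl; ring.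
Qed.

Lemma Cmod_Cexp (z : C) : Cmod (Cexp z) = exp (Re z).
Proof.
  unfold Cexp; rewrite Cmod_mult, Cmod_R, Rabs_pos_eq by (left; apply exp_pos).
  unfold Cmod; simpl fst; simpl snd.
  replace (cos (Im z) ^ 2 + sin (Im z) ^ 2) with 1.
  - rewrite sqrt_1; ring.
  - generalize (sin2_cos2 (Im z)); unfold Rsqr; simpl; lra.
Qed.

Lemma Cexp_0 : Cexp 0 = 1%C.
Proof.
  unfold Cexp; simpl; rewrite exp_0, cos_0, sin_0; apply C_ext; simpl; ring.
Qed.

Lemma Cexp_pow (z : C) (n : nat) : (Cexp z ^ n)%C = Cexp (RtoC (INR n) * z).
Proof.
  induction n as [|n IH].
  - simpl; rewrite Cmult_0_l, Cexp_0; reflexivity.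
  - rewrite Cpow_S, IH, <- Cexp_plus, S_INR, RtoC_plus; f_equal; ring.
Qed.

Lemma Cexp_2PI_Z (n : Z) : Cexp (RtoC (2 * PI * IZR n) * Ci) = 1%C.
Proof.
  assert (h : forall m : nat, Cexp (RtoC (2 * PI * INR m) * Ci) = 1%C).
  { intros m; unfold Cexp; simpl.
    replace (2 * PI * INR m * 0 - 0 * 1) with 0 by ring.
    replace (2 * PI * INR m * 1 + 0 * 0) with (0 + 2 * INR m * PI) by ring.
    rewrite exp_0, cos_period, sin_period, cos_0, sin_0; apply C_ext; simpl; ring. }
  destruct (Z.le_ge_cases 0 n) as [hn|hn].
  - rewrite <- (Z2Nat.id n hn), <- INR_IZR_INZ; apply h.
  - rewrite <- (Cmult_1_r (Cexp _)), <- (h (Z.to_nat (- n))) at 1.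
    rewrite <- Cexp_plus, INR_IZR_INZ, Z2Nat.id, opp_IZR by lia.
    rewrite <- Cexp_0; f_equal; rewrite !RtoC_mult, RtoC_opp; ring.
Qed.

(** * The Gaussian integral and its contour shifts *)

(** Convergence of complex sequences, reduced to real sequences so that
    squeezing by explicit majorants applies directly. *)
Definition Clim_seq (u : nat -> C) (l : C) : Prop :=
  is_lim_seq (fun N => Cmod (u N - l)) 0.

Lemma Clim_seq_plus (u v : nat -> C) (l m : C) :
  Clim_seq u l -> Clim_seq v m -> Clim_seq (fun N => u N + v N)%C (l + m)%C.
Proof.
  intros hu hv.
  apply is_lim_seq_le_le with (u := fun _ => 0)
    (w := fun N => Cmod (u N - l) + Cmod (v N - m)).
  - intros N; split; [apply Cmod_ge_0|].
    replace (_ - _)%C with ((u N - l) + (v N - m))%C by ring; apply Cmod_triangle.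
  - apply is_lim_seq_const.
  - replace (Finite 0) with (Finite (0 + 0)) by (f_equal; ring).
    now apply is_lim_seq_plus'.
Qed.

Lemma Clim_seq_scal (c : C) (u : nat -> C) (l : C) :
  Clim_seq u l -> Clim_seq (fun N => c * u N)%C (c * l)%C.
Proof.
  intros hu; unfold Clim_seq.
  apply is_lim_seq_ext with (fun N => Cmod c * Cmod (u N - l)).
  - intros N; rewrite <- Cmod_mult; f_equal; ring.
  - replace (Finite 0) with (Rbar_mult (Cmod c) 0) by (simpl; now rewrite Rmult_0_r).
    now apply is_lim_seq_scal_l.
Qed.

Lemma Clim_seq_ext (u v : nat -> C) (l : C) :
  (forall N, u N = v N) -> Clim_seq u l -> Clim_seq v l.
Proof. intros h; apply is_lim_seq_ext; intros N; now rewrite h. Qed.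

Lemma Clim_seq_geom (u : nat -> C) (l : C) (K r : R) : 0 <= r < 1 ->
  (forall N, Cmod (u N - l) <= K * r ^ N) -> Clim_seq u l.
Proof.
  intros hr h.
  apply is_lim_seq_le_le with (u := fun _ => 0) (w := fun N => K * r ^ N).
  - intros N; split; [apply Cmod_ge_0 | apply h].
  - apply is_lim_seq_const.
  - now apply is_lim_seq_geom_bound.
Qed.

Lemma Clim_seq_unique (u : nat -> C) (l m : C) :
  Clim_seq u l -> Clim_seq u m -> l = m.
Proof.
  intros hl hm.
  assert (h : (l - m)%C = 0%C).
  { apply Cmod_eq_0, Rle_antisym; [|apply Cmod_ge_0].
    replace 0 with (0 + 0) by ring.
    apply (is_lim_seq_le (fun _ => Cmod (l - m))
      (fun N => Cmod (u N - l) + Cmod (u N - m)) (Cmod (l - m)) (0 + 0)%R).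
    - intros N; rewrite <- (Cmod_opp (u N - l)).
      replace (l - m)%C with (- (u N - l) + (u N - m))%C by ring.
      apply Cmod_triangle.
    - apply is_lim_seq_const.
    - now apply is_lim_seq_plus'. }
  replace l with ((l - m) + m)%C by ring; rewrite h; ring.
Qed.

(** Differentiate [RInt (g s) A B] in [s]: the derivative is the integral of a
    derivative along the path, hence a difference of end values, and the mean
    value theorem concludes. *)
Lemma green_rectangle_real (g k d : R -> R -> R) (A B M : R) : A <= B ->
  (forall s x, is_derive (fun u => g u x) s (d s x)) ->
  (forall s x, is_derive (k s) x (d s x)) ->
  (forall s x, continuity_2d_pt d s x) ->
  (forall s x, continuous (g s) x) ->
  (forall s, 0 <= s <= 1 -> Rabs (k s A) <= M /\ Rabs (k s B) <= M) ->
  Rabs (RInt (g 1) A B - RInt (g 0) A B) <= 2 * M.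
Proof.
  intros hAB hg hk hd hc hM.
  assert (hphi : forall s, is_derive (fun u => RInt (g u) A B) s (k s B - k s A)).
  { intros s.
    assert (hk' : RInt (d s) A B = k s B - k s A).
    { apply is_RInt_unique, (is_RInt_derive (V := R_CompleteNormedModule)).
      - intros; apply hk.
      - intros x _.
        assert (h := proj1 (continuity_2d_pt_filterlim _ _ _) (hd s x)).
        apply (continuous_comp_2 (fun _ : R => s) (fun y : R => y) d x).
        + apply continuous_const.
        + apply continuous_id.
        + exact h. }
    rewrite <- hk'.
    rewrite (RInt_ext (d s) (fun t => Derive (fun u => g u t) s)).
    2: { intros t _; symmetry; apply is_derive_unique, hg. }
    apply (is_derive_RInt_param g A B s).
    - apply filter_forall; intros y t _; eexists; apply hg.
    - intros t _; apply continuity_2d_pt_ext with d; [|apply hd].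
      intros u v; symmetry; apply is_derive_unique, hg.
    - apply filter_forall; intros y.
      apply (ex_RInt_continuous (V := R_CompleteNormedModule)); intros; apply hc. }
  destruct (MVT_gen (fun u => RInt (g u) A B) 0 1 (fun s => k s B - k s A))
    as [c [hc1 hc2]].
  - intros; apply hphi.
  - intros x _; apply continuity_pt_filterlim.
    apply (ex_derive_continuous (V := R_NormedModule) (fun u => RInt (g u) A B)).
    eexists; apply hphi.
  - rewrite hc2; rewrite Rmin_left, Rmax_right in hc1 by lra.
    destruct (hM c hc1) as [h1 h2].
    replace ((k c B - k c A) * (1 - 0)) with (k c B + - k c A) by ring.
    apply Rle_trans with (1 := Rabs_triang _ _); rewrite Rabs_Ropp; lra.
Qed.

(** Cauchy's theorem for a family of paths: when [D] is both the derivative of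
    [G] in the deformation parameter and that of [K] along the path, the
    integral of [G] along the path changes only by the values of [K] at the two
    ends.  For [G s x = f (z s x) * dz/dx] and [K s x = f (z s x) * dz/ds] the
    hypothesis is the symmetry of second derivatives. *)
Lemma green_rectangle (G K D : R -> R -> C) (A B M : R) : A <= B ->
  (forall s x, Cderive_at (fun u => G u x) s (D s x)) ->
  (forall s x, Cderive_at (K s) x (D s x)) ->
  (forall p : R * R, Ccontinuous (fun p : R * R => D (fst p) (snd p)) p) ->
  (forall s x, Ccontinuous (G s) x) ->
  (forall s, 0 <= s <= 1 -> Cmod (K s A) <= M /\ Cmod (K s B) <= M) ->
  Cmod (CInt (G 1) A B - CInt (G 0) A B) <= 4 * M.
Proof.
  intros hAB hG hK hD hc hM.
  assert (hI : forall s, is_CInt (G s) A B (CInt (G s) A B)).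
  { intros s; apply CInt_correct; auto. }
  apply Rle_trans with (1 := Cmod_le_re_im _).
  assert (h1 : Rabs (Re (CInt (G 1) A B - CInt (G 0) A B)) <= 2 * M).
  { assert (e : forall s, Re (CInt (G s) A B) = RInt (fun x => Re (G s x)) A B).
    { intros s; symmetry; apply is_RInt_unique, (is_CInt_re _ _ _ _ (hI s)). }
    replace (Re (CInt (G 1) A B - CInt (G 0) A B))
      with (Re (CInt (G 1) A B) - Re (CInt (G 0) A B)) by reflexivity.
    rewrite !e.
    apply (green_rectangle_real (fun s x => Re (G s x)) (fun s x => Re (K s x))
      (fun s x => Re (D s x)) A B M hAB).
    - intros; now apply Cderive_re.
    - intros; now apply (Cderive_re (K s)).
    - intros s x; apply continuity_2d_pt_filterlim.
      exact (Ccontinuous_re _ _ (hD (s, x))).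
    - intros; now apply Ccontinuous_re.
    - intros s hs; destruct (hM s hs) as [m1 m2]; split;
        (eapply Rle_trans; [apply re_le_Cmod|]); assumption. }
  assert (h2 : Rabs (Im (CInt (G 1) A B - CInt (G 0) A B)) <= 2 * M).
  { assert (e : forall s, Im (CInt (G s) A B) = RInt (fun x => Im (G s x)) A B).
    { intros s; symmetry; apply is_RInt_unique, (is_CInt_im _ _ _ _ (hI s)). }
    replace (Im (CInt (G 1) A B - CInt (G 0) A B))
      with (Im (CInt (G 1) A B) - Im (CInt (G 0) A B)) by reflexivity.
    rewrite !e.
    apply (green_rectangle_real (fun s x => Im (G s x)) (fun s x => Im (K s x))
      (fun s x => Im (D s x)) A B M hAB).
    - intros; now apply Cderive_im.
    - intros; now apply (Cderive_im (K s)).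
    - intros s x; apply continuity_2d_pt_filterlim.
      exact (Ccontinuous_im _ _ (hD (s, x))).
    - intros; now apply Ccontinuous_im.
    - intros s hs; destruct (hM s hs) as [m1 m2]; split;
        (eapply Rle_trans; [apply im_le_Cmod|]); assumption. }
  lra.
Qed.

Definition gauss (z : C) : C := Cexp (- (RtoC PI * (z * z))).

Lemma Cmod_gauss (z : C) : Cmod (gauss z) = exp (- (PI * (Re z ^ 2 - Im z ^ 2))).
Proof. unfold gauss; rewrite Cmod_Cexp; f_equal; simpl; unfold Re, Im; ring. Qed.

Lemma Ccontinuous_gauss {U : UniformSpace} (f : U -> C) (x : U) :
  Ccontinuous f x -> Ccontinuous (fun y => gauss (f y)) x.
Proof.
  intros h; unfold gauss; apply Ccontinuous_Cexp, Ccontinuous_opp.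
  apply Ccontinuous_mult; [apply Ccontinuous_const | now apply Ccontinuous_mult].
Qed.

Lemma Cderive_gauss (f : R -> C) (x : R) (l : C) : Cderive_at f x l ->
  Cderive_at (fun y => gauss (f y)) x (- (2 * PI)%R * (f x * l) * gauss (f x))%C.
Proof.
  intros h; unfold gauss.
  apply Cderive_eq with ((- (RtoC PI) * (l * f x + f x * l))
    * Cexp (- (RtoC PI * (f x * f x))))%C.
  2: { f_equal; rewrite RtoC_mult; ring. }
  apply (Cderive_Cexp (fun y => - (RtoC PI * (f y * f y)))%C).
  apply Cderive_eq with
    (0 * (f x * f x) + (- RtoC PI) * (l * f x + f x * l))%C; [|ring].
  apply (@is_derive_ext R_AbsRing C_R_NormedModule
    (fun y => (- RtoC PI) * (f y * f y))%C).
  { intros t; change ((- RtoC PI * (f t * f t))%C = (- (RtoC PI * (f t * f t)))%C); ring. }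
  apply (Cderive_mult (fun _ => - RtoC PI)%C (fun y => f y * f y)%C);
    [apply Cderive_const | now apply Cderive_mult].
Qed.

(** For [z = (P + i Q) x + (m + i n)] with [|Q| < P], both factors of
    [Re (z^2) = (|Re z| - |Im z|) (|Re z| + |Im z|)] grow linearly in [x].  This
    is what kills the end contributions when a Gaussian contour is deformed. *)
Lemma cone_square_growth (P Q c m n M x : R) : 0 < c -> c <= P - Rabs Q ->
  Rabs m + Rabs n <= M -> 2 * M <= c * Rabs x ->
  (c * Rabs x / 2) ^ 2 <= (P * x + m) ^ 2 - (Q * x + n) ^ 2.
Proof.
  intros hc hP hM hx.
  assert (h1 : P * Rabs x - Rabs m <= Rabs (P * x + m)).
  { assert (h := Rabs_triang (P * x + m) (- m)).
    replace (P * x + m + - m) with (P * x) in h by ring.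
    rewrite Rabs_Ropp, Rabs_mult, (Rabs_pos_eq P) in h; [lra|].
    generalize (Rabs_pos Q); lra. }
  assert (h2 : Rabs (Q * x + n) <= Rabs Q * Rabs x + Rabs n).
  { rewrite <- Rabs_mult; apply Rabs_triang. }
  rewrite <- (pow2_abs (P * x + m)), <- (pow2_abs (Q * x + n)).
  assert (h3 : c * Rabs x / 2 <= Rabs (P * x + m) - Rabs (Q * x + n)).
  { generalize (Rabs_pos x); nra. }
  assert (h0 := Rabs_pos (Q * x + n)).
  assert (h4 : 0 <= c * Rabs x / 2) by (generalize (Rabs_pos x); nra).
  nra.
Qed.

Lemma exp_neg_le_inv (y : R) : 0 < y -> exp (- y) <= / y.
Proof.
  intros hy; rewrite exp_Ropp; apply Rinv_le_contravar; [exact hy|].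
  generalize (exp_ineq1 y); lra.
Qed.

(** Deforming the line [x -> b x + w] into the real axis through the lines
    [x -> (1 + s (b - 1)) x + s w], which all stay in the cone. *)
Lemma gauss_contour (b w : C) : Rabs (Im b) < Re b ->
  Clim_seq (fun N => b * CInt (fun x => gauss (b * RtoC x + w)) (- INR N - / 2) (INR N - / 2)
                     - CInt (fun x => gauss (RtoC x)) (- INR N - / 2) (INR N - / 2))%C 0.
Proof.
  intros hb.
  set (z := fun s x : R => ((1 + RtoC s * (b - 1)) * RtoC x + RtoC s * w)%C).
  set (zx := fun s : R => (1 + RtoC s * (b - 1))%C).
  set (zs := fun x : R => ((b - 1) * RtoC x + w)%C).
  set (G := fun s x : R => (gauss (z s x) * zx s)%C).
  set (K := fun s x : R => (gauss (z s x) * zs x)%C).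
  set (D := fun s x : R =>
    ((- (2 * PI)%R * (z s x * zs x) * gauss (z s x)) * zx s
     + gauss (z s x) * (b - 1))%C).
  assert (dR : forall x, Cderive_at (fun y => RtoC y) x 1).
  { intros x; apply (Cderive_RtoC (fun y => y) x 1), (@is_derive_id R_AbsRing). }
  assert (dzx : forall s, Cderive_at zx s (b - 1)%C).
  { intros s; apply Cderive_eq with (0 + (1 * (b - 1) + RtoC s * 0))%C; [|ring].
    apply (Cderive_plus (fun _ => RtoC 1)); [apply Cderive_const|].
    apply (Cderive_mult (fun y => RtoC y) (fun _ => (b - 1)%C)); [apply dR | apply Cderive_const]. }
  assert (dzs : forall x, Cderive_at zs x (b - 1)%C).
  { intros x; apply Cderive_eq with ((0 * RtoC x + (b - 1) * 1) + 0)%C; [|ring].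
    apply (Cderive_plus (fun y => (b - 1) * RtoC y)%C (fun _ => w));
      [|apply Cderive_const].
    apply (Cderive_mult (fun _ => (b - 1)%C)); [apply Cderive_const | apply dR]. }
  assert (dz_s : forall s x, Cderive_at (fun u => z u x) s (zs x)).
  { intros s x; apply Cderive_eq with
      (((b - 1) * RtoC x + zx s * 0) + (1 * w + RtoC s * 0))%C.
    2: unfold zs; ring.
    apply (Cderive_plus (fun u => zx u * RtoC x)%C (fun u => RtoC u * w)%C).
    - apply (Cderive_mult zx (fun _ => RtoC x)); [apply dzx | apply Cderive_const].
    - apply (Cderive_mult (fun u => RtoC u) (fun _ => w)); [apply dR | apply Cderive_const]. }
  assert (dz_x : forall s x, Cderive_at (z s) x (zx s)).
  { intros s x; apply Cderive_eq with ((0 * RtoC x + zx s * 1) + 0)%C; [|ring].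
    apply (Cderive_plus (fun u => zx s * RtoC u)%C (fun u => RtoC s * w)%C).
    - apply (Cderive_mult (fun _ => zx s)); [apply Cderive_const | apply dR].
    - apply Cderive_const. }
  assert (cfst : forall p : R * R, Ccontinuous (fun p : R * R => RtoC (fst p)) p).
  { intros p; apply Ccontinuous_RtoC, (@continuous_fst R_UniformSpace R_UniformSpace). }
  assert (csnd : forall p : R * R, Ccontinuous (fun p : R * R => RtoC (snd p)) p).
  { intros p; apply Ccontinuous_RtoC, (@continuous_snd R_UniformSpace R_UniformSpace). }
  assert (hD : forall p : R * R, Ccontinuous (fun p : R * R => D (fst p) (snd p)) p).
  { intros p.
    assert (c1 : Ccontinuous (fun p : R * R => zx (fst p)) p).
    { apply (Ccontinuous_plus (fun _ => RtoC 1)); [apply Ccontinuous_const|].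
      apply Ccontinuous_mult; [apply cfst | apply Ccontinuous_const]. }
    assert (c2 : Ccontinuous (fun p : R * R => zs (snd p)) p).
    { apply Ccontinuous_plus; [|apply Ccontinuous_const].
      apply Ccontinuous_mult; [apply Ccontinuous_const | apply csnd]. }
    assert (c3 : Ccontinuous (fun p : R * R => z (fst p) (snd p)) p).
    { apply Ccontinuous_plus; apply Ccontinuous_mult;
        [exact c1 | apply csnd | apply cfst | apply Ccontinuous_const]. }
    assert (c4 := Ccontinuous_gauss _ _ c3).
    unfold D; apply Ccontinuous_plus.
    - apply Ccontinuous_mult; [|exact c1].
      apply Ccontinuous_mult; [|exact c4].
      apply Ccontinuous_mult; [apply Ccontinuous_const|].
      now apply Ccontinuous_mult.
    - apply Ccontinuous_mult; [exact c4 | apply Ccontinuous_const]. }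
  assert (hGs : forall s x, Cderive_at (fun u => G u x) s (D s x)).
  { intros s x.
    apply (Cderive_mult (fun u => gauss (z u x)) zx); [|apply dzx].
    apply (Cderive_gauss (fun u => z u x)), dz_s. }
  assert (hKx : forall s x, Cderive_at (K s) x (D s x)).
  { intros s x.
    apply Cderive_eq with ((- (2 * PI)%R * (z s x * zx s) * gauss (z s x)) * zs x
      + gauss (z s x) * (b - 1))%C.
    2: unfold D; ring.
    apply (Cderive_mult (fun u => gauss (z s u)) zs); [|apply dzs].
    apply (Cderive_gauss (z s)), dz_x. }
  assert (hGc : forall s x, Ccontinuous (G s) x).
  { intros s x; apply (Ccontinuous_mult (fun u => gauss (z s u)) (fun _ => zx s)).
    - apply Ccontinuous_gauss, Cderive_continuous with (1 := dz_x s x).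
    - apply Ccontinuous_const. }
  set (c := Rmin 1 (Re b - Rabs (Im b))).
  assert (hc : 0 < c) by (apply Rmin_pos; lra).
  set (M := Rabs (Re w) + Rabs (Im w)).
  set (al := Cmod (b - 1) + Cmod w).
  assert (hal : 0 <= al) by (apply Rplus_le_le_0_compat; apply Cmod_ge_0).
  set (L := al * / (PI * (c / 2) ^ 2)).
  assert (hpc : 0 < PI * (c / 2) ^ 2).
  { apply Rmult_lt_0_compat; [apply PI_RGT_0 | apply pow_lt; lra]. }
  assert (hK : forall s x, 0 <= s <= 1 -> 1 <= Rabs x -> 2 * M <= c * Rabs x ->
    Cmod (K s x) <= L * / Rabs x).
  { intros s x hs hx1 hx2; unfold K; rewrite Cmod_mult, Cmod_gauss.
    assert (hz : (c * Rabs x / 2) ^ 2 <= Re (z s x) ^ 2 - Im (z s x) ^ 2).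
    { replace (Re (z s x)) with ((1 + s * (Re b - 1)) * x + s * Re w)
        by (simpl; unfold Re, Im; ring).
      replace (Im (z s x)) with ((s * Im b) * x + s * Im w)
        by (simpl; unfold Re, Im; ring).
      apply cone_square_growth with (M := M); try assumption.
      - rewrite Rabs_mult, (Rabs_pos_eq s) by lra.
        assert (c1 := Rmin_l 1 (Re b - Rabs (Im b))).
        assert (c2 := Rmin_r 1 (Re b - Rabs (Im b))).
        fold c in c1, c2; nra.
      - rewrite !Rabs_mult, (Rabs_pos_eq s) by lra.
        unfold M; generalize (Rabs_pos (Re w)) (Rabs_pos (Im w)); nra. }
    assert (hy : 0 < PI * (c / 2) ^ 2 * Rabs x ^ 2).
    { apply Rmult_lt_0_compat; [exact hpc | apply pow_lt; lra]. }
    assert (he : exp (- (PI * (Re (z s x) ^ 2 - Im (z s x) ^ 2)))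
                 <= / (PI * (c / 2) ^ 2 * Rabs x ^ 2)).
    { apply Rle_trans with (2 := exp_neg_le_inv _ hy).
      assert (h : PI * (c / 2) ^ 2 * Rabs x ^ 2 <= PI * (Re (z s x) ^ 2 - Im (z s x) ^ 2)).
      { rewrite Rmult_assoc; apply Rmult_le_compat_l; [left; apply PI_RGT_0|].
        apply Rle_trans with (2 := hz); right; field. }
      destruct h as [h|h]; [left; apply exp_increasing; lra | right; f_equal; lra]. }
    assert (hzs : Cmod (zs x) <= al * Rabs x).
    { unfold zs, al; apply Rle_trans with (1 := Cmod_triangle _ _).
      rewrite Cmod_mult, Cmod_R; generalize (Cmod_ge_0 w); nra. }
    apply Rle_trans with (/ (PI * (c / 2) ^ 2 * Rabs x ^ 2) * (al * Rabs x)).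
    - apply Rmult_le_compat; try assumption; [left; apply exp_pos | apply Cmod_ge_0].
    - right; unfold L; field; repeat split; try lra.
      apply PI_neq0. }
  destruct (nfloor_ex (2 * M / c)) as [n0 hn0].
  { apply Rdiv_le_0_compat; [|exact hc]; unfold M.
    generalize (Rabs_pos (Re w)) (Rabs_pos (Im w)); lra. }
  apply is_lim_seq_le_le_loc with (u := fun _ => 0) (w := fun N => 8 * L * / INR N).
  - exists (n0 + 3)%nat; intros N hN; split; [apply Cmod_ge_0|].
    apply le_INR in hN; rewrite plus_INR in hN; simpl in hN.
    assert (hn0' := pos_INR n0).
    replace (_ - 0)%C with (CInt (G 1) (- INR N - / 2) (INR N - / 2)
      - CInt (G 0) (- INR N - / 2) (INR N - / 2))%C.
    + apply Rle_trans with (4 * (L * (2 * / INR N))); [|right; ring].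
      apply (green_rectangle G K D); auto; [lra|].
      intros s hs.
      assert (hx : forall x, INR N / 2 <= Rabs x -> INR N - / 2 <= Rabs x ->
        Cmod (K s x) <= L * (2 * / INR N)).
      { intros x hx hx'; apply Rle_trans with (L * / Rabs x).
        - apply hK; [exact hs | lra |].
          apply Rmult_le_reg_r with (/ c); [now apply Rinv_0_lt_compat|].
          replace (c * Rabs x * / c) with (Rabs x) by (field; lra).
          unfold Rdiv in hn0; lra.
        - apply Rmult_le_compat_l.
          + unfold L; apply Rmult_le_pos; [exact hal|].
            left; now apply Rinv_0_lt_compat.
          + replace (2 * / INR N) with (/ (INR N / 2)) by (field; lra).
            apply Rinv_le_contravar; lra. }
      split; apply hx; [rewrite Rabs_left | rewrite Rabs_left
        | rewrite Rabs_pos_eq | rewrite Rabs_pos_eq]; lra.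
    + rewrite (CInt_unique (G 1) _ _ (b * CInt (fun x => gauss (b * RtoC x + w))
        (- INR N - / 2) (INR N - / 2))%C).
      * rewrite (CInt_ext (G 0) (fun x => gauss (RtoC x))); [ring | lra |].
        intros x _; unfold G, z, zx.
        replace (_ + 0 * w)%C with (RtoC x) by ring; ring.
      * apply is_CInt_ext with (fun x => b * gauss (b * RtoC x + w))%C; [lra | |].
        -- intros x _; unfold G, z, zx.
           replace ((1 + 1 * (b - 1)) * RtoC x + 1 * w)%C with (b * RtoC x + w)%C by ring.
           ring.
        -- apply is_CInt_scal, CInt_correct; [lra|]; intros x _.
           apply Ccontinuous_gauss, Ccontinuous_plus; [|apply Ccontinuous_const].
           apply Ccontinuous_mult; [apply Ccontinuous_const|].
           apply Cderive_continuous with (1 := dR x).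
  - apply is_lim_seq_const.
  - replace (Finite 0) with (Rbar_mult (8 * L) 0) by (simpl; now rewrite Rmult_0_r).
    apply is_lim_seq_scal_l.
    apply (is_lim_seq_inv INR p_infty); [apply is_lim_seq_INR | discriminate].
Qed.

(** * Uniqueness of Fourier coefficients *)

Definition e2pi (y : R) : C := Cexp (RtoC (2 * PI * y) * Ci).

Lemma e2pi_plus (x y : R) : e2pi (x + y) = (e2pi x * e2pi y)%C.
Proof.
  unfold e2pi; rewrite <- Cexp_plus; f_equal.
  rewrite <- Cmult_plus_distr_r, <- RtoC_plus; do 2 f_equal; ring.
Qed.

Lemma e2pi_Z (n : Z) : e2pi (IZR n) = 1%C.
Proof. apply Cexp_2PI_Z. Qed.

Lemma e2pi_eq (y : R) : e2pi y = (cos (2 * PI * y), sin (2 * PI * y)).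
Proof.
  unfold e2pi, Cexp; simpl.
  replace (2 * PI * y * 0 - 0 * 1) with 0 by ring.
  replace (2 * PI * y * 1 + 0 * 0) with (2 * PI * y) by ring.
  rewrite exp_0; apply C_ext; simpl; ring.
Qed.

Lemma Cmod_e2pi (y : R) : Cmod (e2pi y) = 1.
Proof.
  unfold e2pi; rewrite Cmod_Cexp; simpl.
  rewrite <- exp_0; f_equal; ring.
Qed.

Lemma Cderive_e2pi (c x : R) :
  Cderive_at (fun y => e2pi (c * y)) x (RtoC (2 * PI * c) * Ci * e2pi (c * x))%C.
Proof.
  unfold e2pi; apply (Cderive_Cexp (fun y => RtoC (2 * PI * (c * y)) * Ci)%C).
  apply Cderive_eq with (RtoC (2 * PI * c) * Ci + RtoC (2 * PI * (c * x)) * 0)%C.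
  - apply (Cderive_mult (fun y => RtoC (2 * PI * (c * y))) (fun _ => Ci)).
    + apply Cderive_RtoC; auto_derive; [exact I | ring].
    + apply Cderive_const.
  - ring.
Qed.

Lemma Ccontinuous_e2pi (c x : R) : Ccontinuous (fun y => e2pi (c * y)) x.
Proof. apply Cderive_continuous with (1 := Cderive_e2pi c x). Qed.

Lemma zero_of_real_geom_bound (a K r : R) : 0 <= r < 1 -> 0 <= a ->
  (forall N : nat, a <= K * r ^ N) -> a = 0.
Proof.
  intros hr ha h; apply RtoC_inj, (zero_of_geom_bound _ K r hr).
  intros N; rewrite Cmod_R, Rabs_pos_eq by exact ha; apply h.
Qed.

Lemma cos_mult_Rabs (c x : R) : cos (c * Rabs x) = cos (c * x).
Proof.
  unfold Rabs; destruct (Rcase_abs x); [|reflexivity].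
  rewrite <- cos_neg; f_equal; ring.
Qed.

(** The powers of [cos (pi x) ^ 2] concentrate at the origin, so a function
    orthogonal to all of them cannot be positive there. *)
Lemma not_pos_of_orthogonal_cos (f : R -> R) (M : R) :
  (forall x, - / 2 <= x <= / 2 -> continuous f x) ->
  (forall x, - / 2 <= x <= / 2 -> Rabs (f x) <= M) ->
  (forall n, RInt (fun x => f x * (cos (PI * x) ^ 2) ^ n) (- / 2) (/ 2) = 0) ->
  f 0 <= 0.
Proof.
  intros hc hM h0; destruct (Rle_or_lt (f 0) 0) as [h|hf]; [exact h|exfalso].
  set (d := f 0) in *.
  set (k := fun x => cos (PI * x) ^ 2).
  assert (hpi := PI_RGT_0).
  assert (kc : forall x, continuous k x).
  { intros x; apply (ex_derive_continuous (V := R_NormedModule) k).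
    unfold k; auto_derive; exact I. }
  assert (knc : forall n x, continuous (fun x => k x ^ n) x).
  { intros n x; apply (ex_derive_continuous (V := R_NormedModule) (fun x => k x ^ n)).
    unfold k; auto_derive; exact I. }
  assert (k0 : forall x, 0 <= k x) by (intros; apply pow2_ge_0).
  assert (kmon : forall x y, 0 <= x -> x <= Rabs y -> Rabs y <= / 2 -> k y <= k x).
  { intros x y hx hxy hy; unfold k.
    rewrite <- (cos_mult_Rabs PI y).
    apply pow_incr; split; [apply cos_ge_0; nra|].
    apply cos_decr_1; nra. }
  assert (hd : exists del, 0 < del < / 4 /\ forall x, Rabs x <= del -> d / 2 <= f x).
  { assert (c0 := hc 0 ltac:(lra)).
    apply filterlim_locally with (eps := mkposreal (d / 2) ltac:(lra)) in c0.
    destruct c0 as [e he].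
    exists (Rmin (e / 2) (/ 8)); split.
    - split; [apply Rmin_pos; destruct e; simpl; lra|].
      apply Rle_lt_trans with (1 := Rmin_r _ _); lra.
    - intros x hx; specialize (he x).
      unfold ball in he; simpl in he; unfold AbsRing_ball, abs, minus, plus, opp in he;
        simpl in he.
      assert (hxe : Rabs (x + - 0) < e).
      { rewrite Ropp_0, Rplus_0_r; apply Rle_lt_trans with (1 := hx).
        apply Rle_lt_trans with (1 := Rmin_l _ _); destruct e; simpl; lra. }
      apply he in hxe; apply Rabs_def2 in hxe; fold d in hxe; destruct hxe; lra. }
  destruct hd as [del [hdel hfd]].
  set (q := k del); set (p := k (del / 2)).
  assert (hq : 0 <= q) by apply k0.
  assert (hcos : 0 <= cos (PI * del) < cos (PI * (del / 2))).
  { split; [apply cos_ge_0; nra|]; apply cos_decreasing_1; nra. }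
  assert (hqp : q < p) by (unfold q, p, k; nra).
  assert (hp : 0 < p) by lra.
  assert (hM0 : 0 <= M) by (apply Rle_trans with (2 := hM 0 ltac:(lra)); apply Rabs_pos).
  (* With [q] the value of the kernel at [del]: inside [|x| <= del] the function is
     at least [d / 2], outside the kernel is at most [q]. *)
  assert (hlow : forall n x, - / 2 <= x <= / 2 ->
    d / 2 * k x ^ n - (M + d / 2) * q ^ n <= f x * k x ^ n).
  { intros n x hx.
    assert (hkn : 0 <= k x ^ n) by apply pow_le, k0.
    assert (hqn : 0 <= q ^ n) by now apply pow_le.
    destruct (Rle_or_lt (Rabs x) del) as [hx'|hx'].
    - specialize (hfd x hx'); nra.
    - assert (hkq : k x ^ n <= q ^ n).
      { apply pow_incr; split; [apply k0|]; apply kmon; try lra.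
        apply Rabs_le; lra. }
      assert (hfx := hM x hx); apply Rabs_le_between in hfx; nra. }
  assert (exk : forall n a b, ex_RInt (fun x => k x ^ n) a b).
  { intros n a b; apply (ex_RInt_continuous (V := R_CompleteNormedModule)).
    intros; apply knc. }
  (* The mass of the kernel near the origin beats [q ^ n]. *)
  assert (hint : forall n, del * p ^ n <= RInt (fun x => k x ^ n) (- / 2) (/ 2)).
  { intros n.
    rewrite <- (RInt_Chasles (V := R_CompleteNormedModule) _ (- / 2) (- (del / 2)) (/ 2)
      (exk n _ _) (exk n _ _)).
    rewrite <- (RInt_Chasles (V := R_CompleteNormedModule) _ (- (del / 2)) (del / 2) (/ 2)
      (exk n _ _) (exk n _ _)).
    unfold plus; simpl.
    assert (h1 : 0 <= RInt (fun x => k x ^ n) (- / 2) (- (del / 2))).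
    { apply RInt_ge_0; [lra | apply exk|]; intros; apply pow_le, k0. }
    assert (h2 : 0 <= RInt (fun x => k x ^ n) (del / 2) (/ 2)).
    { apply RInt_ge_0; [lra | apply exk|]; intros; apply pow_le, k0. }
    assert (h3 : del * p ^ n <= RInt (fun x => k x ^ n) (- (del / 2)) (del / 2)).
    { replace (del * p ^ n) with (RInt (fun _ => p ^ n) (- (del / 2)) (del / 2)).
      2: { rewrite RInt_const; unfold scal; simpl; unfold mult; simpl; field. }
      apply RInt_le; [lra | apply ex_RInt_const | apply exk |].
      intros x hx; apply pow_incr; split; [apply k0|].
      unfold p, k.
      assert (hax : Rabs x <= del / 2) by (apply Rabs_le; lra).
      rewrite <- (cos_mult_Rabs PI x).
      assert (hx0 := Rabs_pos x).
      apply pow_incr; split; [lra|]; apply cos_decr_1; nra. }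
    lra. }
  assert (hmain : forall n, del * d / 2 <= (M + d / 2) * (q / p) ^ n).
  { intros n.
    assert (hle : RInt (fun x => d / 2 * k x ^ n - (M + d / 2) * q ^ n) (- / 2) (/ 2)
      <= RInt (fun x => f x * k x ^ n) (- / 2) (/ 2)).
    { apply RInt_le; [lra | | |].
      - apply (ex_RInt_minus (V := R_NormedModule)).
        + apply (ex_RInt_scal (V := R_NormedModule)), exk.
        + apply ex_RInt_const.
      - apply (ex_RInt_continuous (V := R_CompleteNormedModule)).
        rewrite Rmin_left, Rmax_right by lra; intros x hx.
        apply (continuous_mult (K := R_AbsRing)); [now apply hc | apply knc].
      - intros x hx; apply hlow; lra. }
    unfold k at 2 in hle; rewrite h0 in hle.
    rewrite (RInt_minus (V := R_CompleteNormedModule)) in hle.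
    2: apply (ex_RInt_scal (V := R_NormedModule)), exk.
    2: apply ex_RInt_const.
    rewrite (RInt_scal (V := R_CompleteNormedModule)) in hle by apply exk.
    rewrite RInt_const in hle.
    unfold minus, plus, opp, scal in hle; simpl in hle; unfold mult in hle; simpl in hle.
    specialize (hint n).
    assert (hpn : 0 < p ^ n) by now apply pow_lt.
    unfold Rdiv at 3; rewrite Rpow_mult_distr, pow_inv.
    apply Rmult_le_reg_r with (p ^ n); [exact hpn|].
    replace ((M + d / 2) * (q ^ n * / p ^ n) * p ^ n) with ((M + d / 2) * q ^ n)
      by (field; lra).
    nra. }
  assert (hz : del * d / 2 = 0).
  { apply (zero_of_real_geom_bound _ (M + d / 2) (q / p)); [split| |exact hmain].
    - apply Rdiv_le_0_compat; lra.
    - apply Rmult_lt_reg_r with p; [exact hp|]; unfold Rdiv.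
      rewrite Rmult_assoc, Rinv_l; lra.
    - nra. }
  nra.
Qed.

Lemma zero_of_orthogonal_cos (f : R -> R) (M : R) :
  (forall x, - / 2 <= x <= / 2 -> continuous f x) ->
  (forall x, - / 2 <= x <= / 2 -> Rabs (f x) <= M) ->
  (forall n, is_RInt (fun x => f x * (cos (PI * x) ^ 2) ^ n) (- / 2) (/ 2) 0) ->
  f 0 = 0.
Proof.
  intros hc hM h0; apply Rle_antisym.
  - apply (not_pos_of_orthogonal_cos f M); auto; intros; now apply is_RInt_unique.
  - assert (h : - f 0 <= 0); [|lra].
    apply (not_pos_of_orthogonal_cos (fun x => - f x) M); auto.
    + intros x hx; apply (continuous_opp (V := R_NormedModule)); auto.
    + intros x hx; rewrite Rabs_Ropp; auto.
    + intros n; apply is_RInt_unique.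
      apply is_RInt_ext with (fun x => opp (f x * (cos (PI * x) ^ 2) ^ n)).
      * intros x _; unfold opp; simpl; ring.
      * replace 0 with (opp 0) by (unfold opp; simpl; ring).
        now apply (is_RInt_opp (V := R_NormedModule)).
Qed.

(** The even powers of [cos (pi x)] are trigonometric polynomials of period [1],
    so they are orthogonal to [f] as soon as all characters are. *)
Lemma fourier_uniqueness (f : R -> C) (M : R) :
  (forall x, - / 2 <= x <= / 2 -> Ccontinuous f x) ->
  (forall x, - / 2 <= x <= / 2 -> Cmod (f x) <= M) ->
  (forall k : Z, is_CInt (fun x => f x * e2pi (IZR k * x))%C (- / 2) (/ 2) 0) ->
  f 0 = 0%C.
Proof.
  intros hc hM h.
  (* [cos (pi x)^2 = 1/2 + (exp (2 pi i x) + exp (- 2 pi i x)) / 4] *)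
  assert (hcos : forall (n : nat) (k : Z),
    is_CInt (fun x => f x * e2pi (IZR k * x) * RtoC ((cos (PI * x) ^ 2) ^ n))%C
      (- / 2) (/ 2) 0).
  { induction n as [|n IH]; intros k.
    - apply is_CInt_ext with (3 := h k); [lra|]; intros x _; simpl; ring.
    - assert (h1 := is_CInt_scal (RtoC (/ 2)) _ _ _ _ (IH k)).
      assert (h2 := is_CInt_scal (RtoC (/ 4)) _ _ _ _
        (is_CInt_plus _ _ _ _ _ _ (IH (k + 1)%Z) (IH (k - 1)%Z))).
      assert (h3 := is_CInt_plus _ _ _ _ _ _ h1 h2).
      replace (RtoC (/ 2) * 0 + RtoC (/ 4) * (0 + 0))%C with (RtoC 0) in h3 by ring.
      apply is_CInt_ext with (3 := h3); [lra|]; intros x _; simpl.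
      rewrite plus_IZR, minus_IZR.
      replace ((IZR k + 1) * x) with (IZR k * x + x) by ring.
      replace ((IZR k - 1) * x) with (IZR k * x + - x) by ring.
      rewrite !e2pi_plus.
      assert (hk : RtoC (cos (PI * x) * (cos (PI * x) * 1))
        = (RtoC (/ 2) + RtoC (/ 4) * (e2pi x + e2pi (- x)))%C).
      { rewrite !e2pi_eq.
        replace (2 * PI * x) with (2 * (PI * x)) by ring.
        replace (2 * PI * - x) with (- (2 * (PI * x))) by ring.
        rewrite cos_neg, sin_neg, cos_2a_cos.
        apply C_ext; simpl; field. }
      rewrite RtoC_mult, hk; ring. }
  assert (hre : forall n x, Re (f x * e2pi (IZR 0 * x) * RtoC ((cos (PI * x) ^ 2) ^ n))
     = Re (f x) * (cos (PI * x) ^ 2) ^ n).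
  { intros n x; replace (IZR 0 * x) with (IZR 0) by (simpl; ring).
    rewrite e2pi_Z; simpl; unfold Re, Im; ring. }
  assert (him : forall n x, Im (f x * e2pi (IZR 0 * x) * RtoC ((cos (PI * x) ^ 2) ^ n))
     = Im (f x) * (cos (PI * x) ^ 2) ^ n).
  { intros n x; replace (IZR 0 * x) with (IZR 0) by (simpl; ring).
    rewrite e2pi_Z; simpl; unfold Re, Im; ring. }
  apply C_ext.
  - apply (zero_of_orthogonal_cos (fun x => Re (f x)) M).
    + intros; now apply Ccontinuous_re, hc.
    + intros x hx; apply Rle_trans with (1 := re_le_Cmod _); auto.
    + intros n; assert (hn := is_CInt_re _ _ _ _ (hcos n 0%Z)).
      apply is_RInt_ext with (2 := hn); intros; apply hre.
  - apply (zero_of_orthogonal_cos (fun x => Im (f x)) M).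
    + intros; now apply Ccontinuous_im, hc.
    + intros x hx; apply Rle_trans with (1 := im_le_Cmod _); auto.
    + intros n; assert (hn := is_CInt_im _ _ _ _ (hcos n 0%Z)).
      apply is_RInt_ext with (2 := hn); intros; apply him.
Qed.

(** * Poisson summation for Gaussians *)

Lemma exp_neg_pow (c : R) (m : nat) : exp (- c) ^ m = exp (- (c * INR m)).
Proof.
  induction m as [|m IH].
  - simpl; rewrite Rmult_0_r, Ropp_0, exp_0; reflexivity.
  - rewrite S_INR; simpl; rewrite IH, <- exp_plus; f_equal; ring.
Qed.

Lemma exp_neg_lt_1 (c : R) : 0 < c -> 0 <= exp (- c) < 1.
Proof.
  intros hc; split; [left; apply exp_pos|].
  rewrite <- exp_0; apply exp_increasing; lra.
Qed.

Lemma exp_le (x y : R) : x <= y -> exp x <= exp y.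
Proof. intros [h| ->]; [left; now apply exp_increasing | right; reflexivity]. Qed.

Lemma INR_abs_nat (n : Z) : INR (Z.abs_nat n) = Rabs (IZR n).
Proof. rewrite INR_IZR_INZ, Zabs2Nat.id_abs, abs_IZR; reflexivity. Qed.

(** The range [|y| <= 2] leaves room for a point of the period interval, a shift
    by at most [1/2], and a neighbourhood. *)
Lemma gaussian_le_geom (c y : R) (n : Z) : 0 < c -> Rabs y <= 2 ->
  exp (- (c * (IZR n + y) ^ 2)) <= exp (9 * c / 4) * exp (- c) ^ Z.abs_nat n.
Proof.
  intros hc hy; rewrite exp_neg_pow, INR_abs_nat, <- exp_plus; apply exp_le.
  (* [(|n| - |y|)^2 >= |n| - |y| - 1/4] *)
  assert (h : Rabs (IZR n) - 9 / 4 <= (IZR n + y) ^ 2).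
  { assert (h1 := Rabs_triang (IZR n + y) (- y)).
    replace (IZR n + y + - y) with (IZR n) in h1 by ring; rewrite Rabs_Ropp in h1.
    rewrite <- (pow2_abs (IZR n + y)).
    generalize (pow2_ge_0 (Rabs (IZR n + y) - / 2)); nra. }
  nra.
Qed.

(** The image of the right half-plane under the principal square root: as [b]
    runs through the cone, [i b^2] runs through the upper half-plane, and
    [exp (- pi b^2 x^2)] decays along the real axis. *)
Definition cone (b : C) : Prop := Rabs (Im b) < Re b.

Lemma cone_square_pos (b : C) : cone b -> 0 < Re b ^ 2 - Im b ^ 2.
Proof.
  unfold cone; intros h; rewrite <- (pow2_abs (Im b)).
  generalize (Rabs_pos (Im b)); nra.
Qed.

Lemma cone_neq_0 (b : C) : cone b -> b <> 0%C.
Proof.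
  intros h e; apply cone_square_pos in h; rewrite e in h; simpl in h; lra.
Qed.

Lemma cone_inv (b : C) : cone b -> cone (/ b).
Proof.
  intros h; assert (h2 := cone_square_pos b h).
  destruct b as [x y]; unfold cone in *; simpl in *.
  assert (hp : 0 < x * (x * 1) + y * (y * 1)) by nra.
  unfold Rdiv; rewrite Rabs_mult, Rabs_Ropp.
  rewrite (Rabs_pos_eq (/ _)) by (left; now apply Rinv_0_lt_compat).
  apply Rmult_lt_compat_r; [now apply Rinv_0_lt_compat | exact h].
Qed.

Lemma gauss_line_dominated (b : C) (y : R) : cone b -> Rabs y <= 2 ->
  geom_dominated (exp (9 * (PI * (Re b ^ 2 - Im b ^ 2)) / 4))
    (exp (- (PI * (Re b ^ 2 - Im b ^ 2)))) (fun n => gauss (b * RtoC (IZR n + y))).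
Proof.
  intros hb hy n; rewrite Cmod_gauss.
  apply Rle_trans with (2 := gaussian_le_geom _ y n
    (Rmult_lt_0_compat _ _ PI_RGT_0 (cone_square_pos b hb)) hy).
  right; f_equal; simpl; unfold Re, Im; ring.
Qed.

Lemma cone_ratio (b : C) : cone b ->
  0 <= exp (- (PI * (Re b ^ 2 - Im b ^ 2))) < 1.
Proof.
  intros hb; apply exp_neg_lt_1, Rmult_lt_0_compat;
    [apply PI_RGT_0 | now apply cone_square_pos].
Qed.

Lemma is_CInt_Chasles (f : R -> C) (a b c : R) (l m : C) :
  is_CInt f a b l -> is_CInt f b c m -> is_CInt f a c (l + m)%C.
Proof. exact (@is_RInt_Chasles C_R_NormedModule f a b c l m). Qed.

Lemma CInt_Chasles (f : R -> C) (a b c : R) : a <= b <= c ->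
  (forall x, Ccontinuous f x) -> (CInt f a b + CInt f b c)%C = CInt f a c.
Proof.
  intros h hf; symmetry; apply CInt_unique, is_CInt_Chasles with b;
    apply CInt_correct; auto; lra.
Qed.

Lemma is_CInt_shift (f : R -> C) (a b c : R) (l : C) :
  is_CInt f (a + c) (b + c) l -> is_CInt (fun x => f (x + c)) a b l.
Proof.
  intros h.
  apply (@is_RInt_ext C_R_NormedModule
    (fun x => @scal R_AbsRing C_R_NormedModule 1 (f (1 * x + c)))).
  - intros x _; rewrite Rmult_1_l; apply (@scal_one R_AbsRing C_R_NormedModule).
  - apply (@is_RInt_comp_lin C_R_NormedModule); rewrite !Rmult_1_l; exact h.
Qed.

(** The partial sums run over [-N <= n < N], so that the unit intervals centred
    at these integers fill an interval that is slightly off centre. *)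
Lemma zsum_CInt_unit_intervals (f : R -> C) (N : nat) :
  (forall x, Ccontinuous f x) ->
  zsum (fun n => CInt f (IZR n - / 2) (IZR n + / 2)) N
  = CInt f (- INR N - / 2) (INR N - / 2).
Proof.
  intros hf.
  assert (hp : (csum (fun n => CInt f (IZR (Z.of_nat n) - / 2) (IZR (Z.of_nat n) + / 2)) N)
    = CInt f (- / 2) (INR N - / 2)).
  { induction N as [|N IH].
    - simpl; symmetry; replace (0 - / 2) with (- / 2) by ring.
      apply (@RInt_point C_R_CompleteNormedModule).
    - simpl csum; rewrite IH, <- INR_IZR_INZ, S_INR.
      replace (INR N + 1 - / 2) with (INR N + / 2) by field.
      apply CInt_Chasles; [generalize (pos_INR N); lra | exact hf]. }
  assert (hn : (csum (fun n => CInt f (IZR (- Z.of_nat (S n)) - / 2)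
      (IZR (- Z.of_nat (S n)) + / 2)) N) = CInt f (- INR N - / 2) (- / 2)).
  { clear hp; induction N as [|N IH].
    - simpl; symmetry; replace (- 0 - / 2) with (- / 2) by ring.
      apply (@RInt_point C_R_CompleteNormedModule).
    - cbn [csum]; rewrite IH, opp_IZR, <- INR_IZR_INZ, S_INR, Cplus_comm.
      replace (- (INR N + 1) + / 2) with (- INR N - / 2) by field.
      apply CInt_Chasles; [generalize (pos_INR N); lra | exact hf]. }
  unfold zsum; rewrite hp, hn, Cplus_comm.
  apply CInt_Chasles; [generalize (pos_INR N); lra | exact hf].
Qed.

Definition periodized_gauss (b : C) (w x : R) : C :=
  ZSeries (fun n => gauss (b * RtoC (IZR n + (x + w)))).

Lemma Ccontinuous_affine (b w : C) (x : R) :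
  Ccontinuous (fun y : R => b * RtoC y + w)%C x.
Proof.
  apply Ccontinuous_plus; [|apply Ccontinuous_const].
  apply Ccontinuous_mult; [apply Ccontinuous_const|].
  apply Ccontinuous_RtoC, continuous_id.
Qed.

Lemma Ccontinuous_gauss_line (b : C) (c x : R) :
  Ccontinuous (fun y => gauss (b * RtoC (y + c))) x.
Proof.
  apply Ccontinuous_gauss, Ccontinuous_mult; [apply Ccontinuous_const|].
  apply Ccontinuous_RtoC, (continuous_plus (V := R_NormedModule));
    [apply continuous_id | apply continuous_const].
Qed.

Lemma Ccontinuous_periodized_gauss (b : C) (w x : R) : cone b ->
  Rabs w <= / 2 -> - / 2 <= x <= / 2 -> Ccontinuous (periodized_gauss b w) x.
Proof.
  intros hb hw hx.
  apply (ZSeries_continuous (fun y n => gauss (b * RtoC (IZR n + (y + w)))) x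
    (exp (9 * (PI * (Re b ^ 2 - Im b ^ 2)) / 4)) _ (cone_ratio b hb)
    (Rlt_le _ _ (exp_pos _))).
  - exists (mkposreal 1 Rlt_0_1); intros y hy.
    apply gauss_line_dominated; [exact hb|].
    apply Rabs_def2 in hy; destruct hy as [h1 h2].
    unfold minus, plus, opp in h1, h2; simpl in h1, h2.
    apply Rabs_le_between in hw; apply Rabs_le; lra.
  - intros n.
    apply continuous_ext with (fun y => gauss (b * RtoC (y + (IZR n + w)))).
    + intros y; do 3 f_equal; ring.
    + apply Ccontinuous_gauss_line.
Qed.

(** The Fourier coefficients of a periodization are integrals over the whole
    line, here limits over the intervals on which the partial sums unfold. *)
Lemma periodized_gauss_unfold (b : C) (w : R) (k : Z) : cone b -> Rabs w <= / 2 ->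
  Clim_seq (fun N => CInt (fun x => gauss (b * RtoC (x + w)) * e2pi (IZR k * x))%C
                       (- INR N - / 2) (INR N - / 2))
    (CInt (fun x => periodized_gauss b w x * e2pi (IZR k * x))%C (- / 2) (/ 2)).
Proof.
  intros hb hw.
  set (phi := fun x => (gauss (b * RtoC (x + w)) * e2pi (IZR k * x))%C).
  assert (hphi : forall x, Ccontinuous phi x).
  { intros x; apply Ccontinuous_mult;
      [apply Ccontinuous_gauss_line | apply Ccontinuous_e2pi]. }
  set (A := exp (9 * (PI * (Re b ^ 2 - Im b ^ 2)) / 4)).
  set (r := exp (- (PI * (Re b ^ 2 - Im b ^ 2)))).
  assert (hr := cone_ratio b hb); fold r in hr.
  assert (hA : 0 <= A) by (left; apply exp_pos).
  assert (hdom : forall x, - / 2 <= x <= / 2 ->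
    geom_dominated A r (fun n => gauss (b * RtoC (IZR n + (x + w))))).
  { intros x hx; apply gauss_line_dominated; [exact hb|].
    apply Rabs_le_between in hw; apply Rabs_le; lra. }
  apply (Clim_seq_geom _ _ ((/ 2 - - / 2) * (4 * A / (1 - r))) r hr); intros N.
  rewrite <- (zsum_CInt_unit_intervals phi N hphi).
  rewrite <- Cmod_opp, Copp_minus_distr.
  apply (CInt_ZSeries (fun x n => e2pi (IZR k * x)
      * gauss (b * RtoC (IZR n + (x + w))))%C); auto; try lra.
  - intros x hx n; rewrite Cmod_mult, Cmod_e2pi, Rmult_1_l; now apply hdom.
  - intros n; apply is_CInt_ext with (fun x => phi (x + IZR n)); [lra | |].
    + intros x hx; unfold phi.
      rewrite Rmult_plus_distr_l, e2pi_plus, <- mult_IZR, e2pi_Z, Cmult_1_r, Cmult_comm.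
      do 4 f_equal; ring.
    + apply is_CInt_shift.
      replace (- / 2 + IZR n) with (IZR n - / 2) by ring.
      replace (/ 2 + IZR n) with (IZR n + / 2) by ring.
      apply CInt_correct; auto; lra.
  - apply is_CInt_ext with (fun x => periodized_gauss b w x * e2pi (IZR k * x))%C; [lra | |].
    + intros x hx; rewrite (ZSeries_scal (e2pi (IZR k * x)) A r _ hr hA (hdom x hx)).
      unfold periodized_gauss; ring.
    + apply CInt_correct; [lra|]; intros x hx; apply Ccontinuous_mult;
        [now apply Ccontinuous_periodized_gauss | apply Ccontinuous_e2pi].
Qed.

(** Completing the square: a character times a Gaussian is a Gaussian along a
    shifted line. *)
Lemma gauss_times_e2pi (b : C) (w x : R) (k : Z) : b <> 0%C ->
  (gauss (b * RtoC (x + w)) * e2pi (IZR k * x)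
   = gauss (RtoC (IZR k) / b) * e2pi (- (IZR k * w))
     * gauss (b * RtoC x + (b * RtoC w - Ci * RtoC (IZR k) / b)))%C.
Proof.
  intros hb; unfold gauss, e2pi; rewrite <- !Cexp_plus; f_equal.
  rewrite !RtoC_mult, RtoC_opp, RtoC_plus, !RtoC_mult.
  assert (hi := Ci_square).
  set (P := RtoC PI); set (K := RtoC (IZR k)); set (X := RtoC x); set (W := RtoC w).
  replace (- (P * ((b * X + (b * W - Ci * K / b)) * (b * X + (b * W - Ci * K / b)))))%C
    with (- (P * ((b * (X + W)) * (b * (X + W)))) + 2 * P * (K * (X + W)) * Ci
          - P * (Ci * Ci) * (K / b * (K / b)))%C by (field; exact hb).
  rewrite hi; ring.
Qed.

(** Since shifting and rotating the line of integration does not change the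
    Gaussian integral [g], every Fourier coefficient is an explicit multiple of
    [g]. *)
Lemma periodized_gauss_fourier (g : C) : 
  Clim_seq (fun N => CInt (fun x => gauss (RtoC x)) (- INR N - / 2) (INR N - / 2)) g ->
  forall (b : C) (w : R) (k : Z), cone b -> Rabs w <= / 2 ->
  CInt (fun x => periodized_gauss b w x * e2pi (IZR k * x))%C (- / 2) (/ 2)
  = (g / b * (gauss (RtoC (IZR k) / b) * e2pi (- (IZR k * w))))%C.
Proof.
  intros hg b w k hb hw; assert (hb0 := cone_neq_0 b hb).
  apply (Clim_seq_unique _ _ _ (periodized_gauss_unfold b w k hb hw)).
  set (w' := (b * RtoC w - Ci * RtoC (IZR k) / b)%C).
  assert (h := Clim_seq_plus _ _ _ _ (gauss_contour b w' hb) hg).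
  apply (Clim_seq_scal (gauss (RtoC (IZR k) / b) * e2pi (- (IZR k * w)) / b)%C) in h.
  replace (g / b * (gauss (RtoC (IZR k) / b) * e2pi (- (IZR k * w))))%C
    with (gauss (RtoC (IZR k) / b) * e2pi (- (IZR k * w)) / b * (0 + g))%C
    by (field; exact hb0).
  apply Clim_seq_ext with (2 := h); intros N.
  rewrite (CInt_unique (fun x => gauss (b * RtoC (x + w)) * e2pi (IZR k * x))%C _ _
    (gauss (RtoC (IZR k) / b) * e2pi (- (IZR k * w))
    * CInt (fun x => gauss (b * RtoC x + w')) (- INR N - / 2) (INR N - / 2))%C).
  - field; exact hb0.
  - assert (hN := pos_INR N).
    apply is_CInt_ext with (fun x => gauss (RtoC (IZR k) / b) * e2pi (- (IZR k * w))
      * gauss (b * RtoC x + w'))%C; [lra | |].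
    + intros x _; symmetry; now apply gauss_times_e2pi.
    + apply is_CInt_scal, CInt_correct; [lra|]; intros x _.
      apply Ccontinuous_gauss, Ccontinuous_affine.
Qed.

Lemma e2pi_orthogonal (k : Z) :
  is_CInt (fun x => e2pi (IZR k * x)) (- / 2) (/ 2) (if Z.eq_dec k 0 then 1 else 0)%C.
Proof.
  destruct (Z.eq_dec k 0) as [->|hk].
  - apply is_CInt_ext with (fun _ => RtoC 1); [lra | |].
    + intros x _; rewrite Rmult_0_l; symmetry; apply (e2pi_Z 0).
    + unfold is_CInt; evar_last; [apply (@is_RInt_const C_R_NormedModule)|].
      rewrite scal_RtoC, Cmult_1_r; f_equal; field.
  - assert (hk' : RtoC (2 * PI * IZR k) <> 0%C).
    { intros e; apply RtoC_inj in e.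
      apply Rmult_integral in e; destruct e as [e|e].
      - generalize PI_RGT_0; lra.
      - now apply eq_IZR in e. }
    assert (hi := Ci_neq_0).
    set (c := (RtoC (2 * PI * IZR k) * Ci)%C).
    assert (hc : c <> 0%C) by now apply Cmult_neq_0.
    assert (h := is_CInt_derive (fun x => / c * e2pi (IZR k * x))%C
      (fun x => e2pi (IZR k * x)) (- / 2) (/ 2) ltac:(lra)).
    cbv beta in h.
    replace (/ c * e2pi (IZR k * / 2) - / c * e2pi (IZR k * - / 2))%C with (RtoC 0) in h.
    + apply h; intros x _; [|apply Ccontinuous_e2pi].
      apply Cderive_eq with (0 * e2pi (IZR k * x) + / c * (c * e2pi (IZR k * x)))%C.
      * apply (Cderive_mult (fun _ => / c)%C (fun y => e2pi (IZR k * y))); [apply Cderive_const | apply Cderive_e2pi].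
      * field; exact hc.
    + replace (IZR k * / 2) with (IZR k * - / 2 + IZR k) by field.
      rewrite e2pi_plus, e2pi_Z; ring.
Qed.

Lemma csum_zero (N : nat) : csum (fun _ => 0%C) N = 0%C.
Proof. induction N as [|N IH]; simpl; [|rewrite IH]; ring. Qed.

Lemma csum_single (a : nat -> C) (m N : nat) : (m < N)%nat ->
  (forall n, n <> m -> a n = 0%C) -> csum a N = a m.
Proof.
  intros hm ha; induction N as [|N IH]; [lia|]; simpl.
  destruct (Nat.eq_dec m N) as [->|hne].
  - replace (csum a N) with (RtoC 0); [ring|].
    assert (h : forall M, (M <= N)%nat -> csum a M = 0%C).
    { induction M as [|M IHM]; intros hM; simpl; [reflexivity|].
      rewrite IHM, ha by lia; ring. }
    symmetry; apply h; lia.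
  - rewrite IH, (ha N) by lia; ring.
Qed.

Lemma zsum_single (a : Z -> C) (j : Z) (N : nat) : (Z.abs_nat j < N)%nat ->
  (forall k, k <> j -> a k = 0%C) -> zsum a N = a j.
Proof.
  intros hj ha; unfold zsum; destruct (Z.neg_nonneg_cases j) as [hneg|hpos].
  - rewrite (csum_ext _ (fun _ => 0%C)), csum_zero by (intros; apply ha; lia).
    rewrite (csum_single _ (Z.abs_nat j - 1)).
    + rewrite Cplus_0_l; f_equal; lia.
    + lia.
    + intros n hn; apply ha; lia.
  - rewrite (csum_ext (fun n => a (- Z.of_nat (S n))%Z) (fun _ => 0%C)), csum_zero
      by (intros; apply ha; lia).
    rewrite (csum_single _ (Z.abs_nat j)).
    + rewrite Cplus_0_r; f_equal; lia.
    + lia.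
    + intros n hn; apply ha; lia.
Qed.

(** Orthogonality of the characters, applied termwise.  The exponent [- k x]
    matches the test functions [e2pi (k x)] of [fourier_uniqueness]. *)
Lemma trig_series_fourier (d : Z -> C) (A r : R) (j : Z) : 0 <= r < 1 -> 0 <= A ->
  geom_dominated A r d ->
  is_CInt (fun x => ZSeries (fun k => d k * e2pi (- IZR k * x))%C * e2pi (IZR j * x))%C
    (- / 2) (/ 2) (d j).
Proof.
  intros hr hA hd.
  assert (hdx : forall x, geom_dominated A r (fun k => d k * e2pi (- IZR k * x))%C).
  { intros x k; rewrite Cmod_mult, Cmod_e2pi, Rmult_1_r; apply hd. }
  set (f := fun x => ZSeries (fun k => e2pi (IZR j * x) * (d k * e2pi (- IZR k * x)))%C).
  assert (hf : forall x, Ccontinuous f x).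
  { intros x; apply (ZSeries_continuous
      (fun x k => e2pi (IZR j * x) * (d k * e2pi (- IZR k * x)))%C x A r hr hA).
    - apply filter_forall; intros y k; rewrite Cmod_mult, Cmod_e2pi, Rmult_1_l; apply hdx.
    - intros k; apply Ccontinuous_mult; [apply Ccontinuous_e2pi|].
      apply Ccontinuous_mult; [apply Ccontinuous_const | apply Ccontinuous_e2pi]. }
  apply is_CInt_ext with f; [lra | |].
  { intros x _; unfold f; rewrite (ZSeries_scal _ A r _ hr hA (hdx x)); ring. }
  assert (hI : is_CInt f (- / 2) (/ 2) (CInt f (- / 2) (/ 2))) by (apply CInt_correct; auto; lra).
  replace (d j) with (CInt f (- / 2) (/ 2)); [exact hI|].
  set (I := fun k => (d k * (if Z.eq_dec (j - k) 0 then 1 else 0))%C).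
  replace (d j) with (I j).
  2: { unfold I; destruct (Z.eq_dec (j - j) 0); [ring | lia]. }
  apply (Clim_seq_unique (fun N => zsum I N)).
  - apply (Clim_seq_geom _ _ ((/ 2 - - / 2) * (4 * A / (1 - r))) r hr); intros N.
    rewrite <- Cmod_opp, Copp_minus_distr.
    apply (CInt_ZSeries (fun x k => e2pi (IZR j * x) * (d k * e2pi (- IZR k * x)))%C);
      auto; try lra.
    + intros x _ k; rewrite Cmod_mult, Cmod_e2pi, Rmult_1_l; apply hdx.
    + intros k; apply is_CInt_ext with (fun x => d k * e2pi (IZR (j - k) * x))%C; [lra | |].
      * intros x _; rewrite minus_IZR.
        replace ((IZR j - IZR k) * x) with (IZR j * x + - IZR k * x) by ring.
        rewrite e2pi_plus; ring.
      * apply is_CInt_scal, e2pi_orthogonal.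
  - apply is_lim_seq_ext_loc with (fun _ => 0); [|apply is_lim_seq_const].
    exists (S (Z.abs_nat j)); intros N hN.
    rewrite (zsum_single I j); [|lia|].
    + replace (I j - I j)%C with (RtoC 0) by ring; symmetry; apply Cmod_0.
    + intros k hk; unfold I; destruct (Z.eq_dec (j - k) 0); [lia | ring].
Qed.

(** The Gaussian integral converges because it is a Fourier coefficient of the
    periodized Gaussian with [b = 1]. *)
Lemma gaussian_integral_exists : exists g : C,
  Clim_seq (fun N => CInt (fun x => gauss (RtoC x)) (- INR N - / 2) (INR N - / 2)) g.
Proof.
  eexists.
  apply Clim_seq_ext with (2 := periodized_gauss_unfold 1 0 0 ltac:(
    unfold cone; simpl; rewrite Rabs_R0; lra) ltac:(rewrite Rabs_R0; lra)).
  intros N; assert (hN := pos_INR N); apply CInt_ext; [lra|].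
  intros x _; rewrite Rmult_0_l, (e2pi_Z 0), Rplus_0_r, Cmult_1_l; ring.
Qed.

Lemma gauss_inv_dominated (b c : C) (w : R) : cone b ->
  exists A r, 0 <= r < 1 /\ 0 <= A /\ geom_dominated A r
    (fun k => c * (gauss (RtoC (IZR k) / b) * e2pi (- (IZR k * w))))%C.
Proof.
  intros hb; assert (hb' := cone_inv b hb).
  eexists; eexists; split; [exact (cone_ratio _ hb')|]; split.
  2: { apply geom_dominated_scal; intros k.
       rewrite Cmod_mult, Cmod_e2pi, Rmult_1_r.
       replace (RtoC (IZR k) / b)%C with (/ b * RtoC (IZR k + 0))%C
         by (rewrite Rplus_0_r; unfold Cdiv; ring).
       apply gauss_line_dominated; [exact hb' | rewrite Rabs_R0; lra]. }
  apply Rmult_le_pos; [apply Cmod_ge_0 | left; apply exp_pos].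
Qed.

(** Both sides, with the summation point moving over a period, have the same
    Fourier coefficients. *)
Lemma poisson_up_to_constant : exists g : C, forall (b : C) (w : R),
  cone b -> Rabs w <= / 2 ->
  ZSeries (fun n => gauss (b * RtoC (IZR n + w)))
  = (g / b * ZSeries (fun k => gauss (RtoC (IZR k) / b) * e2pi (- (IZR k * w))))%C.
Proof.
  destruct gaussian_integral_exists as [g hg]; exists g; intros b w hb hw.
  destruct (gauss_inv_dominated b (g / b)%C w hb) as [A [r [hr [hA hd]]]].
  destruct (gauss_inv_dominated b 1%C w hb) as [A1 [r1 [hr1 [hA1 hd1]]]].
  set (d := fun k => (g / b * (gauss (RtoC (IZR k) / b) * e2pi (- (IZR k * w))))%C) in hd.
  set (S := fun x => ZSeries (fun k => d k * e2pi (- IZR k * x))%C).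
  assert (hdx : forall x, geom_dominated A r (fun k => d k * e2pi (- IZR k * x))%C).
  { intros x k; rewrite Cmod_mult, Cmod_e2pi, Rmult_1_r; apply hd. }
  assert (hS : forall x, Ccontinuous S x).
  { intros x; apply (ZSeries_continuous (fun x k => d k * e2pi (- IZR k * x))%C x A r hr hA).
    - apply filter_forall; intros y; apply hdx.
    - intros k; apply Ccontinuous_mult; [apply Ccontinuous_const | apply Ccontinuous_e2pi]. }
  (* Evaluating the difference at the origin is enough, because [w] is free. *)
  set (f := fun x => (periodized_gauss b w x - S x)%C).
  set (A0 := exp (9 * (PI * (Re b ^ 2 - Im b ^ 2)) / 4)).
  set (r0 := exp (- (PI * (Re b ^ 2 - Im b ^ 2)))).
  assert (hr0 := cone_ratio b hb); fold r0 in hr0.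
  assert (hf0 : f 0 = 0%C).
  { apply (fourier_uniqueness f (4 * A0 / (1 - r0) + 4 * A / (1 - r))).
    - intros x hx; apply Ccontinuous_minus; [now apply Ccontinuous_periodized_gauss | apply hS].
    - intros x hx; apply Rle_trans with (1 := Cmod_triangle _ _); rewrite Cmod_opp.
      apply Rplus_le_compat.
      + apply ZSeries_bound; [exact hr0 | left; apply exp_pos|].
        apply gauss_line_dominated; [exact hb|].
        apply Rabs_le_between in hw; apply Rabs_le; lra.
      + now apply ZSeries_bound.
    - intros k.
      replace (RtoC 0) with (d k - d k)%C by ring.
      apply is_CInt_ext with (fun x => periodized_gauss b w x * e2pi (IZR k * x)
        - S x * e2pi (IZR k * x))%C; [lra | |].
      + intros x _; unfold f; ring.
      + apply is_CInt_minus; [|now apply (trig_series_fourier d A r)].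
        unfold d at 1; rewrite <- (periodized_gauss_fourier g hg b w k hb hw).
        apply CInt_correct; [lra|]; intros x hx; apply Ccontinuous_mult;
          [now apply Ccontinuous_periodized_gauss | apply Ccontinuous_e2pi]. }
  assert (hfin : periodized_gauss b w 0 = S 0).
  { replace (periodized_gauss b w 0) with (f 0 + S 0)%C by (unfold f; ring).
    rewrite hf0; ring. }
  unfold periodized_gauss, S in hfin.
  rewrite (ZSeries_ext (fun n => gauss (b * RtoC (IZR n + w)))
    (fun n => gauss (b * RtoC (IZR n + (0 + w))))) by (intros; now rewrite Rplus_0_l).
  rewrite hfin.
  rewrite (ZSeries_ext _ d).
  2: { intros k; rewrite Rmult_0_r, (e2pi_Z 0); ring. }
  unfold d; apply (ZSeries_scal _ A1 r1); auto.
  intros k; specialize (hd1 k); cbv beta in hd1.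
  rewrite Cmult_1_l in hd1; exact hd1.
Qed.

Lemma gauss_RtoC (t : R) : gauss (RtoC t) = RtoC (exp (- (PI * (t * t)))).
Proof.
  unfold gauss; rewrite <- !RtoC_mult, <- RtoC_opp.
  unfold Cexp; simpl; rewrite cos_0, sin_0; apply C_ext; simpl; ring.
Qed.

(** All terms are positive; this is [theta3 i]. *)
Lemma ZSeries_gauss_neq_0 : ZSeries (fun n => gauss (1 * RtoC (IZR n + 0))) <> 0%C.
Proof.
  intros h; apply (f_equal Re) in h; revert h; apply Rgt_not_eq.
  assert (hb : cone 1) by (unfold cone; simpl; rewrite Rabs_R0; lra).
  assert (hd := gauss_line_dominated 1 0 hb ltac:(rewrite Rabs_R0; lra)).
  assert (hr := cone_ratio 1 hb).
  set (A := exp (9 * _ / 4)) in hd; set (r := exp _) in hd, hr.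
  set (a := fun n : Z => gauss (1 * RtoC (IZR n + 0))) in *.
  assert (hpos : forall n, 0 <= Re (a n)).
  { intros n; unfold a; rewrite Cmult_1_l, gauss_RtoC; left; apply exp_pos. }
  assert (h0 : Re (a 0%Z) = 1).
  { unfold a, gauss.
    replace (- (PI * (1 * RtoC (0 + 0) * (1 * RtoC (0 + 0)))))%C with (RtoC 0).
    - rewrite Cexp_0; reflexivity.
    - rewrite Rplus_0_l; ring. }
  assert (hs : forall c : nat -> Z, (forall n, Z.abs_nat (c n) >= n)%nat ->
    ex_series (fun n => Re (a (c n))) /\ 0 <= Series (fun n => Re (a (c n)))).
  { intros c hc.
    assert (hex : ex_series (fun n => Re (a (c n)))).
    { apply (CSeries_le_geom (fun n => a (c n)) A r hr).
      intros n; apply Rle_trans with (1 := hd _).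
      apply Rmult_le_compat_l; [left; apply exp_pos|].
      replace (Z.abs_nat (c n)) with (n + (Z.abs_nat (c n) - n))%nat
        by (specialize (hc n); lia).
      rewrite pow_add; apply Rle_trans with (r ^ n * 1); [|right; ring].
      apply Rmult_le_compat_l; [apply pow_le; lra|].
      rewrite <- (pow1 (Z.abs_nat (c n) - n)); apply pow_incr; lra. }
    split; [exact hex|].
      replace 0 with (Series (fun n => 0 * Re (a (c n))))
        by (rewrite Series_scal_l; ring).
      apply Series_le; [intros n; specialize (hpos (c n)); lra|].
      exact hex. }
  destruct (hs (fun n => Z.of_nat (S n)) ltac:(intros n; cbv beta; lia)) as [_ h1].
  destruct (hs (fun n => (- Z.of_nat (S n))%Z) ltac:(intros n; cbv beta; lia)) as [_ h2].
  destruct (hs (fun n => Z.of_nat n) ltac:(intros n; cbv beta; lia)) as [h3 _].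
  change (Series (fun n => Re (a (Z.of_nat n)))
          + Series (fun n => Re (a (- Z.of_nat (S n))%Z)) > 0).
  rewrite (Series_incr_1 _ h3); change (Z.of_nat 0) with 0%Z.
  rewrite h0; lra.
Qed.

(** The constant in Poisson's formula is the Gaussian integral; the self-dual
    case [b = 1], [w = 0] forces it to be [1]. *)
Lemma poisson_gauss (b : C) (w : R) : cone b -> Rabs w <= / 2 ->
  ZSeries (fun n => gauss (b * RtoC (IZR n + w)))
  = (/ b * ZSeries (fun k => gauss (RtoC (IZR k) / b) * e2pi (- (IZR k * w))))%C.
Proof.
  destruct poisson_up_to_constant as [g hg].
  assert (hg1 : g = 1%C).
  { assert (h := hg 1%C 0 ltac:(unfold cone; simpl; rewrite Rabs_R0; lra)
      ltac:(rewrite Rabs_R0; lra)).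
    assert (hs : ZSeries (fun k => gauss (RtoC (IZR k) / 1) * e2pi (- (IZR k * 0)))%C
      = ZSeries (fun n => gauss (1 * RtoC (IZR n + 0)))).
    { apply ZSeries_ext; intros n.
      rewrite Rmult_0_r, Ropp_0, (e2pi_Z 0), Rplus_0_r, Cmult_1_r, Cmult_1_l.
      f_equal; field. }
    rewrite hs in h.
    set (T := ZSeries _) in h.
    assert (hT : T <> 0%C) by apply ZSeries_gauss_neq_0.
    replace g with (g / 1 * T * / T)%C by (field; exact hT).
    rewrite <- h; field; exact hT. }
  intros hb hw; rewrite (hg b w hb hw), hg1.
  replace (1 / b)%C with (/ b)%C by (unfold Cdiv; ring); reflexivity.
Qed.

(** * Theta constants *)

Definition theta2_term (tau : C) (n : Z) : C := nome_pow tau ((IZR n + / 2) ^ 2).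
Definition theta3_term (tau : C) (n : Z) : C := nome_pow tau (IZR n ^ 2).
Definition theta4_term (tau : C) (n : Z) : C :=
  (RtoC (powerRZ (-1) n) * nome_pow tau (IZR n ^ 2))%C.

Lemma Cmod_nome_pow (tau : C) (s : R) : Cmod (nome_pow tau s) = exp (- (PI * Im tau * s)).
Proof.
  unfold nome_pow; rewrite Cmod_Cexp; f_equal; simpl; unfold Re, Im; ring.
Qed.

Lemma powerRZ_neg1_abs (n : Z) : Rabs (powerRZ (-1) n) = 1.
Proof.
  destruct n as [|p|p]; simpl; [apply Rabs_R1 | apply pow_1_abs |].
  rewrite Rabs_inv, pow_1_abs; apply Rinv_1.
Qed.

Lemma theta_term_dominated (a : C -> Z -> C) (w y : R) (tau : C) :
  (forall tau n, Cmod (a tau n) = exp (- (PI * Im tau * (IZR n + w) ^ 2))) ->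
  Rabs w <= / 2 -> 0 < y <= Im tau ->
  geom_dominated (exp (9 * (PI * y) / 4)) (exp (- (PI * y))) (a tau).
Proof.
  intros ha hw hy n; rewrite ha.
  assert (hpi := PI_RGT_0).
  assert (hw2 : Rabs w <= 2) by lra.
  apply Rle_trans with (2 := gaussian_le_geom (PI * y) w n
    (Rmult_lt_0_compat _ _ hpi (proj1 hy)) hw2).
  apply exp_le, Ropp_le_contravar, Rmult_le_compat_r; [apply pow2_ge_0|].
  apply Rmult_le_compat_l; lra.
Qed.

Lemma theta2_term_Cmod (tau : C) (n : Z) :
  Cmod (theta2_term tau n) = exp (- (PI * Im tau * (IZR n + / 2) ^ 2)).
Proof. apply Cmod_nome_pow. Qed.

Lemma theta3_term_Cmod (tau : C) (n : Z) :
  Cmod (theta3_term tau n) = exp (- (PI * Im tau * (IZR n + 0) ^ 2)).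
Proof. unfold theta3_term; rewrite Cmod_nome_pow, Rplus_0_r; reflexivity. Qed.

Lemma theta4_term_Cmod (tau : C) (n : Z) :
  Cmod (theta4_term tau n) = exp (- (PI * Im tau * (IZR n + 0) ^ 2)).
Proof.
  unfold theta4_term; rewrite Cmod_mult, Cmod_R, powerRZ_neg1_abs, Cmod_nome_pow.
  rewrite Rplus_0_r; ring.
Qed.

Lemma Rabs_half : Rabs (/ 2) <= / 2.
Proof. rewrite Rabs_pos_eq; lra. Qed.

Lemma Rabs_0_half : Rabs 0 <= / 2.
Proof. rewrite Rabs_R0; lra. Qed.

Lemma theta2_dominated (tau : C) (y : R) : 0 < y <= Im tau ->
  geom_dominated (exp (9 * (PI * y) / 4)) (exp (- (PI * y))) (theta2_term tau).
Proof.
  exact (theta_term_dominated theta2_term (/ 2) y tau theta2_term_Cmod Rabs_half).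
Qed.

Lemma theta3_dominated (tau : C) (y : R) : 0 < y <= Im tau ->
  geom_dominated (exp (9 * (PI * y) / 4)) (exp (- (PI * y))) (theta3_term tau).
Proof.
  exact (theta_term_dominated theta3_term (0) y tau theta3_term_Cmod Rabs_0_half).
Qed.

Lemma theta4_dominated (tau : C) (y : R) : 0 < y <= Im tau ->
  geom_dominated (exp (9 * (PI * y) / 4)) (exp (- (PI * y))) (theta4_term tau).
Proof.
  exact (theta_term_dominated theta4_term (0) y tau theta4_term_Cmod Rabs_0_half).
Qed.

Lemma theta_ratio (y : R) : 0 < y -> 0 <= exp (- (PI * y)) < 1.
Proof. intros hy; apply exp_neg_lt_1, Rmult_lt_0_compat; [apply PI_RGT_0 | exact hy]. Qed.

Lemma Ccontinuous_nome_pow {U : UniformSpace} (p : U -> C) (s : R) (x : U) :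
  Ccontinuous p x -> Ccontinuous (fun y => nome_pow (p y) s) x.
Proof.
  intros hp; unfold nome_pow; apply Ccontinuous_Cexp.
  apply Ccontinuous_mult; [|apply Ccontinuous_const].
  apply Ccontinuous_mult; [apply Ccontinuous_const | exact hp].
Qed.

Lemma theta_series_continuous {U : UniformSpace} (a : C -> Z -> C) (p : U -> C) (x : U) :
  (forall tau y, 0 < y <= Im tau ->
     geom_dominated (exp (9 * (PI * y) / 4)) (exp (- (PI * y))) (a tau)) ->
  (forall n, Ccontinuous (fun y => a (p y) n) x) ->
  Ccontinuous p x -> 0 < Im (p x) -> Ccontinuous (fun y => ZSeries (a (p y))) x.
Proof.
  intros ha hc hp hx.
  apply (ZSeries_continuous (fun y => a (p y)) x (exp (9 * (PI * (Im (p x) / 2)) / 4))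
    (exp (- (PI * (Im (p x) / 2))))); auto.
  - apply theta_ratio; lra.
  - left; apply exp_pos.
  - assert (hi := Ccontinuous_im _ _ hp).
    apply filterlim_locally with (eps := mkposreal (Im (p x) / 2) ltac:(lra)) in hi.
    revert hi; apply filter_imp; intros y hy; apply ha; split; [lra|].
    unfold ball in hy; simpl in hy; unfold AbsRing_ball, abs, minus, plus, opp in hy;
      simpl in hy; apply Rabs_def2 in hy; destruct hy; lra.
Qed.

Lemma theta2_continuous {U : UniformSpace} (p : U -> C) (x : U) :
  Ccontinuous p x -> 0 < Im (p x) -> Ccontinuous (fun y => theta2 (p y)) x.
Proof.
  intros hp hx; apply (theta_series_continuous theta2_term p x); auto.
  - intros; now apply theta2_dominated.
  - intros n; now apply Ccontinuous_nome_pow.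
Qed.

Lemma theta3_continuous {U : UniformSpace} (p : U -> C) (x : U) :
  Ccontinuous p x -> 0 < Im (p x) -> Ccontinuous (fun y => theta3 (p y)) x.
Proof.
  intros hp hx; apply (theta_series_continuous theta3_term p x); auto.
  - intros; now apply theta3_dominated.
  - intros n; now apply Ccontinuous_nome_pow.
Qed.

Lemma theta4_continuous {U : UniformSpace} (p : U -> C) (x : U) :
  Ccontinuous p x -> 0 < Im (p x) -> Ccontinuous (fun y => theta4 (p y)) x.
Proof.
  intros hp hx; apply (theta_series_continuous theta4_term p x); auto.
  - intros; now apply theta4_dominated.
  - intros n; apply Ccontinuous_mult; [apply Ccontinuous_const|].
    now apply Ccontinuous_nome_pow.
Qed.

(** ** Translation *)

Lemma even_mul_succ (n : Z) : exists m : Z, (n * (n + 1) = 2 * m)%Z.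
Proof.
  destruct (Z.Even_or_Odd n) as [[k ->]|[k ->]]; [exists (k * (2 * k + 1))%Z
    | exists ((2 * k + 1) * (k + 1))%Z]; ring.
Qed.

Lemma e2pi_half_Z (n : Z) : e2pi (IZR n / 2) = RtoC (powerRZ (-1) n).
Proof.
  assert (hhalf : e2pi (/ 2) = RtoC (-1)).
  { rewrite e2pi_eq; replace (2 * PI * / 2) with PI by field.
    rewrite cos_PI, sin_PI; reflexivity. }
  assert (hnat : forall m : nat, e2pi (INR m / 2) = RtoC ((-1) ^ m)).
  { induction m as [|m IH].
    - simpl INR; replace (0 / 2) with 0 by field; apply (e2pi_Z 0).
    - rewrite S_INR; replace ((INR m + 1) / 2) with (/ 2 + INR m / 2) by field.
      rewrite e2pi_plus, IH, hhalf, <- RtoC_mult; reflexivity. }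
  destruct n as [|p|p]; simpl powerRZ.
  - replace (0 / 2) with 0 by field; apply (e2pi_Z 0).
  - rewrite <- hnat, INR_IZR_INZ, positive_nat_Z; reflexivity.
  - assert (h2 : ((-1) ^ Pos.to_nat p) <> 0) by (apply pow_nonzero; lra).
    assert (h3 : RtoC ((-1) ^ Pos.to_nat p) <> 0%C).
    { intros e; apply h2, RtoC_inj, e. }
    rewrite RtoC_inv by exact h2.
    set (X := RtoC ((-1) ^ Pos.to_nat p)) in *.
    replace (e2pi (IZR (Z.neg p) / 2)) with (e2pi (IZR (Z.neg p) / 2) * X * / X)%C
      by (field; exact h3).
    unfold X at 1; rewrite <- hnat, <- e2pi_plus, INR_IZR_INZ, positive_nat_Z.
    replace (IZR (Z.neg p) / 2 + IZR (Z.pos p) / 2) with (IZR 0).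
    + rewrite e2pi_Z; ring.
    + change (Z.neg p) with (- Z.pos p)%Z; rewrite opp_IZR; field.
Qed.

Lemma nome_pow_plus1 (tau : C) (s : R) :
  nome_pow (tau + 1) s = (e2pi (s / 2) * nome_pow tau s)%C.
Proof.
  unfold nome_pow, e2pi; rewrite <- Cexp_plus; f_equal.
  replace (2 * PI * (s / 2)) with (PI * s) by field; rewrite RtoC_mult; ring.
Qed.

(** [n^2] and [n] have the same parity. *)
Lemma e2pi_half_square (n : Z) : e2pi (IZR n ^ 2 / 2) = RtoC (powerRZ (-1) n).
Proof.
  destruct (even_mul_succ (n - 1)) as [m hm].
  apply (f_equal IZR) in hm; rewrite !mult_IZR, plus_IZR, minus_IZR in hm.
  replace (IZR n ^ 2 / 2) with (IZR m + IZR n / 2) by lra.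
  rewrite e2pi_plus, e2pi_Z, Cmult_1_l; apply e2pi_half_Z.
Qed.

Lemma powerRZ_neg1_square (n : Z) : powerRZ (-1) n * powerRZ (-1) n = 1.
Proof.
  assert (h := powerRZ_neg1_abs n); unfold Rabs in h.
  destruct (Rcase_abs _); nra.
Qed.

(** The eighth root of unity by which [theta2] is multiplied under
    [tau -> tau + 1]. *)
Definition zeta8 : C := e2pi (/ 8).

Lemma theta2_term_plus1 (tau : C) (n : Z) :
  theta2_term (tau + 1) n = (zeta8 * theta2_term tau n)%C.
Proof.
  unfold theta2_term; rewrite nome_pow_plus1; f_equal.
  destruct (even_mul_succ n) as [m hm].
  apply (f_equal IZR) in hm; rewrite !mult_IZR, plus_IZR in hm.
  replace ((IZR n + / 2) ^ 2 / 2) with (IZR m + / 8) by lra.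
  rewrite e2pi_plus, e2pi_Z; apply Cmult_1_l.
Qed.

Lemma theta3_term_plus1 (tau : C) (n : Z) : theta3_term (tau + 1) n = theta4_term tau n.
Proof.
  unfold theta3_term, theta4_term; now rewrite nome_pow_plus1, e2pi_half_square.
Qed.

Lemma theta4_term_plus1 (tau : C) (n : Z) : theta4_term (tau + 1) n = theta3_term tau n.
Proof.
  unfold theta3_term, theta4_term; rewrite nome_pow_plus1, e2pi_half_square.
  rewrite Cmult_assoc, <- RtoC_mult, powerRZ_neg1_square; apply Cmult_1_l.
Qed.

Lemma theta2_plus1 (tau : C) : 0 < Im tau -> theta2 (tau + 1) = (zeta8 * theta2 tau)%C.
Proof.
  intros h; transitivity (ZSeries (fun n => zeta8 * theta2_term tau n)%C).
  { exact (ZSeries_ext _ _ (theta2_term_plus1 tau)). }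
  apply (ZSeries_scal zeta8 (exp (9 * (PI * Im tau) / 4)) _ (theta2_term tau) (theta_ratio (Im tau) h)
    (Rlt_le _ _ (exp_pos _))).
  apply theta2_dominated; lra.
Qed.

Lemma theta3_plus1 (tau : C) : theta3 (tau + 1) = theta4 tau.
Proof. exact (ZSeries_ext _ _ (theta3_term_plus1 tau)). Qed.

Lemma theta4_plus1 (tau : C) : theta4 (tau + 1) = theta3 tau.
Proof. exact (ZSeries_ext _ _ (theta4_term_plus1 tau)). Qed.

(** ** Inversion *)

Lemma cone_sqrt (tau : C) : 0 < Im tau ->
  exists b, cone b /\ tau = (Ci * (b * b))%C.
Proof.
  destruct tau as [x y]; simpl; intros hy.
  set (m := sqrt (x ^ 2 + y ^ 2)).
  assert (hm2 : m ^ 2 = x ^ 2 + y ^ 2) by (apply pow2_sqrt; nra).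
  assert (hm : 0 <= m) by apply sqrt_pos.
  assert (hmy : y <= m) by nra.
  set (p := sqrt ((m + y) / 2)).
  assert (hp2 : p ^ 2 = (m + y) / 2) by (apply pow2_sqrt; lra).
  assert (hp : 0 < p) by (apply sqrt_lt_R0; lra).
  set (q := - x / (2 * p)).
  assert (hpq : p * q = - x / 2) by (unfold q; field; lra).
  assert (hq2 : q ^ 2 = (m - y) / 2).
  { apply Rmult_eq_reg_l with (p ^ 2); [|nra].
    replace (p ^ 2 * q ^ 2) with ((p * q) ^ 2) by ring.
    rewrite hpq, hp2; nra. }
  exists (p, q); split.
  - unfold cone; simpl; rewrite <- (Rabs_pos_eq p) by lra.
    apply Rsqr_lt_abs_0; unfold Rsqr; nra.
  - apply C_ext; simpl; nra.
Qed.

Lemma nome_pow_gauss (b : C) (t : R) : nome_pow (Ci * (b * b)) (t ^ 2) = gauss (b * RtoC t).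
Proof.
  unfold nome_pow, gauss; f_equal; rewrite RtoC_pow; simpl.
  assert (hi := Ci_square).
  replace (PI * Ci * (Ci * (b * b)) * (t * (t * 1)))%C
    with (PI * (Ci * Ci) * (b * b) * (t * t))%C by ring.
  rewrite hi; ring.
Qed.

Lemma jacobi_theta3 (b : C) : cone b ->
  theta3 (Ci * (b * b)) = (/ b * theta3 (Ci * (/ b * / b)))%C.
Proof.
  intros hb; assert (h := poisson_gauss b 0 hb Rabs_0_half).
  unfold theta3; rewrite (ZSeries_ext _ (fun n => gauss (b * RtoC (IZR n + 0)))), h.
  - f_equal; apply ZSeries_ext; intros n.
    rewrite nome_pow_gauss, Rmult_0_r, Ropp_0, (e2pi_Z 0), Cmult_1_r.
    f_equal; unfold Cdiv; ring.
  - intros n; now rewrite nome_pow_gauss, Rplus_0_r.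
Qed.

Lemma jacobi_theta2 (b : C) : cone b ->
  theta2 (Ci * (b * b)) = (/ b * theta4 (Ci * (/ b * / b)))%C.
Proof.
  intros hb; assert (h := poisson_gauss b (/ 2) hb Rabs_half).
  unfold theta2; rewrite (ZSeries_ext _ (fun n => gauss (b * RtoC (IZR n + / 2)))), h.
  - f_equal; apply ZSeries_ext; intros n.
    rewrite nome_pow_gauss, Cmult_comm.
    replace (- (IZR n * / 2)) with (IZR n / 2 + IZR (- n)) by (rewrite opp_IZR; field).
    rewrite e2pi_plus, e2pi_Z, Cmult_1_r, e2pi_half_Z.
    f_equal; f_equal; unfold Cdiv; ring.
  - intros n; now rewrite nome_pow_gauss.
Qed.

(** The square root [b] is the same for all three constants, so a product of ten
    of them picks up [b^10 = (- i tau)^5], where no choice of root is left. *)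
Lemma theta_inversion (tau : C) : 0 < Im tau ->
  exists b : C, b <> 0%C /\ (b * b = - Ci * tau)%C /\
  theta2 (- / tau) = (b * theta4 tau)%C /\
  theta3 (- / tau) = (b * theta3 tau)%C /\
  theta4 (- / tau) = (b * theta2 tau)%C.
Proof.
  intros h; destruct (cone_sqrt tau h) as [b [hb ->]].
  assert (hb0 := cone_neq_0 b hb); assert (hb' := cone_inv b hb).
  assert (hi := Ci_square).
  assert (hi0 := Ci_neq_0).
  exists b; split; [exact hb0|].
  split; [replace (- Ci * (Ci * (b * b)))%C with (- (Ci * Ci) * (b * b))%C by ring;
          rewrite hi; ring|].
  replace (- / (Ci * (b * b)))%C with (Ci * (/ b * / b))%C.
  2: { replace (Ci * (/ b * / b))%C with ((Ci * Ci) * / (Ci * (b * b)))%C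
         by (field; auto).
       rewrite hi; ring. }
  assert (e : (/ / b)%C = b) by (field; exact hb0).
  assert (h2 := jacobi_theta2 _ hb'); assert (h3 := jacobi_theta3 _ hb').
  assert (h4 := jacobi_theta2 _ hb).
  rewrite !e in h2, h3.
  split; [exact h2|]; split; [exact h3|].
  rewrite h4; field; exact hb0.
Qed.

(** ** Decay at the cusps *)

(** The lowest exponent in [theta2] is [1/4]; the others exceed it by the
    nonnegative integers [n (n + 1)], so after the factor
    [exp (pi i tau / 4)] is taken out the terms are largest on the lower edge [Im tau = 1/2]. *)
Lemma theta2_decay : exists K, 0 <= K /\ forall tau, / 2 <= Im tau ->
  Cmod (theta2 tau) <= K * exp (- (PI * Im tau / 4)).
Proof.
  set (A := exp (9 * (PI * / 2) / 4)); set (r := exp (- (PI * / 2))).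
  assert (hr := theta_ratio (/ 2) ltac:(lra)); fold r in hr.
  assert (hA : 0 <= A) by (left; apply exp_pos).
  set (A' := exp (PI / 8) * A).
  assert (hA' : 0 <= A') by (apply Rmult_le_pos; [left; apply exp_pos | exact hA]).
  exists (4 * A' / (1 - r)); split.
  { apply Rdiv_le_0_compat; lra. }
  intros tau htau.
  assert (hd : geom_dominated (exp (- (PI * Im tau / 4)) * A') r (theta2_term tau)).
  { intros n.
    assert (hn := theta2_dominated (Ci * RtoC (/ 2)) (/ 2)).
    assert (hn' := hn ltac:(simpl; lra) n).
    apply Rle_trans with (exp (- (PI * Im tau / 4)) * exp (PI / 8)
      * Cmod (theta2_term (Ci * RtoC (/ 2)) n)).
    - rewrite !theta2_term_Cmod, <- !exp_plus; apply exp_le; simpl Im.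
      (* [(n + 1/2)^2 - 1/4 = n (n + 1)] is nonnegative *)
      assert (h0 : 0 <= (IZR n + / 2) ^ 2 - / 4).
      { replace ((IZR n + / 2) ^ 2 - / 4) with (IZR (n * (n + 1)))
          by (rewrite mult_IZR, plus_IZR; field).
        apply IZR_le; nia. }
      assert (hpi := PI_RGT_0).
      assert (h1 : 0 <= PI * (Im tau - / 2) * ((IZR n + / 2) ^ 2 - / 4)).
      { apply Rmult_le_pos; [|exact h0]; apply Rmult_le_pos; lra. }
      nra.
    - unfold A'; rewrite !Rmult_assoc.
      do 2 (apply Rmult_le_compat_l; [left; apply exp_pos|]); exact hn'. }
  apply Rle_trans with (4 * (exp (- (PI * Im tau / 4)) * A') / (1 - r)).
  - apply (ZSeries_bound (theta2_term tau)); auto.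
    apply Rmult_le_pos; [left; apply exp_pos | exact hA'].
  - right; field; lra.
Qed.

Lemma theta34_bounded : exists K, 0 <= K /\ forall tau, / 2 <= Im tau ->
  Cmod (theta3 tau) <= K /\ Cmod (theta4 tau) <= K.
Proof.
  exists (4 * exp (9 * (PI * / 2) / 4) / (1 - exp (- (PI * / 2)))).
  assert (hr := theta_ratio (/ 2) ltac:(lra)).
  assert (hA : 0 <= exp (9 * (PI * / 2) / 4)) by (left; apply exp_pos).
  split; [apply Rdiv_le_0_compat; lra|].
  intros tau htau; split.
  - apply (ZSeries_bound (theta3_term tau)); auto; apply theta3_dominated; lra.
  - apply (ZSeries_bound (theta4_term tau)); auto; apply theta4_dominated; lra.
Qed.

Lemma exp_neg_le_pow5 (y : R) : 0 < y -> exp (- (PI * y / 4)) <= (10 / y) ^ 5.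
Proof.
  intros hy.
  replace (exp (- (PI * y / 4))) with (exp (- (PI * y / 20)) ^ 5).
  - assert (hpi := PI2_3_2).
    apply pow_incr; split; [left; apply exp_pos|].
    apply Rle_trans with (exp (- (y / 10))); [apply exp_le; nra|].
    apply Rle_trans with (1 := exp_neg_le_inv (y / 10) ltac:(lra)).
    right; field; lra.
  - rewrite exp_neg_pow; simpl; f_equal; field.
Qed.

(** High in the upper half-plane the exponential decay of [theta2] beats any
    power; the fifth is the one that the inversion of a product of ten theta
    constants costs. *)
Lemma theta_product_decay : exists K, 0 <= K /\ forall tau, / 2 <= Im tau ->
  Cmod (theta2 tau * theta3 tau ^ 8 * theta4 tau) <= K / Im tau ^ 5 /\
  Cmod (theta2 tau * theta4 tau ^ 8 * theta3 tau) <= K / Im tau ^ 5.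
Proof.
  destruct theta2_decay as [K2 [hK2 h2]]; destruct theta34_bounded as [K3 [hK3 h3]].
  exists (K2 * 10 ^ 5 * K3 ^ 8 * K3); split.
  { assert (h8 := pow_le K3 8 hK3).
    repeat apply Rmult_le_pos; try assumption; lra. }
  intros tau htau; specialize (h2 tau htau); destruct (h3 tau htau) as [h3' h4'].
  assert (h5 := exp_neg_le_pow5 (Im tau) ltac:(lra)).
  assert (h2' : Cmod (theta2 tau) <= K2 * (10 / Im tau) ^ 5).
  { apply Rle_trans with (1 := h2); now apply Rmult_le_compat_l. }
  assert (key : forall x y, Cmod x <= K3 -> Cmod y <= K3 ->
    Cmod (theta2 tau * x ^ 8 * y) <= K2 * 10 ^ 5 * K3 ^ 8 * K3 / Im tau ^ 5).
  { intros x y hx hy; rewrite !Cmod_mult, Cmod_pow.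
    apply Rle_trans with (K2 * (10 / Im tau) ^ 5 * K3 ^ 8 * K3).
    - assert (hx8 : Cmod x ^ 8 <= K3 ^ 8) by (apply pow_incr; split; [apply Cmod_ge_0 | exact hx]).
      assert (p8 : 0 <= Cmod x ^ 8) by (apply pow_le, Cmod_ge_0).
      apply Rmult_le_compat; [| apply Cmod_ge_0 | | exact hy].
      + apply Rmult_le_pos; [apply Cmod_ge_0 | exact p8].
      + apply Rmult_le_compat; [apply Cmod_ge_0 | exact p8 | exact h2' | exact hx8].
    - right; unfold Rdiv; rewrite Rpow_mult_distr, pow_inv; ring. }
  split; apply key; assumption.
Qed.

(** * A closed path modulo translation *)

Lemma inv_le_self (T : R) : 1 <= T -> 0 < / T <= T.
Proof.
  intros hT; split; [apply Rinv_0_lt_compat; lra|].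
  apply Rle_trans with (/ 1); [apply Rinv_le_contravar; lra | lra].
Qed.

(** [F_1] seen from the cusp [-1]. *)
Definition F_cusp (tau : C) : C := (theta2 tau ^ 8 * theta3 tau * theta4 tau)%C.

(** The image of the imaginary axis under [tau -> -1/(tau + 1)], a half circle
    from [-1] to [0]. *)
Definition arc (t : R) : C := (- / (1 + Ci * RtoC t))%C.
Definition arc_speed (t : R) : C := (Ci / (1 + Ci * RtoC t) ^ 2)%C.

Lemma arc_eq (t : R) : arc t = (- / (1 + t ^ 2), t / (1 + t ^ 2)).
Proof.
  assert (h : 1 + t ^ 2 <> 0) by nra.
  unfold arc, Cinv; apply C_ext; simpl; field; repeat split; nra.
Qed.

Lemma arc_speed_eq (t : R) :
  arc_speed t = (2 * t / (1 + t ^ 2) ^ 2, (1 - t ^ 2) / (1 + t ^ 2) ^ 2).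
Proof.
  assert (h : 1 + t ^ 2 <> 0) by nra.
  unfold arc_speed, Cdiv, Cinv; apply C_ext; simpl; field; repeat split; nra.
Qed.

Lemma Cderive_arc (t : R) : Cderive_at arc t (arc_speed t).
Proof.
  assert (h : 1 + t * (t * 1) <> 0) by nra.
  rewrite arc_speed_eq; apply Cderive_pair; cbn [Re Im fst snd].
  - apply is_derive_ext with (fun t => - / (1 + t ^ 2)).
    { intros s; rewrite arc_eq; reflexivity. }
    auto_derive; [exact h|]; field; nra.
  - apply is_derive_ext with (fun t => t / (1 + t ^ 2)).
    { intros s; rewrite arc_eq; reflexivity. }
    auto_derive; [exact h|]; field; nra.
Qed.

Lemma Ccontinuous_arc (t : R) : Ccontinuous arc t.
Proof. apply Cderive_continuous with (1 := Cderive_arc t). Qed.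

Lemma Ccontinuous_arc_speed (t : R) : Ccontinuous arc_speed t.
Proof.
  assert (h : 1 + t * (t * 1) <> 0) by nra.
  apply Ccontinuous_pair.
  - apply continuous_ext with (fun t => 2 * t / (1 + t ^ 2) ^ 2).
    { intros s; rewrite arc_speed_eq; reflexivity. }
    apply (ex_derive_continuous (V := R_NormedModule)); auto_derive; nra.
  - apply continuous_ext with (fun t => (1 - t ^ 2) / (1 + t ^ 2) ^ 2).
    { intros s; rewrite arc_speed_eq; reflexivity. }
    apply (ex_derive_continuous (V := R_NormedModule)); auto_derive; nra.
Qed.

Lemma Cmod_arc_speed_le (t : R) : Cmod (arc_speed t) <= 1.
Proof.
  rewrite arc_speed_eq; unfold Cmod; cbn [fst snd].
  apply Rle_trans with (sqrt 1); [|rewrite sqrt_1; lra]; apply sqrt_le_1_alt.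
  assert (h : 1 <= 1 + t ^ 2) by nra.
  replace ((2 * t / (1 + t ^ 2) ^ 2) ^ 2 + ((1 - t ^ 2) / (1 + t ^ 2) ^ 2) ^ 2)
    with (/ (1 + t ^ 2) ^ 2) by (field; lra).
  apply Rle_trans with (/ 1); [apply Rinv_le_contravar; nra | lra].
Qed.

Definition gap (T : R) : R := / (1 + T ^ 2).
Definition level (T : R) : R := T / (1 + T ^ 2).
Definition chord (T x : R) : C := (RtoC x + Ci * RtoC (level T))%C.

Lemma Cderive_chord (T x : R) : Cderive_at (chord T) x 1.
Proof.
  apply Cderive_eq with (1 + 0)%C; [|ring].
  apply (Cderive_plus (fun x => RtoC x)); [|apply Cderive_const].
  apply (Cderive_RtoC (fun y => y)), (@is_derive_id R_AbsRing).
Qed.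

(** The truncated arc runs from [chord (gap T) - 1] to [chord (- gap T)]: after
    translation by [1] the short chord closes it up. *)
Lemma arc_end (T : R) : arc T = chord T (- gap T).
Proof. rewrite arc_eq; unfold chord, gap, level; apply C_ext; simpl; ring. Qed.

Lemma arc_start (T : R) : 0 < T -> arc (/ T) = (chord T (gap T) - 1)%C.
Proof.
  intros hT; rewrite arc_eq; unfold chord, gap, level.
  apply C_ext; simpl; field; repeat split; nra.
Qed.

Lemma level_le_arc (T t : R) : 1 <= T -> / T <= t <= T -> level T <= Im (arc t).
Proof.
  intros hT ht; rewrite arc_eq; cbn [Im snd]; unfold level.
  assert (h1 : 1 <= t * T).
  { apply Rmult_le_reg_r with (/ T); [apply Rinv_0_lt_compat; lra|].
    rewrite Rmult_assoc, Rinv_r by lra; lra. }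
  apply Rmult_le_reg_r with ((1 + T ^ 2) * (1 + t ^ 2)); [nra|].
  replace (T / (1 + T ^ 2) * ((1 + T ^ 2) * (1 + t ^ 2))) with (T * (1 + t ^ 2))
    by (field; nra).
  replace (t / (1 + t ^ 2) * ((1 + T ^ 2) * (1 + t ^ 2))) with (t * (1 + T ^ 2))
    by (field; nra).
  assert (h2 : 0 <= (T - t) * (t * T - 1)) by (apply Rmult_le_pos; lra).
  lra.
Qed.

Lemma level_pos (T : R) : 1 <= T -> 0 < level T.
Proof. intros hT; unfold level; apply Rdiv_lt_0_compat; nra. Qed.

Lemma gap_pos (T : R) : 0 < gap T.
Proof. unfold gap; apply Rinv_0_lt_compat; nra. Qed.

Lemma Im_chord (T x : R) : Im (chord T x) = level T.
Proof. unfold chord; simpl; ring. Qed.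

(** Truncated arc and chord form a closed path modulo translation by [1], so the
    two integrals cancel whenever [f] has a primitive of period [1]. *)
Definition closes (T : R) (f : C -> C) : Prop := exists I : C,
  is_CInt (fun t => f (arc t) * arc_speed t)%C (/ T) T I /\
  is_CInt (fun x => f (chord T x)) (- gap T) (gap T) (- I)%C.

Definition qexp (tau : C) : C := Cexp (RtoC (2 * PI) * Ci * tau).

Lemma closes_ext (T : R) (f g : C -> C) : 1 <= T ->
  (forall tau, f tau = g tau) -> closes T f -> closes T g.
Proof.
  intros hT h [I [h1 h2]]; exists I.
  destruct (inv_le_self T hT) as [_ hT'].
  assert (hg := gap_pos T).
  split; [apply is_CInt_ext with (3 := h1) | apply is_CInt_ext with (3 := h2)];
    try lra; intros; now rewrite h.
Qed.

Lemma closes_plus (T : R) (f g : C -> C) : closes T f -> closes T g ->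
  closes T (fun tau => f tau + g tau)%C.
Proof.
  intros [I [h1 h2]] [J [h3 h4]]; exists (I + J)%C; split.
  - assert (h := is_CInt_plus _ _ _ _ _ _ h1 h3).
    apply (@is_RInt_ext C_R_NormedModule) with (2 := h); intros x _.
    change (f (arc x) * arc_speed x + g (arc x) * arc_speed x
      = (f (arc x) + g (arc x)) * arc_speed x)%C; ring.
  - replace (- (I + J))%C with (- I + - J)%C by ring; now apply is_CInt_plus.
Qed.

Lemma closes_scal (T : R) (c : C) (f : C -> C) : closes T f ->
  closes T (fun tau => c * f tau)%C.
Proof.
  intros [I [h1 h2]]; exists (c * I)%C; split.
  - assert (h := is_CInt_scal c _ _ _ _ h1).
    apply (@is_RInt_ext C_R_NormedModule) with (2 := h); intros x _.
    change (c * (f (arc x) * arc_speed x) = (c * f (arc x)) * arc_speed x)%C; ring.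
  - replace (- (c * I))%C with (c * - I)%C by ring; now apply is_CInt_scal.
Qed.

(** A nonconstant power of [q = exp (2 pi i tau)] has a primitive that is
    invariant under [tau -> tau + 1]. *)
Lemma closes_qexp_pow (T : R) (m : nat) : 1 <= T ->
  closes T (fun tau => qexp tau ^ S m)%C.
Proof.
  intros hT.
  destruct (inv_le_self T hT) as [_ hT'].
  assert (hg := gap_pos T).
  set (c := (RtoC (INR (S m)) * (RtoC (2 * PI) * Ci))%C).
  assert (hpow : forall tau, (qexp tau ^ S m)%C = Cexp (c * tau)).
  { intros tau; unfold qexp; rewrite Cexp_pow; f_equal; unfold c; ring. }
  assert (hc : c <> 0%C).
  { unfold c; repeat apply Cmult_neq_0.
    - intros e; apply RtoC_inj in e; revert e; now apply not_0_INR.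
    - intros e; apply RtoC_inj in e; generalize PI_RGT_0; lra.
    - intros e; injection e; lra. }
  assert (hper : forall tau, Cexp (c * (tau - 1)) = Cexp (c * tau)).
  { intros tau; replace (c * (tau - 1))%C
      with (c * tau + RtoC (2 * PI * IZR (- Z.of_nat (S m))) * Ci)%C.
    - rewrite Cexp_plus, Cexp_2PI_Z; apply Cmult_1_r.
    - unfold c; rewrite opp_IZR, <- INR_IZR_INZ, !RtoC_mult, RtoC_opp; ring. }
  assert (hder : forall (p : R -> C) (l : C) (x : R), Cderive_at p x l ->
    Cderive_at (fun y => / c * Cexp (c * p y))%C x (Cexp (c * p x) * l)%C).
  { intros p l x hp.
    apply Cderive_eq with (0 * Cexp (c * p x) + / c * (c * l * Cexp (c * p x)))%C.
    - apply (Cderive_mult (fun _ => / c)%C (fun y => Cexp (c * p y)));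
        [apply Cderive_const|].
      apply (Cderive_Cexp (fun y => c * p y)%C).
      apply Cderive_eq with (0 * p x + c * l)%C; [|ring].
      apply (Cderive_mult (fun _ => c)); [apply Cderive_const | exact hp].
    - field; exact hc. }
  assert (hcont : forall (p : R -> C) x, Ccontinuous p x ->
    Ccontinuous (fun y => Cexp (c * p y)) x).
  { intros p x hp; apply Ccontinuous_Cexp, Ccontinuous_mult;
      [apply Ccontinuous_const | exact hp]. }
  apply closes_ext with (fun tau => Cexp (c * tau)); [exact hT | auto |].
  exists (/ c * Cexp (c * arc T) - / c * Cexp (c * arc (/ T)))%C; split.
  - apply (is_CInt_derive (fun t => / c * Cexp (c * arc t))%C); [exact hT' | |].
    + intros t _; apply hder, Cderive_arc.
    + intros t _; apply Ccontinuous_mult; [apply hcont, Ccontinuous_arc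
        | apply Ccontinuous_arc_speed].
  - rewrite arc_end, arc_start, hper by lra.
    replace (- (/ c * Cexp (c * chord T (- gap T)) - / c * Cexp (c * chord T (gap T))))%C
      with (/ c * Cexp (c * chord T (gap T)) - / c * Cexp (c * chord T (- gap T)))%C by ring.
    apply (is_CInt_derive (fun x => / c * Cexp (c * chord T x))%C); [lra | |].
    + intros x _; apply Cderive_eq with (Cexp (c * chord T x) * 1)%C; [|ring].
      apply hder, Cderive_chord.
    + intros x _; apply (hcont (chord T)), Cderive_continuous with (1 := Cderive_chord T x).
Qed.

(** Polynomials in [q = exp (2 pi i tau)], generated by their operations: only the
    closure properties are used, never a list of coefficients. *)
Inductive qpoly : (C -> C) -> Prop :=
| qpoly_const c : qpoly (fun _ => c)
| qpoly_qexp : qpoly qexp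
| qpoly_plus f g : qpoly f -> qpoly g -> qpoly (fun tau => f tau + g tau)%C
| qpoly_mult f g : qpoly f -> qpoly g -> qpoly (fun tau => f tau * g tau)%C
| qpoly_ext f g : (forall tau, f tau = g tau) -> qpoly f -> qpoly g.

Lemma qpoly_pow (f : C -> C) (n : nat) : qpoly f -> qpoly (fun tau => f tau ^ n)%C.
Proof.
  intros hf; induction n as [|n IH]; simpl; [apply qpoly_const | now apply qpoly_mult].
Qed.

Lemma qpoly_csum (a : C -> nat -> C) (N : nat) :
  (forall n, qpoly (fun tau => a tau n)) -> qpoly (fun tau => csum (a tau) N).
Proof.
  intros h; induction N as [|N IH]; simpl; [apply qpoly_const | now apply qpoly_plus].
Qed.

Lemma qpoly_zsum (a : C -> Z -> C) (N : nat) :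
  (forall n, qpoly (fun tau => a tau n)) -> qpoly (fun tau => zsum (a tau) N).
Proof.
  intros h; apply qpoly_plus;
    [apply (qpoly_csum (fun tau n => a tau (Z.of_nat n)))
    | apply (qpoly_csum (fun tau n => a tau (- Z.of_nat (S n))%Z))]; intros n; apply h.
Qed.

(** The factor [q] removes the constant term, whose primitive would not be
    periodic. *)
Lemma closes_qpoly (T : R) (f : C -> C) : 1 <= T -> qpoly f ->
  closes T (fun tau => qexp tau * f tau)%C.
Proof.
  intros hT hf.
  (* Multiplication by [f] preserves the functions all of whose products with
     positive powers of [q] close up. *)
  assert (key : forall g, (forall m, closes T (fun tau => qexp tau ^ S m * g tau)%C) ->
    forall m, closes T (fun tau => qexp tau ^ S m * (f tau * g tau))%C).
  { induction hf as [c| |f1 f2 h1 IH1 h2 IH2|f1 f2 h1 IH1 h2 IH2|f1 f2 he h1 IH1];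
      intros g hg m.
    - apply closes_ext with (fun tau => c * (qexp tau ^ S m * g tau))%C; auto.
      + intros; ring.
      + apply closes_scal, hg.
    - apply closes_ext with (fun tau => qexp tau ^ S (S m) * g tau)%C; auto.
      intros tau; rewrite !Cpow_S; ring.
    - apply closes_ext with (fun tau => qexp tau ^ S m * (f1 tau * g tau)
        + qexp tau ^ S m * (f2 tau * g tau))%C;
        [exact hT | intros; ring
        | exact (closes_plus T _ _ (IH1 g hg m) (IH2 g hg m))].
    - apply closes_ext with (fun tau => qexp tau ^ S m * (f1 tau * (f2 tau * g tau)))%C;
        [exact hT | intros; ring
        | exact (IH1 (fun tau => f2 tau * g tau)%C (IH2 g hg) m)].
    - apply closes_ext with (fun tau => qexp tau ^ S m * (f1 tau * g tau))%C;
        [exact hT | intros tau; now rewrite he | exact (IH1 g hg m)]. }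
  apply closes_ext with (fun tau => qexp tau ^ 1 * (f tau * 1))%C;
    [exact hT | intros tau; simpl; ring |].
  apply (key (fun _ => 1%C)); intros m.
  apply closes_ext with (fun tau => qexp tau ^ S m)%C;
    [exact hT | intros; ring | now apply closes_qexp_pow].
Qed.

(** ** Partial sums *)

Lemma nome_pow_plus (tau : C) (s s' : R) :
  nome_pow tau (s + s') = (nome_pow tau s * nome_pow tau s')%C.
Proof. unfold nome_pow; rewrite <- Cexp_plus, RtoC_plus; f_equal; ring. Qed.

Lemma nome_pow_pow (tau : C) (s : R) (n : nat) :
  (nome_pow tau s ^ n)%C = nome_pow tau (INR n * s).
Proof. unfold nome_pow; rewrite Cexp_pow, RtoC_mult; f_equal; ring. Qed.

Lemma nome_pow_2 (tau : C) : nome_pow tau 2 = qexp tau.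
Proof. unfold nome_pow, qexp; rewrite RtoC_mult; f_equal; ring. Qed.

Lemma qpoly_nome_pow (s : R) (m : Z) : (0 <= m)%Z -> s = IZR (2 * m) ->
  qpoly (fun tau => nome_pow tau s).
Proof.
  intros hm ->; apply qpoly_ext with (fun tau => qexp tau ^ Z.to_nat m)%C.
  - intros tau; rewrite <- nome_pow_2, nome_pow_pow, INR_IZR_INZ, Z2Nat.id by exact hm.
    rewrite mult_IZR; f_equal; ring.
  - apply qpoly_pow, qpoly_qexp.
Qed.

Definition theta2_partial (N : nat) (tau : C) : C := zsum (theta2_term tau) N.
Definition theta3_partial (N : nat) (tau : C) : C := zsum (theta3_term tau) N.
Definition theta4_partial (N : nat) (tau : C) : C := zsum (theta4_term tau) N.

(** The exponents [(n + 1/2)^2 = n (n + 1) + 1/4] contribute an even integer and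
    [1/4]; eight quarters make up one [q]. *)
Lemma theta2_partial_qpoly (N : nat) : exists P, qpoly P /\
  forall tau, (theta2_partial N tau ^ 8 = qexp tau * P tau)%C.
Proof.
  set (P := fun tau => zsum (fun n => nome_pow tau (IZR (n * (n + 1)))) N).
  exists (fun tau => P tau ^ 8)%C; split.
  - apply qpoly_pow, (qpoly_zsum (fun tau n => nome_pow tau (IZR (n * (n + 1))))).
    intros n; destruct (even_mul_succ n) as [m hm].
    apply qpoly_nome_pow with m; [nia | now rewrite hm].
  - intros tau.
    replace (theta2_partial N tau) with (nome_pow tau (/ 4) * P tau)%C.
    + rewrite Cpow_mult_l, nome_pow_pow, <- nome_pow_2; do 2 f_equal; simpl; field.
    + unfold P, theta2_partial; rewrite <- zsum_scal; apply zsum_ext; intros n.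
      unfold theta2_term; rewrite <- nome_pow_plus, mult_IZR, plus_IZR; f_equal; field.
Qed.

Lemma csum_plus (a b : nat -> C) (N : nat) :
  csum (fun n => a n + b n)%C N = (csum a N + csum b N)%C.
Proof. induction N as [|N IH]; simpl; [|rewrite IH]; ring. Qed.

Lemma zsum_plus (a b : Z -> C) (N : nat) :
  zsum (fun n => a n + b n)%C N = (zsum a N + zsum b N)%C.
Proof.
  unfold zsum.
  rewrite (csum_plus (fun n => a (Z.of_nat n)) (fun n => b (Z.of_nat n))).
  rewrite (csum_plus (fun n => a (- Z.of_nat (S n))%Z) (fun n => b (- Z.of_nat (S n))%Z)).
  ring.
Qed.

Lemma powerRZ_neg1_even (n : Z) :
  powerRZ (-1) n = if Z.even n then 1 else -1.
Proof.
  destruct (Z.even n) eqn:e.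
  - apply Z.even_spec in e; destruct e as [k ->].
    replace (2 * k)%Z with (k + k)%Z by ring.
    rewrite powerRZ_add by lra; apply powerRZ_neg1_square.
  - assert (e' : Z.odd n = true) by (rewrite <- Z.negb_even, e; reflexivity).
    apply Z.odd_spec in e'; destruct e' as [k ->].
    replace (2 * k + 1)%Z with (k + k + 1)%Z by ring.
    rewrite !powerRZ_add, powerRZ_neg1_square by lra; simpl; ring.
Qed.

(** With [E] and [O] the sums of [exp (pi i tau n^2)] over even and odd [n], the product
    [theta3 theta4 = (E + O) (E - O)] involves only even powers of [exp (pi i tau)]. *)
Lemma theta34_partial_qpoly (N : nat) : exists P, qpoly P /\
  forall tau, (theta3_partial N tau * theta4_partial N tau = P tau)%C.
Proof.
  set (E := fun tau => zsum (fun n =>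
    if Z.even n then nome_pow tau (IZR (n * n)) else 0%C) N).
  set (O := fun tau => zsum (fun n =>
    if Z.even n then 0%C else nome_pow tau (IZR (n * n - 1))) N).
  exists (fun tau => E tau * E tau + (RtoC (-1)) * (qexp tau * (O tau * O tau)))%C; split.
  - assert (hE : qpoly E).
    { apply (qpoly_zsum (fun tau n =>
        if Z.even n then nome_pow tau (IZR (n * n)) else 0%C)); intros n.
      destruct (Z.even n) eqn:e; [|apply qpoly_const].
      apply Z.even_spec in e; destruct e as [k ->].
      apply qpoly_nome_pow with (2 * k * k)%Z; [nia | f_equal; ring]. }
    assert (hO : qpoly O).
    { apply (qpoly_zsum (fun tau n =>
        if Z.even n then 0%C else nome_pow tau (IZR (n * n - 1)))); intros n.
      destruct (Z.even n) eqn:e; [apply qpoly_const|].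
      assert (e' : Z.odd n = true) by (rewrite <- Z.negb_even, e; reflexivity).
      apply Z.odd_spec in e'; destruct e' as [k ->].
      apply qpoly_nome_pow with (2 * k * (k + 1))%Z; [nia | f_equal; ring]. }
    apply qpoly_plus; [now apply qpoly_mult|].
    apply qpoly_mult; [apply qpoly_const|].
    apply qpoly_mult; [apply qpoly_qexp | now apply qpoly_mult].
  - intros tau.
    assert (h3 : theta3_partial N tau = (E tau + nome_pow tau 1 * O tau)%C).
    { unfold E, O, theta3_partial; rewrite <- zsum_scal, <- zsum_plus.
      apply zsum_ext; intros n; unfold theta3_term; destruct (Z.even n).
      - rewrite mult_IZR, Cmult_0_r, Cplus_0_r; f_equal; ring.
      - rewrite <- nome_pow_plus, minus_IZR, mult_IZR, Cplus_0_l; f_equal; ring. }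
    assert (h4 : theta4_partial N tau
      = (E tau + (RtoC (-1) * nome_pow tau 1) * O tau)%C).
    { unfold E, O, theta4_partial; rewrite <- zsum_scal, <- zsum_plus.
      apply zsum_ext; intros n; unfold theta4_term; rewrite powerRZ_neg1_even.
      destruct (Z.even n).
      - rewrite mult_IZR, Cmult_0_r, Cplus_0_r, Cmult_1_l; f_equal; ring.
      - rewrite <- Cmult_assoc, <- nome_pow_plus, minus_IZR, mult_IZR, Cplus_0_l.
        do 2 f_equal; ring. }
    rewrite h3, h4.
    assert (hq : qexp tau = (nome_pow tau 1 * nome_pow tau 1)%C).
    { rewrite <- nome_pow_plus, <- nome_pow_2; f_equal; ring. }
    rewrite hq; ring.
Qed.

Definition F_cusp_partial (N : nat) (tau : C) : C :=
  (theta2_partial N tau ^ 8 * theta3_partial N tau * theta4_partial N tau)%C.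

Lemma closes_F_cusp_partial (T : R) (N : nat) : 1 <= T -> closes T (F_cusp_partial N).
Proof.
  intros hT; destruct (theta2_partial_qpoly N) as [P [hP e2]].
  destruct (theta34_partial_qpoly N) as [P' [hP' e34]].
  apply closes_ext with (fun tau => qexp tau * (P tau * P' tau))%C; [exact hT| |].
  - intros tau; unfold F_cusp_partial.
    rewrite <- Cmult_assoc, e34, e2; ring.
  - apply closes_qpoly; [exact hT | now apply qpoly_mult].
Qed.

(** ** Passage to the limit *)

(** Uniform approximation at a geometric rate, together with uniform bounds so
    that the notion passes to products. *)
Definition unif_geom_limit (y r : R) (fN : nat -> C -> C) (f : C -> C) : Prop :=
  exists B K, 0 <= B /\ 0 <= K /\ forall tau, y <= Im tau -> forall N,
    Cmod (f tau) <= B /\ Cmod (fN N tau) <= B /\ Cmod (f tau - fN N tau) <= K * r ^ N.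

Lemma unif_geom_limit_mult (y r : R) (fN gN : nat -> C -> C) (f g : C -> C) :
  unif_geom_limit y r fN f -> unif_geom_limit y r gN g ->
  unif_geom_limit y r (fun N tau => fN N tau * gN N tau)%C (fun tau => f tau * g tau)%C.
Proof.
  intros [B [K [hB [hK hf]]]] [B' [K' [hB' [hK' hg]]]].
  exists (B * B'), (K * B' + B * K'); repeat split.
  - now apply Rmult_le_pos.
  - apply Rplus_le_le_0_compat; now apply Rmult_le_pos.
  - destruct (hf tau H N) as [h1 _]; destruct (hg tau H N) as [h2 _].
    rewrite Cmod_mult; apply Rmult_le_compat; auto using Cmod_ge_0.
  - destruct (hf tau H N) as [_ [h1 _]]; destruct (hg tau H N) as [_ [h2 _]].
    rewrite Cmod_mult; apply Rmult_le_compat; auto using Cmod_ge_0.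
  - destruct (hf tau H N) as [_ [h1 h1']]; destruct (hg tau H N) as [h2 [_ h2']].
    replace (_ - _)%C with ((f tau - fN N tau) * g tau + fN N tau * (g tau - gN N tau))%C
      by ring.
    apply Rle_trans with (1 := Cmod_triangle _ _); rewrite !Cmod_mult.
    replace ((K * B' + B * K') * r ^ N) with (K * r ^ N * B' + B * (K' * r ^ N)) by ring.
    apply Rplus_le_compat; apply Rmult_le_compat; auto using Cmod_ge_0.
Qed.

Lemma unif_geom_limit_pow (y r : R) (fN : nat -> C -> C) (f : C -> C) (n : nat) :
  unif_geom_limit y r fN f ->
  unif_geom_limit y r (fun N tau => fN N tau ^ S n)%C (fun tau => f tau ^ S n)%C.
Proof.
  intros hf; induction n as [|n IH].
  - destruct hf as [B [K [hB [hK h]]]]; exists B, K; split; [exact hB|].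
    split; [exact hK|]; intros tau htau N; rewrite !Cpow_1_r; now apply h.
  - exact (unif_geom_limit_mult y r _ _ _ _ hf IH).
Qed.

Lemma ZSeries_unif_geom_limit (a : C -> Z -> C) (y A r : R) : 0 <= r < 1 -> 0 <= A ->
  (forall tau, y <= Im tau -> geom_dominated A r (a tau)) ->
  unif_geom_limit y r (fun N tau => zsum (a tau) N) (fun tau => ZSeries (a tau)).
Proof.
  intros hr hA ha.
  assert (h4 : 0 <= 4 * A / (1 - r)) by (apply Rdiv_le_0_compat; lra).
  exists (8 * A / (1 - r)), (4 * A / (1 - r)).
  assert (h8 : 8 * A / (1 - r) = 4 * A / (1 - r) + 4 * A / (1 - r)) by (field; lra).
  rewrite h8; split; [lra|]; split; [exact h4|].
  intros tau htau N; specialize (ha tau htau).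
  assert (h1 := ZSeries_bound _ A r hr hA ha).
  assert (h2 := ZSeries_tail _ A r N hr hA ha).
  split; [lra|]; split; [|exact h2].
  replace (zsum (a tau) N)
    with (ZSeries (a tau) + - (ZSeries (a tau) - zsum (a tau) N))%C by ring.
  apply Rle_trans with (1 := Cmod_triangle _ _); rewrite Cmod_opp.
  assert (hrN : r ^ N <= 1) by (rewrite <- (pow1 N); apply pow_incr; lra).
  nra.
Qed.

Lemma F_cusp_unif_geom_limit (y : R) : 0 < y ->
  unif_geom_limit y (exp (- (PI * y))) F_cusp_partial F_cusp.
Proof.
  intros hy; assert (hr := theta_ratio y hy).
  assert (hA : 0 <= exp (9 * (PI * y) / 4)) by (left; apply exp_pos).
  apply (unif_geom_limit_mult _ _
    (fun N tau => theta2_partial N tau ^ 8 * theta3_partial N tau)%C theta4_partial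
    (fun tau => theta2 tau ^ 8 * theta3 tau)%C theta4).
  - apply (unif_geom_limit_mult _ _ (fun N tau => theta2_partial N tau ^ 8)%C
      theta3_partial (fun tau => theta2 tau ^ 8)%C theta3).
    + apply (unif_geom_limit_pow _ _ theta2_partial theta2 7).
      apply (ZSeries_unif_geom_limit theta2_term y _ _ hr hA).
      intros; now apply theta2_dominated.
    + apply (ZSeries_unif_geom_limit theta3_term y _ _ hr hA).
      intros; now apply theta3_dominated.
  - apply (ZSeries_unif_geom_limit theta4_term y _ _ hr hA).
    intros; now apply theta4_dominated.
Qed.

Lemma F_cusp_continuous (p : R -> C) (x : R) :
  Ccontinuous p x -> 0 < Im (p x) -> Ccontinuous (fun y => F_cusp (p y)) x.
Proof.
  intros hp hx; unfold F_cusp; apply Ccontinuous_mult; [apply Ccontinuous_mult|].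
  - now apply Ccontinuous_pow, theta2_continuous.
  - now apply theta3_continuous.
  - now apply theta4_continuous.
Qed.

Lemma closes_F_cusp (T : R) : 1 <= T -> closes T F_cusp.
Proof.
  intros hT; assert (hy := level_pos T hT); assert (hg := gap_pos T).
  destruct (inv_le_self T hT) as [_ hT'].
  assert (hT0 : 0 < / T) by (apply Rinv_0_lt_compat; lra).
  set (I := CInt (fun t => F_cusp (arc t) * arc_speed t)%C (/ T) T).
  set (J := CInt (fun x => F_cusp (chord T x)) (- gap T) (gap T)).
  assert (hI : is_CInt (fun t => F_cusp (arc t) * arc_speed t)%C (/ T) T I).
  { apply CInt_correct; [exact hT'|]; intros t ht.
    apply Ccontinuous_mult; [|apply Ccontinuous_arc_speed].
    apply F_cusp_continuous; [apply Ccontinuous_arc|].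
    apply Rlt_le_trans with (1 := hy); now apply level_le_arc. }
  assert (hJ : is_CInt (fun x => F_cusp (chord T x)) (- gap T) (gap T) J).
  { apply CInt_correct; [lra|]; intros x hx.
    apply F_cusp_continuous; [|now rewrite Im_chord].
    apply Cderive_continuous with (1 := Cderive_chord T x). }
  destruct (F_cusp_unif_geom_limit (level T) hy) as [B [K [hB [hK hlim]]]].
  set (r := exp (- (PI * level T))) in hlim.
  assert (h0 : (I + J)%C = 0%C).
  { apply (zero_of_geom_bound _ ((T - / T) * K + (gap T - - gap T) * K) r).
    { now apply theta_ratio. }
    intros N; destruct (closes_F_cusp_partial T N hT) as [IN [h1 h2]].
    replace (I + J)%C with ((I - IN) + (J - - IN))%C by ring.
    apply Rle_trans with (1 := Cmod_triangle _ _).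
    rewrite Rmult_plus_distr_r, !Rmult_assoc; apply Rplus_le_compat.
    - apply (CInt_close (fun t => F_cusp (arc t) * arc_speed t)%C
        (fun t => F_cusp_partial N (arc t) * arc_speed t)%C (/ T) T); auto.
      intros t ht; destruct (hlim (arc t) (level_le_arc T t hT ht) N) as [_ [_ h]].
      replace (_ - _)%C with ((F_cusp (arc t) - F_cusp_partial N (arc t)) * arc_speed t)%C by ring.
      rewrite Cmod_mult, <- (Rmult_1_r (K * r ^ N)).
      apply Rmult_le_compat; auto using Cmod_ge_0, Cmod_arc_speed_le.
    - apply (CInt_close (fun x => F_cusp (chord T x)) (fun x => F_cusp_partial N (chord T x))
        (- gap T) (gap T)); auto; [lra|].
      intros x hx; apply hlim; rewrite Im_chord; lra. }
  exists I; split; [exact hI|].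
  replace (- I)%C with ((I + J) - I - (I + J))%C by ring.
  replace (I + J - I - (I + J))%C with (J - (I + J))%C by ring.
  rewrite h0; replace (J - 0)%C with J by ring; exact hJ.
Qed.

Lemma pow10_of_square (b c : C) : (b * b = c)%C -> (b ^ 10 = c ^ 5)%C.
Proof. intros <-; ring. Qed.

(** [theta2] and [theta4] are exchanged, [theta3] is kept, and the factor is
    [b^10] with [b^2 = - i (i t) = t]. *)
Lemma F_1_inversion (t : R) : 0 < t ->
  F_1 (Ci * RtoC (/ t)) = (RtoC (t ^ 5) * F_1 (Ci * RtoC t))%C.
Proof.
  intros ht.
  destruct (theta_inversion (Ci * RtoC t)) as [b [_ [hb [h2 [h3 h4]]]]].
  { simpl; lra. }
  assert (ht0 : RtoC t <> 0%C) by (intros e; apply RtoC_inj in e; lra).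
  assert (e : (- / (Ci * RtoC t))%C = (Ci * RtoC (/ t))%C).
  { rewrite RtoC_inv by lra.
    replace (Ci * / RtoC t)%C with ((Ci * Ci) * / (Ci * RtoC t))%C
      by (field; split; [exact ht0 | exact Ci_neq_0]).
    rewrite Ci_square; ring. }
  rewrite e in h2, h3, h4; unfold F_1; rewrite h2, h3, h4.
  replace (- Ci * (Ci * RtoC t))%C with (- (Ci * Ci) * RtoC t)%C in hb by ring.
  rewrite Ci_square in hb.
  replace (- - (1) * RtoC t)%C with (RtoC t) in hb by ring.
  rewrite RtoC_pow, <- (pow10_of_square b _ hb); ring.
Qed.

(** On the imaginary axis, [F_1 (i t) (1 + i t)^3] is the pullback of
    [F_cusp] along [arc]: translate by [1], where [theta3] and [theta4] are
    exchanged, then invert. *)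
Lemma F_1_arc (t : R) : 0 < t ->
  (zeta8 * (F_1 (Ci * RtoC t) * (1 + Ci * RtoC t) ^ 3) = F_cusp (arc t) * arc_speed t)%C.
Proof.
  intros ht; set (w := (1 + Ci * RtoC t)%C).
  assert (hw : 0 < Im w) by (unfold w; simpl; lra).
  assert (hw0 : w <> 0%C).
  { intros e; rewrite e in hw; simpl in hw; lra. }
  assert (ht' : 0 < Im (Ci * RtoC t)) by (simpl; lra).
  assert (ew : w = (Ci * RtoC t + 1)%C) by (unfold w; ring).
  assert (t2 := theta2_plus1 _ ht'); rewrite <- ew in t2.
  assert (t3 := theta3_plus1 (Ci * RtoC t)); rewrite <- ew in t3.
  assert (t4 := theta4_plus1 (Ci * RtoC t)); rewrite <- ew in t4.
  destruct (theta_inversion w hw) as [b [_ [hb [h2 [h3 h4]]]]].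
  change (arc t) with (- / w)%C; change (arc_speed t) with (Ci / w ^ 2)%C.
  unfold F_cusp, F_1; rewrite h2, h3, h4, t2, t3, t4.
  set (x := theta2 _); set (y := theta3 _); set (z := theta4 _).
  replace ((b * y) ^ 8 * (b * z) * (b * (zeta8 * x)) * (Ci / w ^ 2))%C
    with (b ^ 10 * Ci * (zeta8 * (x * y ^ 8 * z)) / w ^ 2)%C by (field; exact hw0).
  rewrite (pow10_of_square b _ hb).
  replace ((- Ci * w) ^ 5 * Ci)%C with (- (Ci * Ci) * (Ci * Ci) * (Ci * Ci) * w ^ 5)%C by ring.
  rewrite Ci_square; field; exact hw0.
Qed.

Lemma F_1_continuous (t : R) : 0 < t -> Ccontinuous (fun s => F_1 (Ci * RtoC s)) t.
Proof.
  intros ht.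
  assert (hp : Ccontinuous (fun s : R => Ci * RtoC s)%C t).
  { apply Ccontinuous_mult; [apply Ccontinuous_const|].
    apply Ccontinuous_RtoC, continuous_id. }
  assert (hi : 0 < Im (Ci * RtoC t)) by (simpl; lra).
  unfold F_1; apply Ccontinuous_mult; [apply Ccontinuous_mult|].
  - now apply (theta2_continuous (fun s => Ci * RtoC s)%C).
  - now apply Ccontinuous_pow, (theta3_continuous (fun s => Ci * RtoC s)%C).
  - now apply (theta4_continuous (fun s => Ci * RtoC s)%C).
Qed.

(** Near [0] the bound is the one near infinity, carried over by inversion. *)
Lemma F_1_bound : exists K, 0 <= K /\
  (forall t, 0 < t <= 1 -> Cmod (F_1 (Ci * RtoC t)) <= K) /\
  (forall t, 1 <= t -> Cmod (F_1 (Ci * RtoC t)) <= K / t ^ 5).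
Proof.
  destruct theta_product_decay as [K [hK h]]; exists K; split; [exact hK|].
  assert (h1 : forall t, 1 <= t -> Cmod (F_1 (Ci * RtoC t)) <= K / t ^ 5).
  { intros t ht.
    assert (e : Im (Ci * RtoC t) = t) by (simpl; ring).
    destruct (h (Ci * RtoC t)%C ltac:(rewrite e; lra)) as [h' _].
    rewrite e in h'; exact h'. }
  split; [|exact h1]; intros t ht.
  assert (hs : 1 <= / t).
  { apply Rle_trans with (/ 1); [lra | apply Rinv_le_contravar; lra]. }
  rewrite <- (Rinv_inv t), F_1_inversion, Cmod_mult, Cmod_R by lra.
  assert (h5 : 0 < (/ t) ^ 5) by (apply pow_lt; lra).
  rewrite Rabs_pos_eq by lra.
  apply Rle_trans with ((/ t) ^ 5 * (K / (/ t) ^ 5)).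
  - apply Rmult_le_compat_l; [lra | now apply h1].
  - right; field; lra.
Qed.

(** The cusp [0] is approached in a sector, where inversion leads high up in the
    half-plane. *)
Lemma F_cusp_bound : exists B, 0 <= B /\
  forall x v, 0 < v <= 1 -> Rabs x <= v -> Cmod (F_cusp (RtoC x + Ci * RtoC v)) <= B.
Proof.
  destruct theta_product_decay as [K [hK h]]; exists (K * 32).
  split; [lra|]; intros x v hv hx.
  set (u := (RtoC x + Ci * RtoC v)%C).
  assert (hu : 0 < Im u) by (unfold u; simpl; lra).
  destruct (theta_inversion u hu) as [b [hb0 [hb [h2 [h3 h4]]]]].
  assert (hx2 : x ^ 2 <= v ^ 2) by (rewrite <- (pow2_abs x); apply pow_incr; split;
    [apply Rabs_pos | exact hx]).
  assert (hn : Cmod u ^ 2 = x ^ 2 + v ^ 2).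
  { unfold u, Cmod; rewrite pow2_sqrt; [simpl; ring|].
    apply Rplus_le_le_0_compat; apply pow2_ge_0. }
  assert (hm0 := Cmod_ge_0 u).
  assert (hm1 : 0 < Cmod u) by nra.
  assert (hm2 : Cmod u <= 2 * v) by nra.
  assert (hi : Im (- / u) = v / Cmod u ^ 2).
  { rewrite hn; unfold u; simpl; field; nra. }
  assert (hd : 0 < Cmod u ^ 2) by nra.
  assert (hi2 : / 2 <= Im (- / u)).
  { rewrite hi; apply Rmult_le_reg_r with (Cmod u ^ 2); [exact hd|].
    unfold Rdiv; rewrite Rmult_assoc, Rinv_l by lra; nra. }
  destruct (h _ hi2) as [_ hq]; rewrite hi, h2, h3, h4 in hq.
  replace (b * theta4 u * (b * theta2 u) ^ 8 * (b * theta3 u))%C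
    with (b ^ 10 * F_cusp u)%C in hq by (unfold F_cusp; ring).
  rewrite (pow10_of_square b _ hb), Cmod_mult, Cmod_pow, Cmod_mult, Cmod_opp, Cmod_Ci,
    Rmult_1_l in hq.
  assert (hd5 : 0 < Cmod u ^ 5) by now apply pow_lt.
  apply Rmult_le_reg_l with (Cmod u ^ 5); [exact hd5|].
  apply Rle_trans with (1 := hq).
  replace (K / (v / Cmod u ^ 2) ^ 5) with (Cmod u ^ 5 * (K * (Cmod u / v) ^ 5))
    by (field; lra).
  apply Rmult_le_compat_l; [lra|]; apply Rmult_le_compat_l; [exact hK|].
  replace 32 with (2 ^ 5) by ring; apply pow_incr; split.
  - apply Rdiv_le_0_compat; lra.
  - apply Rmult_le_reg_r with v; [lra|]; unfold Rdiv; rewrite Rmult_assoc, Rinv_l; lra.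
Qed.

(** * The truncated period polynomial *)

(** Truncated moments.  The interval is invariant under [t -> 1/t]. *)
Definition moment (k : nat) (T : R) : C :=
  CInt (fun t => F_1 (Ci * RtoC t) * RtoC (t ^ k))%C (/ T) T.

Lemma moment_continuous (k : nat) (t : R) : 0 < t ->
  Ccontinuous (fun t => F_1 (Ci * RtoC t) * RtoC (t ^ k))%C t.
Proof.
  intros ht; apply Ccontinuous_mult; [now apply F_1_continuous|].
  apply Ccontinuous_RtoC, (ex_derive_continuous (V := R_NormedModule) (fun t => t ^ k)).
  auto_derive; exact I.
Qed.

Lemma is_moment (k : nat) (T : R) : 1 <= T ->
  is_CInt (fun t => F_1 (Ci * RtoC t) * RtoC (t ^ k))%C (/ T) T (moment k T).
Proof.
  intros hT; destruct (inv_le_self T hT) as [h1 h2].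
  apply CInt_correct; [exact h2|]; intros t ht; apply moment_continuous; lra.
Qed.

Lemma moment_symmetry (k j : nat) (T : R) : 1 <= T -> (k + j = 3)%nat ->
  moment k T = moment j T.
Proof.
  intros hT hkj; destruct (inv_le_self T hT) as [h1 h2].
  set (f := fun t => (F_1 (Ci * RtoC t) * RtoC (t ^ k))%C).
  assert (hsw : @RInt C_R_CompleteNormedModule f T (/ T) = (- moment k T)%C).
  { apply (@is_RInt_unique C_R_CompleteNormedModule).
    apply (@is_RInt_swap C_R_NormedModule), is_moment; exact hT. }
  assert (hc : is_CInt (fun t => - (RtoC (- / t ^ 2) * f (/ t)%R))%C (/ T) T (moment k T)).
  { replace (moment k T) with (- - moment k T)%C by ring.
    apply (@is_RInt_opp C_R_NormedModule (fun t => RtoC (- / t ^ 2) * f (/ t)%R)%C).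
    rewrite <- hsw; rewrite <- (Rinv_inv T) at 3.
    apply (@is_RInt_ext C_R_NormedModule
      (fun t => @scal R_AbsRing C_R_NormedModule (- / t ^ 2) (f (/ t)))).
    { intros t _; apply scal_RtoC. }
    apply (@is_RInt_comp C_R_CompleteNormedModule f Rinv (fun t => - / t ^ 2));
      rewrite Rmin_left, Rmax_right by exact h2; intros t ht.
    - apply moment_continuous, Rinv_0_lt_compat; lra.
    - split.
      + evar_last; [apply is_derive_inv; [apply (@is_derive_id R_AbsRing) | lra]|].
        unfold one; simpl; field; lra.
      + apply (ex_derive_continuous (V := R_NormedModule) (fun t => - / t ^ 2)).
        auto_derive; nra. }
  symmetry; apply CInt_unique.
  apply is_CInt_ext with (3 := hc); [exact h2|]; intros t ht.
  assert (ht0 : 0 < t) by lra.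
  unfold f; rewrite F_1_inversion by exact ht0.
  replace (- (RtoC (- / t ^ 2) * (RtoC (t ^ 5) * F_1 (Ci * RtoC t) * RtoC ((/ t) ^ k))))%C
    with (F_1 (Ci * RtoC t) * (RtoC (/ t ^ 2) * RtoC (t ^ 5) * RtoC ((/ t) ^ k)))%C
    by (rewrite RtoC_opp; ring).
  rewrite <- !RtoC_mult; do 2 f_equal.
  replace (t ^ 5) with (t ^ 2 * (t ^ k * t ^ j)) by (rewrite <- !pow_add; f_equal; lia).
  rewrite pow_inv; field; split; [apply pow_nonzero|]; lra.
Qed.

(** An improper integral known to converge may be computed along the truncations
    [1/T <= t <= T]. *)
Lemma Clim_seq_of_improper (f : R -> C) (l : C) :
  is_RInt_gen (V := C_R_NormedModule) f (at_right 0) (Rbar_locally p_infty) l ->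
  Clim_seq (fun N => CInt f (/ INR (S N)) (INR (S N))) l.
Proof.
  intros h.
  apply is_lim_seq_spec; intros eps.
  destruct (h (fun z => Cmod (z - l) < eps)) as [Q1 Q2 hQ1 hQ2 hQ].
  { apply (locally_le_locally_norm (V := C_R_NormedModule)).
    exists eps; intros z hz; unfold ball_norm in hz; rewrite C_norm_Cmod in hz; exact hz. }
  destruct hQ1 as [d hd]; destruct hQ2 as [M hM].
  destruct (nfloor_ex (Rmax 0 (Rmax M (/ d)))) as [n0 hn0]; [apply Rmax_l|].
  exists n0; intros N hN.
  assert (hN1 : Rmax 0 (Rmax M (/ d)) < INR (S N)).
  { apply Rlt_le_trans with (1 := proj2 hn0); rewrite S_INR.
    apply le_INR in hN; lra. }
  assert (m1 := Rmax_r 0 (Rmax M (/ d))).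
  assert (m2 := Rmax_l M (/ d)); assert (m3 := Rmax_r M (/ d)).
  assert (hS : 0 < INR (S N)) by (apply lt_0_INR; lia).
  assert (hd0 := cond_pos d).
  assert (hinv : / INR (S N) < d).
  { rewrite <- (Rinv_inv d); apply Rinv_lt_contravar; [|lra].
    apply Rmult_lt_0_compat; [now apply Rinv_0_lt_compat | exact hS]. }
  assert (hpos := Rinv_0_lt_compat _ hS).
  set (s := INR (S N)) in *; clearbody s.
  destruct (hQ (/ s) s) as [z [hz1 hz2]].
  - apply hd; [|exact hpos].
    unfold ball; simpl; unfold AbsRing_ball, abs, minus, plus, opp; simpl.
    rewrite Ropp_0, Rplus_0_r, Rabs_pos_eq; lra.
  - apply hM; lra.
  - cbn [fst snd] in hz1.
    rewrite (CInt_unique _ _ _ _ hz1), Rminus_0_r, Rabs_pos_eq; [exact hz2|].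
    apply Cmod_ge_0.
Qed.

Lemma at_right_0_between (d : R) : 0 < d -> at_right 0 (fun a => 0 < a < d).
Proof.
  intros hd; exists (mkposreal d hd); intros a ha ha0; split; [exact ha0|].
  unfold ball in ha; simpl in ha; unfold AbsRing_ball, abs, minus, plus, opp in ha;
    simpl in ha.
  rewrite Ropp_0, Rplus_0_r in ha; apply Rabs_def2 in ha; lra.
Qed.

(** Cauchy's criterion: moving the lower end within [(0, d)] changes the integral
    by at most [K d], moving the upper end beyond [1/d] as well. *)
Lemma ex_improper_of_bounds (f : R -> C) (K : R) : 0 <= K ->
  (forall t, 0 < t -> Ccontinuous f t) ->
  (forall t, 0 < t <= 1 -> Cmod (f t) <= K) ->
  (forall t, 1 <= t -> Cmod (f t) <= K / t ^ 2) ->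
  ex_RInt_gen (V := C_R_NormedModule) f (at_right 0) (Rbar_locally p_infty).
Proof.
  intros hK hc h0 h1.
  assert (hI : forall a b, 0 < a <= b -> is_CInt f a b (CInt f a b)).
  { intros a b hab; apply CInt_correct; [lra|]; intros t ht; apply hc; lra. }
  assert (hch : forall a b c, 0 < a <= b -> b <= c ->
    CInt f a c = (CInt f a b + CInt f b c)%C).
  { intros a b c hab hbc; apply CInt_unique, is_CInt_Chasles with b; apply hI; lra. }
  assert (near0 : forall d a a', 0 < a < d -> 0 < a' < d -> d <= 1 ->
    Cmod (CInt f a 1 - CInt f a' 1) <= K * d).
  { assert (hle : forall d a a', 0 < a <= a' -> a' < d -> d <= 1 ->
      Cmod (CInt f a 1 - CInt f a' 1) <= K * d).
    { intros d a a' ha ha' hd.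
      rewrite (hch a a' 1) by lra.
      replace (_ - _)%C with (CInt f a a') by ring.
      apply Rle_trans with ((a' - a) * K); [|nra].
      apply (is_CInt_Cmod_le f a a'); [lra | | apply hI; lra].
      intros t ht; apply h0; lra. }
    intros d a a' ha ha' hd; destruct (Rle_or_lt a a').
    - apply hle; lra.
    - rewrite <- Cmod_opp, Copp_minus_distr; apply hle; lra. }
  assert (nearinf : forall M b b', 1 <= M -> M < b -> M < b' ->
    Cmod (CInt f 1 b - CInt f 1 b') <= K * / M).
  { assert (hle : forall M b b', 1 <= M -> M < b <= b' ->
      Cmod (CInt f 1 b' - CInt f 1 b) <= K * / M).
    { intros M b b' hM hb.
      rewrite (hch 1 b b') by lra.
      replace (_ - _)%C with (CInt f b b') by ring.
      assert (hint : is_RInt (fun t => K / t ^ 2) b b' (- K / b' - - K / b)).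
      { apply (is_RInt_derive (V := R_CompleteNormedModule) (fun t => - K / t));
          rewrite Rmin_left, Rmax_right by lra; intros t ht.
        - auto_derive; [lra | field; lra].
        - apply (ex_derive_continuous (V := R_NormedModule) (fun t => K / t ^ 2)).
          auto_derive; nra. }
      apply Rle_trans with (- K / b' - - K / b).
      - rewrite <- C_norm_Cmod.
        apply (norm_RInt_le (V := C_R_NormedModule) f (fun t => K / t ^ 2) b b');
          [lra | | apply hI; lra | exact hint].
        intros t ht; rewrite C_norm_Cmod; apply h1; lra.
      - assert (e1 : / b <= / M) by (apply Rinv_le_contravar; lra).
        assert (e2 : 0 < / b') by (apply Rinv_0_lt_compat; lra).
        unfold Rdiv; nra. }
    intros M b b' hM hb hb'; destruct (Rle_or_lt b b').
    - rewrite <- Cmod_opp, Copp_minus_distr; apply hle; lra.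
    - apply hle; lra. }
  assert (hlim : exists l : C_R_CompleteNormedModule,
    filterlim (fun ab => CInt f (fst ab) (snd ab) : C_R_CompleteNormedModule)
      (filter_prod (at_right 0) (Rbar_locally p_infty)) (locally l)).
  { apply (proj1 (filterlim_locally_cauchy (U := C_R_CompleteNormedModule)
      (F := filter_prod (at_right 0) (Rbar_locally p_infty))
      (fun ab => CInt f (fst ab) (snd ab)))); intros eps.
    set (d := Rmin 1 (eps / (4 * (K + 1)))).
    assert (heps := cond_pos eps).
    assert (hd : 0 < d).
    { apply Rmin_pos; [lra|]; apply Rdiv_lt_0_compat; lra. }
    assert (hd1 : d <= 1) by apply Rmin_l.
    assert (hKd : K * d <= eps / 4).
    { apply Rle_trans with (K * (eps / (4 * (K + 1)))).
      - apply Rmult_le_compat_l; [exact hK | apply Rmin_r].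
      - apply Rmult_le_reg_r with (4 * (K + 1)); [lra|].
        replace (K * (eps / (4 * (K + 1))) * (4 * (K + 1))) with (K * eps) by (field; lra).
        nra. }
    exists (fun ab => 0 < fst ab < d /\ / d < snd ab); split.
    - apply Filter_prod with (Q := fun a => 0 < a < d) (R := fun b => / d < b).
      + apply (at_right_0_between d hd).
      + exists (/ d); auto.
      + intros a b; auto.
    - intros [a b] [a' b']; cbn [fst snd]; intros [ha hb] [ha' hb'].
      assert (hinv : 1 <= / d).
      { apply Rle_trans with (/ 1); [lra | apply Rinv_le_contravar; lra]. }
      apply (norm_compat1 (V := C_R_NormedModule)); rewrite C_norm_Cmod.
      rewrite (hch a 1 b), (hch a' 1 b') by lra.
      change (Cmod ((CInt f a' 1 + CInt f 1 b') - (CInt f a 1 + CInt f 1 b)) < eps).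
      replace (_ - _)%C with ((CInt f a' 1 - CInt f a 1) + (CInt f 1 b' - CInt f 1 b))%C
        by ring.
      apply Rle_lt_trans with (1 := Cmod_triangle _ _).
      assert (e1 := near0 d a' a ha' ha hd1).
      assert (e2 := nearinf (/ d) b' b hinv hb' hb).
      rewrite Rinv_inv in e2; lra. }
  destruct hlim as [l hl]; exists l.
  apply (filterlimi_lim_ext_loc (fun ab => CInt f (fst ab) (snd ab))); [|exact hl].
  apply Filter_prod with (Q := fun a => 0 < a < 1) (R := fun b => 1 < b).
  - apply (at_right_0_between 1 Rlt_0_1).
  - exists 1; auto.
  - intros a b ha hb; apply hI; cbn [fst snd]; lra.
Qed.

Definition period_integrand (X : C) (tau : C) : C := (F_1 tau * (tau - X) ^ 3)%C.

Definition truncated_period (T : R) (X : C) : C :=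
  (moment 3 T + 3 * Ci * X * moment 2 T - 3 * X ^ 2 * moment 1 T
   - Ci * X ^ 3 * moment 0 T)%C.

Lemma is_truncated_period (T : R) (X : C) : 1 <= T ->
  is_CInt (imag_axis_pullback (period_integrand X)) (/ T) T (truncated_period T X).
Proof.
  intros hT; destruct (inv_le_self T hT) as [h1 h2].
  set (g := fun (k : nat) (t : R) => (F_1 (Ci * RtoC t) * RtoC (t ^ k))%C).
  apply is_CInt_ext with (fun t => g 3%nat t + 3 * Ci * X * g 2%nat t
    - 3 * X ^ 2 * g 1%nat t - Ci * X ^ 3 * g 0%nat t)%C; [exact h2 | |].
  - intros t _; unfold g, imag_axis_pullback, period_integrand.
    set (F := F_1 _); rewrite !RtoC_pow.
    replace (F * (Ci * RtoC t - X) ^ 3 * Ci)%C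
      with (F * ((Ci * Ci) * (Ci * Ci) * RtoC t ^ 3 - 3 * (Ci * Ci) * Ci * RtoC t ^ 2 * X
        + 3 * (Ci * Ci) * RtoC t * X ^ 2 - Ci * X ^ 3))%C by ring.
    rewrite Ci_square; ring.
  - assert (hg := fun k => is_moment k T hT).
    assert (h32 := is_CInt_plus _ _ _ _ _ _ (hg 3%nat)
      (is_CInt_scal (3 * Ci * X)%C _ _ _ _ (hg 2%nat))).
    assert (h321 := is_CInt_minus _ _ _ _ _ _ h32
      (is_CInt_scal (3 * X ^ 2)%C _ _ _ _ (hg 1%nat))).
    exact (is_CInt_minus _ _ _ _ _ _ h321
      (is_CInt_scal (Ci * X ^ 3)%C _ _ _ _ (hg 0%nat))).
Qed.

(** At [X = -1] the truncated period is, up to constants of modulus [1], the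
    integral over the arc, hence that over the chord.  By the symmetry of the
    moments it is also [(1 + i) (M 0 - 3 M 1)]. *)
Lemma moment_relation : exists B, forall T, 1 <= T ->
  Cmod (moment 0 T - 3 * moment 1 T) <= B * gap T.
Proof.
  destruct F_cusp_bound as [B [hB hH]]; exists (2 * B); intros T hT.
  destruct (inv_le_self T hT) as [h1 h2].
  destruct (closes_F_cusp T hT) as [I [hI hJ]].
  assert (hg := gap_pos T).
  assert (hl := level_pos T hT).
  assert (hgl : gap T <= level T).
  { unfold gap, level, Rdiv; rewrite <- (Rmult_1_l (/ (1 + T ^ 2))) at 1.
    apply Rmult_le_compat_r; [left; apply gap_pos | exact hT]. }
  assert (hl1 : level T <= 1).
  { unfold level; apply Rmult_le_reg_r with (1 + T ^ 2); [nra|].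
    unfold Rdiv; rewrite Rmult_assoc, Rinv_l by nra; nra. }
  assert (hIle : Cmod I <= 2 * B * gap T).
  { rewrite <- Cmod_opp.
    apply Rle_trans with ((gap T - - gap T) * B); [|right; ring].
    apply (is_CInt_Cmod_le (fun x => F_cusp (chord T x)) (- gap T) (gap T)); auto; [lra|].
    intros x hx; apply hH; [lra|]; apply Rabs_le; lra. }
  assert (hP : (zeta8 * truncated_period T (- (1)))%C = (Ci * I)%C).
  { assert (hz := is_CInt_scal zeta8 _ _ _ _ (is_truncated_period T (- (1))%C hT)).
    rewrite <- (CInt_unique _ _ _ _ hz); apply CInt_unique.
    apply is_CInt_ext with (fun t => Ci * (F_cusp (arc t) * arc_speed t))%C; [exact h2 | |].
    - intros t ht; rewrite <- F_1_arc by lra.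
      unfold imag_axis_pullback, period_integrand; ring.
    - now apply is_CInt_scal. }
  apply (f_equal Cmod) in hP.
  unfold zeta8 in hP; rewrite !Cmod_mult, Cmod_e2pi, Cmod_Ci, !Rmult_1_l in hP.
  replace (truncated_period T (- (1)))
    with ((1 + Ci) * (moment 0 T - 3 * moment 1 T))%C in hP.
  - rewrite Cmod_mult in hP.
    assert (hi : 1 <= Cmod (1 + Ci)).
    { apply Rle_trans with (2 := re_le_Cmod _); simpl; rewrite Rplus_0_r, Rabs_R1; lra. }
    generalize (Cmod_ge_0 (moment 0 T - 3 * moment 1 T)); nra.
  - unfold truncated_period.
    rewrite (moment_symmetry 3 0 T), (moment_symmetry 2 1 T) by auto; ring.
Qed.

Lemma ex_period_integral (X : C) :
  ex_RInt_gen (V := C_R_NormedModule) (imag_axis_pullback (period_integrand X))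
    (at_right 0) (Rbar_locally p_infty).
Proof.
  destruct F_1_bound as [K [hK [h0 h1]]].
  assert (hX := Cmod_ge_0 X).
  assert (hm : forall t, 0 < t -> Cmod (imag_axis_pullback (period_integrand X) t)
    <= Cmod (F_1 (Ci * RtoC t)) * (t + Cmod X) ^ 3).
  { intros t ht; unfold imag_axis_pullback, period_integrand.
    rewrite !Cmod_mult, Cmod_Ci, Rmult_1_r, Cmod_pow.
    apply Rmult_le_compat_l; [apply Cmod_ge_0|].
    apply pow_incr; split; [apply Cmod_ge_0|].
    apply Rle_trans with (1 := Cmod_triangle _ _).
    rewrite Cmod_opp, Cmod_mult, Cmod_Ci, Cmod_R, Rabs_pos_eq; lra. }
  apply (ex_improper_of_bounds _ (K * (1 + Cmod X) ^ 3)).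
  - apply Rmult_le_pos; [exact hK | apply pow_le; lra].
  - intros t ht; apply Ccontinuous_mult; [|apply Ccontinuous_const].
    apply Ccontinuous_mult; [now apply F_1_continuous|].
    apply Ccontinuous_pow, Ccontinuous_minus; [|apply Ccontinuous_const].
    apply Ccontinuous_mult; [apply Ccontinuous_const|].
    apply Ccontinuous_RtoC, continuous_id.
  - intros t ht; apply Rle_trans with (1 := hm t (proj1 ht)).
    apply Rmult_le_compat; [apply Cmod_ge_0 | apply pow_le; lra | now apply h0 |].
    apply pow_incr; lra.
  - intros t ht; apply Rle_trans with (1 := hm t ltac:(lra)).
    apply Rle_trans with (K / t ^ 5 * (t * (1 + Cmod X)) ^ 3).
    + apply Rmult_le_compat; [apply Cmod_ge_0 | apply pow_le; lra | now apply h1 |].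
      apply pow_incr; nra.
    + right; field; lra.
Qed.

Lemma truncated_period_limit (X : C) :
  Clim_seq (fun N => truncated_period (INR (S N)) X) (R_1 X).
Proof.
  assert (h := Clim_seq_of_improper _ _ (RInt_gen_correct (V := C_R_CompleteNormedModule) _
    (ex_period_integral X))).
  apply Clim_seq_ext with (2 := h); intros N.
  apply CInt_unique, is_truncated_period.
  rewrite S_INR; generalize (pos_INR N); lra.
Qed.

Lemma moment_relation_limit :
  Clim_seq (fun N => moment 0 (INR (S N)) - 3 * moment 1 (INR (S N)))%C 0.
Proof.
  destruct moment_relation as [B hB].
  assert (hS : forall N, 1 <= INR (S N)).
  { intros N; rewrite S_INR; generalize (pos_INR N); lra. }
  apply is_lim_seq_le_le with (u := fun _ => 0) (w := fun N => Rabs B * / INR (S N)).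
  - intros N; split; [apply Cmod_ge_0|].
    replace (_ - 0)%C with (moment 0 (INR (S N)) - 3 * moment 1 (INR (S N)))%C by ring.
    apply Rle_trans with (1 := hB _ (hS N)).
    assert (hg := gap_pos (INR (S N))).
    apply Rle_trans with (Rabs B * gap (INR (S N))).
    + apply Rmult_le_compat_r; [lra | apply Rle_abs].
    + apply Rmult_le_compat_l; [apply Rabs_pos|].
      unfold gap; apply Rinv_le_contravar; specialize (hS N); nra.
  - apply is_lim_seq_const.
  - replace (Finite 0) with (Rbar_mult (Rabs B) 0) by (simpl; now rewrite Rmult_0_r).
    apply is_lim_seq_scal_l, (is_lim_seq_incr_1 (fun N => / INR N)).
    apply (is_lim_seq_inv INR p_infty); [apply is_lim_seq_INR | discriminate].
Qed.

Theorem theorem3p1 :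
  (forall X : C, ex_imag_axis_int (fun tau : C => F_1 tau * (tau - X) ^ 3)%C) /\
  (forall X : C, R_1 X = R_1 0 * (1 - X ^ 2) * (1 + Ci * X))%C.
Proof.
  split; [exact ex_period_integral|]; intros X.
  set (c := ((1 - X ^ 2) * (1 + Ci * X))%C).
  assert (h : (R_1 X + - c * R_1 0)%C = 0%C).
  { apply (Clim_seq_unique (fun N =>
      truncated_period (INR (S N)) X + - c * truncated_period (INR (S N)) 0)%C).
    - apply Clim_seq_plus; [apply truncated_period_limit|].
      apply (Clim_seq_scal (- c)), truncated_period_limit.
    - (* With [M 3 = M 0] and [M 2 = M 1] the difference of the two sides is a
         multiple of [M 0 - 3 M 1]. *)
      assert (hlim := Clim_seq_scal (X ^ 2 - Ci * X)%C _ _ moment_relation_limit).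
      rewrite Cmult_0_r in hlim.
      apply Clim_seq_ext with (2 := hlim); intros N.
      assert (hN : 1 <= INR (S N)) by (rewrite S_INR; generalize (pos_INR N); lra).
      unfold truncated_period, c.
      rewrite (moment_symmetry 3 0 _ hN), (moment_symmetry 2 1 _ hN) by reflexivity.
      ring. }
  replace (R_1 X) with ((R_1 X + - c * R_1 0) + c * R_1 0)%C by ring.
  rewrite h; unfold c; ring.
Qed.
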